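(* Let $D$ be a unital C*-algebra and let $X\in\mathsf{Bim_{fgp}}(D)$ be full, with left action $D\to\mathrm{End}(X_D)$ given by a unital injective (hence isometric) $*$-homomorphism. Let $\mathcal{O}_X$ be the Cuntz–Pimsner algebra of $X$, let $\mathcal{O}_X^{\mathbb{T}}$ be the fixed-point algebra of its gauge action, and let $E:\mathcal{O}_X\to\mathcal{O}_X^{\mathbb{T}}$ be the faithful conditional expectation obtained by averaging the gauge action. Then $\mathcal{O}_X^{\mathbb{T}}\overset{E}{\subset}\mathcal{O}_X$ is a C*-discrete inclusion. Moreover, there is a (not necessarily outer) action $F$ of $\mathbb{Z}$ on $\mathcal{O}_X^{\mathbb{T}}$ by dualizable bimodules such that $$\mathcal{O}_X\cong \mathcal{O}_X^{\mathbb{T}}\rtimes_{r,F}\mathbb{C}[\mathbb{Z}],$$ the reduced crossed product by $F$ under the group C*-algebra object $\mathbb{C}[\mathbb{Z}]$.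
   Context: Bimodules. For unital C*-algebras $A,B$, a right C*-correspondence from $A$ to $B$ is a right Hilbert $B$-module $X$ (inner product $\langle\cdot\mid\cdot\rangle_B$, linear in the second variable) with a unital $*$-homomorphism from $A$ into the adjointable operators (written $a\rhd\xi$; the right action is $\xi\lhd b$). Left C*-correspondences are defined symmetrically, with left $A$-valued inner product ${}_A\langle\cdot,\cdot\rangle$ linear in the first variable. A right C*-correspondence $X$ from $A$ to $B$ lies in $\mathsf{Bim_{fgp}}(A\to B)$ if it also carries a left $A$-valued inner product making it a left C*-correspondence, the two inner products induce equivalent norms, and $X$ has a finite right Pimsner–Popa basis $\{u_i\}$ ($\xi=\sum_i u_i\lhd\langle u_i\mid\xi\rangle_B$ for all $\xi$) and a finite left Pimsner–Popa basis $\{v_j\}$ ($\xi=\sum_j {}_A\langle\xi,v_j\rangle\rhd v_j$ for all $\xi$). Such bimodules are called dualizable, or fgp; $\mathsf{Bim_{fgp}}(A):=\mathsf{Bim_{fgp}}(A\to A)$. Morphisms are adjointable bimodule maps, and $\boxtimes_A$ is the relative tensor product. $X\in \mathsf{Bim_{fgp}}(D)$ is full if $\mathrm{span}\{\langle\eta\mid\xi\rangle_D\}$ is dense in $D$. Cuntz–Pimsner algebra. For $X$ as in the statement let $\mathcal{F}(X)=\overline{\bigoplus_{n\ge0}X^{\boxtimes_D n}}$ (with $X^{\boxtimes_D 0}=D$) be the Fock right Hilbert $D$-module. Let $\varphi_\infty(d)$ be the diagonal left action of $d\in D$, and $\tau_\infty(\xi)$ the creation operator $\zeta\mapsto\xi\boxtimes\zeta$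 for $\xi\in X$. Let $\varphi,\tau$ be their compositions with the quotient map $\mathrm{End}(\mathcal{F}(X)_D)\to\mathrm{End}(\mathcal{F}(X)_D)/\mathcal{K}(\mathcal{F}(X)_D)$, where $\mathrm{End}$ denotes adjointable operators and $\mathcal K$ the $D$-compact operators. Then $\mathcal{O}_X:=C^*(\varphi(D),\tau(X))$. The gauge action $\gamma$ of $\mathbb{T}$ is $\gamma_z(\varphi(d))=\varphi(d)$, $\gamma_z(\tau(\xi))=z\tau(\xi)$, and $E(x)=\int_{\mathbb{T}}\gamma_z(x)\,d\mu(z)$ with $\mu$ the normalized Haar measure. C*-discreteness. Let $A\subset B$ be a unital inclusion of C*-algebras with a faithful conditional expectation $E:B\to A$. The projective quasi-normalizer $\mathsf{PQN}(A\subset B)$ is the set of $b\in B$ that lie in some $A$-$A$ sub-bimodule $K\subset B$ which, with right inner product $\langle x\mid y\rangle_A=E(x^*y)$, belongs to $\mathsf{Bim_{fgp}}(A)$. The inclusion is C*-discrete if $\mathsf{PQN}(A\subset B)$ is norm-dense in $B$. Actions and crossed products. $\mathsf{Hilb_{fd}}(\mathbb{Z})$ is the unitary tensor category of finite-dimensional $\mathbb{Z}$-graded Hilbert spaces, with simple objects $\mathbb{C}_k$ and $\mathbb{C}_k\otimes\mathbb{C}_\ell=\mathbb{C}_{k+\ell}$. An action of $\mathbb{Z}$ on a unital C*-algebra $A$ by dualizable bimodules is a unitary tensor functor $F:\mathsf{Hilb_{fd}}(\mathbb{Z})\to\mathsf{Bim_{fgp}}(A)$. It thus gives bimodules $F(\mathbb{C}_k)$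 with $F(\mathbb{C}_0)=A$ and unitary bimodule maps $F^2_{k,\ell}:F(\mathbb{C}_k)\boxtimes_AF(\mathbb{C}_\ell)\to F(\mathbb{C}_{k+\ell})$ satisfying associativity and unitality. It is outer if $F$ is fully faithful. $\mathbb{C}[\mathbb{Z}]$ is the connected C*-algebra object with $\mathbb{C}[\mathbb{Z}](k)=\mathbb{C}$ for every $k$ and the group multiplication. The algebraic direct sum $\bigoplus_kF(\mathbb{C}_k)\otimes\mathbb{C}[\mathbb{Z}](k)=\bigoplus_k F(\mathbb{C}_k)$ is a unital $*$-algebra with product $\xi\cdot\eta=F^2_{k,\ell}(\xi\boxtimes\eta)$ for $\xi\in F(\mathbb{C}_k)$, $\eta\in F(\mathbb{C}_\ell)$, and with $\xi^*\in F(\mathbb{C}_{-k})$ the element determined by $\xi^*\cdot\eta=\langle\xi\mid\eta\rangle_A$ for $\eta\in F(\mathbb{C}_k)$. The reduced crossed product $A\rtimes_{r,F}\mathbb{C}[\mathbb{Z}]$ is its completion in the operator norm of left multiplication on the right Hilbert $A$-module direct sum of the $F(\mathbb{C}_k)$. *)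

(* Defs.v *)
From HB Require Import structures.
From mathcomp Require Import all_boot all_order all_algebra.
From mathcomp Require Import complex.
From mathcomp Require Import all_classical all_reals all_analysis.

Set Implicit Arguments.
Unset Strict Implicit.
Unset Printing Implicit Defensive.

Import Order.TTheory GRing.Theory Num.Theory.
Import numFieldNormedType.Exports.

Local Open Scope classical_set_scope.
Local Open Scope complex_scope.
Local Open Scope ring_scope.

Reserved Notation "x ** y" (at level 40, left associativity).
Reserved Notation "a *> x" (at level 41, right associativity).
Reserved Notation "x <* b" (at level 40, left associativity).

(** * Unital C*-algebras

The scalars are [R[i]] for [R : realType], and norms are valued in [R[i]] (as
for any [normedModType R[i]]), where [x <= y] means that [y - x] is real and
nonnegative. The product is a separate operation [**] because MathComp's
hierarchies of rings and of normed modules have no join below [numDomainType]. *)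

HB.mixin Record NormedModule_isCStar (R : realType) (A : Type)
    of CompleteNormedModule R[i] A := {
  cmul : A -> A -> A;
  cone : A;
  star : A -> A;
  cmulA : forall x y z : A, cmul x (cmul y z) = cmul (cmul x y) z;
  cmul1l : forall x : A, cmul cone x = x;
  cmul1r : forall x : A, cmul x cone = x;
  cmulDl : forall x y z : A, cmul (x + y) z = cmul x z + cmul y z;
  cmulDr : forall x y z : A, cmul x (y + z) = cmul x y + cmul x z;
  cmulZl : forall (c : R[i]) (x y : A), cmul (c *: x) y = c *: cmul x y;
  cmulZr : forall (c : R[i]) (x y : A), cmul x (c *: y) = c *: cmul x y;
  starK : forall x : A, star (star x) = x;
  starD : forall x y : A, star (x + y) = star x + star y;
  starZ : forall (c : R[i]) (x : A), star (c *: x) = c^*%C *: star x;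
  starM : forall x y : A, star (cmul x y) = cmul (star y) (star x);
  cstar_normM : forall x y : A, `|cmul x y| <= `|x| * `|y|;
  cstar_normE : forall x : A, `|cmul (star x) x| = `|x| ^+ 2
}.

#[short(type="cstarType")]
HB.structure Definition CStar (R : realType) :=
  {A of CompleteNormedModule R[i] A & NormedModule_isCStar R A}.

Notation "x ** y" := (cmul x y) : ring_scope.

Definition cpos (R : realType) (A : cstarType R) (a : A) : Prop :=
  exists b : A, a = star b ** b.

Record star_hom (R : realType) (A B : cstarType R) (f : A -> B) : Prop := {
  star_homD : forall x y, f (x + y) = f x + f y;
  star_homZ : forall (c : R[i]) x, f (c *: x) = c *: f x;
  star_homM : forall x y, f (x ** y) = f x ** f y;
  star_hom1 : f cone = cone;
  star_homS : forall x, f (star x) = star (f x)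
}.

Definition star_iso (R : realType) (A B : cstarType R) : Prop :=
  exists f : A -> B, star_hom f /\ bijective f.

(** A unital inclusion [A ⊂ B] is given by an isometric unital
*-homomorphism, so that [A] may be a type of its own. *)
Definition cstar_incl (R : realType) (A B : cstarType R) (f : A -> B) : Prop :=
  star_hom f /\ forall x, `|f x| = `|x|.

Definition lin_span (R : realType) (V : lmodType R[i]) (S : set V) : set V :=
  [set x | exists (n : nat) (c : 'I_n -> R[i]) (v : 'I_n -> V),
    (forall i, S (v i)) /\ x = \sum_(i < n) c i *: v i].

Definition cstar_subalg (R : realType) (B : cstarType R) (S : set B) : Prop :=
  [/\ closed S, S 0,
      forall (c : R[i]) x y, S x -> S y -> S (c *: x + y),
      forall x y, S x -> S y -> S (x ** y) &
      forall x, S x -> S (star x)].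

Definition cstar_gen (R : realType) (B : cstarType R) (G : set B) : set B :=
  smallest (@cstar_subalg R B) G.

(** * Hilbert modules *)

(** The norm of the underlying Banach space is required to be the norm of the
inner product; this contains both definiteness and completeness. *)
Record hilbMod (R : realType) (B : cstarType R) := HilbMod {
  hm_sort :> completeNormedModType R[i];
  ract : hm_sort -> B -> hm_sort;
  inner : hm_sort -> hm_sort -> B;
  ractDl : forall x y b, ract (x + y) b = ract x b + ract y b;
  ractDr : forall x b c, ract x (b + c) = ract x b + ract x c;
  ractZl : forall (k : R[i]) x b, ract (k *: x) b = k *: ract x b;
  ractZr : forall (k : R[i]) x b, ract x (k *: b) = k *: ract x b;
  ractM : forall x b c, ract x (b ** c) = ract (ract x b) c;
  ract1 : forall x, ract x cone = x;
  innerD : forall x y z, inner x (y + z) = inner x y + inner x z;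
  innerZ : forall (k : R[i]) x y, inner x (k *: y) = k *: inner x y;
  innerM : forall x y b, inner x (ract y b) = inner x y ** b;
  inner_star : forall x y, star (inner x y) = inner y x;
  inner_pos : forall x, cpos (inner x x);
  inner_norm : forall x, `|x| ^+ 2 = `|inner x x|
}.

Notation "x <* b" := (ract x b) : ring_scope.

Section Adjointable.
Context {R : realType} {B : cstarType R}.

Definition adjoint_pair (X Y : hilbMod B) (T : X -> Y) (S : Y -> X) : Prop :=
  forall x y, inner (T x) y = inner x (S y).

Definition adjointable (X Y : hilbMod B) (T : X -> Y) : Prop :=
  exists S : Y -> X, adjoint_pair T S.

Definition opbound (X Y : hilbMod B) (T : X -> Y) (c : R[i]) : Prop :=
  0 <= c /\ forall x, `|T x| <= c * `|x|.

Definition is_opnorm (X Y : hilbMod B) (T : X -> Y) (c : R[i]) : Prop :=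
  opbound T c /\ forall c', opbound T c' -> c <= c'.

Definition finite_rank (X : hilbMod B) (K : X -> X) : Prop :=
  exists (n : nat) (u v : 'I_n -> X),
    forall x, K x = \sum_(i < n) u i <* inner (v i) x.

Definition compact_op (X : hilbMod B) (T : X -> X) : Prop :=
  adjointable T /\
  forall e : R[i], 0 < e ->
    exists K, finite_rank K /\ opbound (fun x => T x - K x) e.

(** [q], restricted to the adjointable operators of [X], is a quotient map
[End(X) -> End(X)/K(X)]; its values on other functions are irrelevant. *)
Record quotient_by_compacts (X : hilbMod B) (Q : cstarType R)
    (q : (X -> X) -> Q) : Prop := {
  qcD : forall S T : X -> X, adjointable S -> adjointable T ->
    q (fun x => S x + T x) = q S + q T;
  qcZ : forall (c : R[i]) (T : X -> X), adjointable T ->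
    q (fun x => c *: T x) = c *: q T;
  qcM : forall S T : X -> X, adjointable S -> adjointable T ->
    q (S \o T) = q S ** q T;
  qc1 : q id = cone;
  qcS : forall S T : X -> X, adjoint_pair S T -> q T = star (q S);
  qc_surj : forall y : Q, exists2 T : X -> X, adjointable T & q T = y;
  qc_ker : forall T : X -> X, adjointable T -> (q T = 0 <-> compact_op T);
  qc_norm_le : forall (T K : X -> X) (c : R[i]),
    adjointable T -> compact_op K -> opbound (fun x => T x - K x) c ->
    `|q T| <= c;
  qc_norm_inf : forall (T : X -> X) (e : R[i]), adjointable T -> 0 < e ->
    exists2 K, compact_op K & opbound (fun x => T x - K x) (`|q T| + e)
}.

(** [H], with the embeddings [j], is the completed direct sum of the [Y i]. *)
Record hilbert_sum (I : Type) (Y : I -> hilbMod B) (H : hilbMod B)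
    (j : forall i, Y i -> H) : Prop := {
  hsD : forall i x y, j i (x + y) = j i x + j i y;
  hsZ : forall i (c : R[i]) x, j i (c *: x) = c *: j i x;
  hsM : forall i x b, j i (x <* b) = j i x <* b;
  hs_inner : forall i x y, inner (j i x) (j i y) = inner x y;
  hs_orth : forall i k x y, i <> k -> inner (j i x) (j k y) = 0;
  hs_dense : dense (lin_span (\bigcup_i range (@j i)))
}.

End Adjointable.

(** * C*-correspondences *)

Record corr (R : realType) (A B : cstarType R) := Corr {
  corr_mod :> hilbMod B;
  lact : A -> corr_mod -> corr_mod;
  lactD : forall a b x, lact (a + b) x = lact a x + lact b x;
  lactZ : forall (k : R[i]) a x, lact (k *: a) x = k *: lact a x;
  lactM : forall a b x, lact (a ** b) x = lact a (lact b x);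
  lact1 : forall x, lact cone x = x;
  lact_star : forall a, adjoint_pair (lact a) (lact (star a))
}.

Notation "a *> x" := (lact a x) : ring_scope.

Section Correspondences.
Context {R : realType}.
Implicit Types A B C D : cstarType R.

(** [lin] makes [X] a left correspondence. Completeness for the norm of [lin]
is not repeated: in [fgp] this norm is equivalent to the complete norm of [X]. *)
Record left_corr A B (X : corr A B) (lin : X -> X -> A) : Prop := {
  linD : forall x y z, lin (x + y) z = lin x z + lin y z;
  linZ : forall (k : R[i]) x y, lin (k *: x) y = k *: lin x y;
  linM : forall a x y, lin (a *> x) y = a ** lin x y;
  lin_star : forall x y, star (lin x y) = lin y x;
  lin_pos : forall x, cpos (lin x x);
  lin_def : forall x, lin x x = 0 -> x = 0;
  lin_ract : forall x y b, lin (x <* b) y = lin x (y <* star b)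
}.

Definition fgp A B (X : corr A B) : Prop :=
  exists lin : X -> X -> A,
    [/\ left_corr lin,
        exists c c' : R[i], [/\ 0 < c, 0 < c' & forall x,
          c * `|x| <= sqrtC `|lin x x| <= c' * `|x|],
        exists (n : nat) (u : 'I_n -> X),
          forall x, x = \sum_(i < n) u i <* inner (u i) x &
        exists (m : nat) (v : 'I_m -> X),
          forall x, x = \sum_(i < m) lin x (v i) *> v i].

Definition full D (X : corr D D) : Prop :=
  dense (lin_span [set d : D | exists x y : X, d = inner x y]).

Definition lact_injective A B (X : corr A B) : Prop :=
  forall a b : A, (forall x : X, a *> x = b *> x) -> a = b.

Record bimod_map A B (X Y : corr A B) (T : X -> Y) : Prop := {
  bmD : forall x y, T (x + y) = T x + T y;
  bmZ : forall (c : R[i]) x, T (c *: x) = c *: T x;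
  bm_lact : forall a x, T (a *> x) = a *> T x;
  bm_ract : forall x b, T (x <* b) = T x <* b;
  bm_adj : adjointable T
}.

Definition unitary_bimod_map A B (X Y : corr A B) (U : X -> Y) : Prop :=
  bimod_map U /\
  exists V : Y -> X, [/\ adjoint_pair U V, cancel U V & cancel V U].

(** [Z], with [t x y] the elementary tensors, is the relative tensor product
of [X] and [Y] over [B]. *)
Record rel_tensor A B C (X : corr A B) (Y : corr B C) (Z : corr A C)
    (t : X -> Y -> Z) : Prop := {
  rtDl : forall x x' y, t (x + x') y = t x y + t x' y;
  rtDr : forall x y y', t x (y + y') = t x y + t x y';
  rtZl : forall (c : R[i]) x y, t (c *: x) y = c *: t x y;
  rtZr : forall (c : R[i]) x y, t x (c *: y) = c *: t x y;
  rt_bal : forall x b y, t (x <* b) y = t x (b *> y);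
  rt_lact : forall a x y, t (a *> x) y = a *> t x y;
  rt_ract : forall x y c, t x (y <* c) = t x y <* c;
  rt_inner : forall x x' y y',
    inner (t x y) (t x' y') = inner y (inner x x' *> y');
  rt_dense : dense (lin_span [set z | exists x y, z = t x y])
}.

End Correspondences.

Section IdCorr.
Context {R : realType} (D : cstarType R).

Definition idmod : hilbMod D.
Proof.
refine (@HilbMod R D D (fun x b => x ** b) (fun x y => star x ** y)
  _ _ _ _ _ _ _ _ _ _ _ _).
- exact: cmulDl.
- exact: cmulDr.
- by move=> k x b; rewrite cmulZl.
- by move=> k x b; rewrite cmulZr.
- exact: cmulA.
- exact: cmul1r.
- by move=> x y z; rewrite cmulDr.
- by move=> k x y; rewrite cmulZr.
- by move=> x y b; rewrite cmulA.
- by move=> x y; rewrite starM starK.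
- by move=> x; exists x.
- by move=> x; rewrite cstar_normE.
Defined.

Definition idcorr : corr D D.
Proof.
refine (@Corr R D D idmod (fun a x => a ** x) _ _ _ _ _).
- exact: cmulDl.
- by move=> k a x; rewrite cmulZl.
- by move=> a b x; rewrite cmulA.
- exact: cmul1l.
- by move=> a x y; rewrite /= starM cmulA.
Defined.

End IdCorr.

(** * Cuntz-Pimsner algebras *)

Section CuntzPimsner.
Context {R : realType} {D : cstarType R}.

(** [tpow Y n] is the [n]-th tensor power once [Y n] is [X ⊠ tpow Y n] for all
[n]; its 0-th term is [D] itself. *)
Definition tpow (Y : nat -> corr D D) (n : nat) : corr D D :=
  if n is m.+1 then Y m else idcorr D.

(** The construction of the Cuntz-Pimsner algebra of [X]: every stage (tensor
powers, Fock module, quotient by the compacts) is pinned down up to unique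
isomorphism by its axioms. The maps [cp_phi_inf d] and [cp_tau_inf x] are
determined by their values on the dense span of the [cp_emb n]. *)
Record cuntz_pimsner (X : corr D D) := CuntzPimsner {
  cp_pow : nat -> corr D D;
  cp_tens : forall n, X -> tpow cp_pow n -> tpow cp_pow n.+1;
  cp_tensP : forall n, rel_tensor (@cp_tens n);

  cp_fock : hilbMod D;
  cp_emb : forall n, tpow cp_pow n -> cp_fock;
  cp_fockP : hilbert_sum cp_emb;
  cp_phi_inf : D -> cp_fock -> cp_fock;
  cp_phi_inf_adj : forall d, adjointable (cp_phi_inf d);
  cp_phi_infE : forall d n z, cp_phi_inf d (@cp_emb n z) = cp_emb (d *> z);
  cp_tau_inf : X -> cp_fock -> cp_fock;
  cp_tau_inf_adj : forall x, adjointable (cp_tau_inf x);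
  cp_tau_infE : forall x n z,
    cp_tau_inf x (@cp_emb n z) = cp_emb (cp_tens x z);

  cp_quot : cstarType R;
  cp_q : (cp_fock -> cp_fock) -> cp_quot;
  cp_qP : quotient_by_compacts cp_q;

  cp_alg :> cstarType R;
  cp_incl : cp_alg -> cp_quot;
  cp_inclP : cstar_incl cp_incl;
  cp_incl_range : range cp_incl =
    cstar_gen (range (cp_q \o cp_phi_inf) `|` range (cp_q \o cp_tau_inf));
  cp_phi : D -> cp_alg;
  cp_phiE : forall d, cp_incl (cp_phi d) = cp_q (cp_phi_inf d);
  cp_tau : X -> cp_alg;
  cp_tauE : forall x, cp_incl (cp_tau x) = cp_q (cp_tau_inf x)
}.

(** The circle is [{z : R[i] | `|z| = 1}]. *)
Record gauge_action (X : corr D D) (O : cuntz_pimsner X)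
    (gam : R[i] -> O -> O) : Prop := {
  ga_hom : forall z, `|z| = 1 -> star_hom (gam z);
  ga_1 : forall x, gam 1 x = x;
  ga_M : forall z w x, `|z| = 1 -> `|w| = 1 -> gam (z * w) x = gam z (gam w x);
  ga_phi : forall z d, `|z| = 1 -> gam z (cp_phi O d) = cp_phi O d;
  ga_tau : forall z x, `|z| = 1 -> gam z (cp_tau O x) = z *: cp_tau O x
}.

End CuntzPimsner.

Definition fixed_points (R : realType) (B : cstarType R)
    (gam : R[i] -> B -> B) : set B :=
  [set x | forall z, `|z| = 1 -> gam z x = x].

Definition circle_point (R : realType) (t : R) : R[i] :=
  (cos (2 * pi * t)) +i* (sin (2 * pi * t)).

(** [v] is the integral of [f] over the circle for the normalized Haar measure,
as the norm limit of the Riemann sums of [t |-> f (exp (2 i pi t))] over tagged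
partitions [p 0 <= s 0 <= p 1 <= ... <= p n] of [[0, 1]]. *)
Definition circle_integral (R : realType) (V : normedModType R[i])
    (f : R[i] -> V) (v : V) : Prop :=
  forall e : R[i], 0 < e -> exists2 d : R, 0 < d &
    forall (n : nat) (p s : nat -> R), p 0%N = 0 -> p n = 1 ->
      (forall i, (i < n)%N -> p i <= s i <= p i.+1) ->
      (forall i, (i < n)%N -> p i.+1 - p i < d) ->
      `|\sum_(i < n) (p i.+1 - p i)%:C *: f (circle_point (s i)) - v| < e.

(** * C*-discrete inclusions *)

Section Discrete.
Context {R : realType} {A B : cstarType R}.

Record faithful_cond_exp (iota : A -> B) (E : B -> A) : Prop := {
  ceD : forall x y, E (x + y) = E x + E y;
  ceZ : forall (c : R[i]) x, E (c *: x) = c *: E x;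
  ce_id : forall a, E (iota a) = a;
  ce_bimod : forall a x b, E (iota a ** x ** iota b) = a ** E x ** b;
  ce_pos : forall x, cpos (E (star x ** x));
  ce_norm : forall x, `|E x| <= `|x|;
  ce_faithful : forall x, E (star x ** x) = 0 -> x = 0
}.

(** The sub-bimodule of [B] is the image of [k : K -> B]; [left_corr] and the
bases of [K] come with [fgp K]. *)
Definition PQN (iota : A -> B) (E : B -> A) : set B :=
  [set b | exists (K : corr A A) (k : K -> B),
    [/\ fgp K,
        (injective k /\ forall (c : R[i]) x y, k (c *: x + y) = c *: k x + k y),
        forall a x b, k (a *> x <* b) = iota a ** k x ** iota b,
        forall x y, inner x y = E (star (k x) ** k y) &
        range k b]].

Definition cstar_discrete (iota : A -> B) (E : B -> A) : Prop :=
  [/\ cstar_incl iota, faithful_cond_exp iota E & dense (PQN iota E)].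

End Discrete.

(** * The unitary tensor category Hilb_fd(Z)

A finite-dimensional Z-graded Hilbert space is represented by a homogeneous
orthonormal basis [gidx] and the degrees [gdeg] of its elements, and morphisms
by their matrices. The tensor product has the product basis, so that
associators and unitors are permutation matrices. *)

Record ghilb := GHilb { gidx : finType; gdeg : gidx -> int }.

Section GradedHilbertSpaces.
Context {R : realType}.
Implicit Types U V W : ghilb.

Record ghom V W := GHom {
  gmx :> gidx W -> gidx V -> R[i];
  gmx_deg : forall w v, gdeg w <> gdeg v -> gmx w v = 0
}.

Definition gtens V W : ghilb :=
  GHilb (fun x : gidx V * gidx W => gdeg x.1 + gdeg x.2).

Definition gline (k : int) : ghilb := GHilb (fun _ : unit => k).

(** The matrices below are given by their entries; degree preservation is
enforced by discarding the entries between different degrees, which are zero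
anyway except possibly in [gcan]. *)
Definition gmatrix V W (f : gidx W -> gidx V -> R[i]) : ghom V W.
Proof.
exists (fun w v => if gdeg w == gdeg v then f w v else 0).
by move=> w v /eqP /negbTE ->.
Defined.

Definition gid V : ghom V V := gmatrix (fun v v' => (v == v')%:R).
Definition gcomp U V W (g : ghom V W) (f : ghom U V) : ghom U W :=
  gmatrix (fun w u => \sum_v g w v * f v u).
Definition gaxpy V W (c : R[i]) (f g : ghom V W) : ghom V W :=
  gmatrix (fun w v => c * f w v + g w v).
Definition gdag V W (f : ghom V W) : ghom W V :=
  gmatrix (fun v w => (f w v)^*%C).
Definition gtensm V V' W W' (f : ghom V V') (g : ghom W W') :
    ghom (gtens V W) (gtens V' W') :=
  gmatrix (fun (y : gidx (gtens V' W')) (x : gidx (gtens V W)) =>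
    f y.1 x.1 * g y.2 x.2).
Definition gassoc U V W : ghom (gtens (gtens U V) W) (gtens U (gtens V W)) :=
  gmatrix (fun (y : gidx (gtens U (gtens V W)))
               (x : gidx (gtens (gtens U V) W)) =>
    (y == (x.1.1, (x.1.2, x.2)))%:R).
Definition glunit V : ghom (gtens (gline 0) V) V :=
  gmatrix (fun v (x : gidx (gtens (gline 0) V)) => (v == x.2)%:R).
Definition grunit V : ghom (gtens V (gline 0)) V :=
  gmatrix (fun v (x : gidx (gtens V (gline 0))) => (v == x.1)%:R).
(** [C_k ⊗ C_l = C_m] for [m = k + l] (and zero otherwise). *)
Definition gcan (k l m : int) : ghom (gtens (gline k) (gline l)) (gline m) :=
  gmatrix (fun _ _ => 1).

End GradedHilbertSpaces.

(** * Actions of Z and their reduced crossed products *)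

Section Actions.
Context {R : realType} {A : cstarType R}.

(** Unitary tensor functors from Hilb_fd(Z) to Bim_fgp(A); [zt] provides the
elementary tensors of the relative tensor products [zT V W] of [zF V] and
[zF W], and the coherence axioms are stated on elementary tensors. *)
Record Zaction := ZAction {
  zF :> ghilb -> corr A A;
  zF_fgp : forall V, fgp (zF V);
  zmap : forall V W, ghom (R := R) V W -> zF V -> zF W;
  zmap_bimod : forall V W (f : ghom V W), bimod_map (zmap f);
  zmap_id : forall V x, zmap (gid V) x = x;
  zmap_comp : forall U V W (g : ghom V W) (f : ghom U V) x,
    zmap (gcomp g f) x = zmap g (zmap f x);
  zmap_lin : forall V W (c : R[i]) (f g : ghom V W) x,
    zmap (gaxpy c f g) x = c *: zmap f x + zmap g x;
  zmap_dag : forall V W (f : ghom V W), adjoint_pair (zmap f) (zmap (gdag f));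

  zT : ghilb -> ghilb -> corr A A;
  zt : forall V W, zF V -> zF W -> zT V W;
  ztP : forall V W, rel_tensor (@zt V W);
  zF2 : forall V W, zT V W -> zF (gtens V W);
  zF2_unitary : forall V W, unitary_bimod_map (@zF2 V W);
  zF2_nat : forall V V' W W' (f : ghom V V') (g : ghom W W') x y,
    zmap (gtensm f g) (zF2 (zt x y)) = zF2 (zt (zmap f x) (zmap g y));
  zF0 : idcorr A -> zF (gline 0);
  zF0_unitary : unitary_bimod_map zF0;
  zF2_assoc : forall U V W x y z,
    zmap (gassoc U V W) (zF2 (zt (zF2 (zt x y)) z)) =
    zF2 (zt x (zF2 (zt y z)));
  zF2_lunit : forall V (a : A) (x : zF V),
    zmap (glunit V) (zF2 (zt (zF0 a) x)) = a *> x;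
  zF2_runit : forall V (x : zF V) (a : A),
    zmap (grunit V) (zF2 (zt x (zF0 a))) = x <* a
}.

(** For [m = k + l], the product of the algebraic direct sum of the [F C_k]. *)
Definition zmul (F : Zaction) (k l m : int)
    (x : F (gline k)) (y : F (gline l)) : F (gline m) :=
  zmap (gcan k l m) (zF2 (zt x y)).

(** [rc_in] sends the algebraic direct sum of the [F C_k] to the crossed
product: it is a unital *-homomorphism with dense range, and it is isometric
for the operator norm of left multiplication on the completed direct sum
[rc_mod]. *)
Record reduced_crossed (F : Zaction) := ReducedCrossed {
  rc_mod : hilbMod A;
  rc_emb : forall k, F (gline k) -> rc_mod;
  rc_modP : hilbert_sum rc_emb;
  rc_lmul : forall k, F (gline k) -> rc_mod -> rc_mod;
  rc_lmul_adj : forall k (x : F (gline k)), adjointable (rc_lmul x);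
  rc_lmulE : forall k l (x : F (gline k)) (y : F (gline l)),
    rc_lmul x (rc_emb y) = rc_emb (zmul (k + l) x y);

  rc_alg :> cstarType R;
  rc_in : forall k, F (gline k) -> rc_alg;
  rc_inD : forall k (x y : F (gline k)), rc_in (x + y) = rc_in x + rc_in y;
  rc_inZ : forall k (c : R[i]) (x : F (gline k)), rc_in (c *: x) = c *: rc_in x;
  rc_inM : forall k l (x : F (gline k)) (y : F (gline l)),
    rc_in x ** rc_in y = rc_in (zmul (k + l) x y);
  rc_in1 : rc_in (zF0 F cone) = cone;
  rc_inS : forall k (x : F (gline k)), exists2 x' : F (gline (- k)),
    (forall y, zmul 0 x' y = zF0 F (inner x y)) & rc_in x' = star (rc_in x);
  rc_in_norm : forall n (k : 'I_n -> int) (x : forall i, F (gline (k i))),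
    is_opnorm (fun h => \sum_(i < n) rc_lmul (x i) h)
              `|\sum_(i < n) rc_in (x i)|;
  rc_in_dense : dense (lin_span (\bigcup_k range (@rc_in k)))
}.

End Actions.

Arguments Zaction {R} A.

(* Main.v *)
(** The gauge action grades [O_X] by its spectral subspaces [B_k], with [B_0] the
fixed-point algebra, and the average [E] kills [B_k] for [k <> 0]. If [u] is a right
frame of [X], then [1 - sum tau_inf(u_i) tau_inf(u_i)^*] is the rank-one projection on
the vacuum, so [sum tau(u_i) tau(u_i)^* = 1] in [O_X]; and fullness gives [v] with
[sum <v_j | v_j> = 1], hence [sum tau(v_j)^* tau(v_j) = 1]. Products of the [tau(u_i)]
and [tau(v_j)^*] then give, for every [k], finitely many [w] in [B_k] with
[sum w w^* = 1]. Therefore [B_k] with [x^* y] and [x y^*] is a dualizable bimodule over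
[B_0], multiplication identifies [B_k ⊠ B_l] with [B_(k+l)], and [F(C_k) = B_k] is the
action. Finite sums of the [B_k] are dense, which gives discreteness; and since [E] is
faithful, left multiplication on the completed direct sum of the [B_k] is isometric on
[O_X], so that the reduced crossed product is [O_X] itself.

Positivity of [b^* b] and square roots are obtained from norm-convergent iterations
rather than from the Gelfand representation. *)

Require Import Defs.
From HB Require Import structures.
From mathcomp Require Import all_boot all_order all_algebra.
From mathcomp Require Import complex.
From mathcomp Require Import all_classical all_reals all_analysis.
From mathcomp Require Import ring lra.

Set Implicit Arguments.
Unset Strict Implicit.
Unset Printing Implicit Defensive.

Import Order.TTheory GRing.Theory Num.Theory.
Import numFieldNormedType.Exports.

Local Open Scope classical_set_scope.
Local Open Scope complex_scope.
Local Open Scope ring_scope.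

(** * Real-valued norms and limits of sequences *)

(** The proof is cut in two at [strong_grading]: from there on only the grading, the expectation,
    the density of homogeneous sums and the frames are used. Every bimodule built after that is a
    space of square-summable families in [B] whose entry at [i] lies in [B_(deg i)]. A finite index
    set gives [F(V)] and the sub-bimodules needed for discreteness; the index set Z gives the
    Hilbert module of the crossed product. The frames make every element of [F(V (x) W)] a finite
    sum of elementary tensors, so this space is itself a relative tensor product: the tensorator is
    the identity, and coherence becomes associativity in [B].

    The obstacle is the order. Square roots and norm comparisons are needed before [b^* b] is known
    to be positive. Positivity is therefore introduced by a norm condition, [pos], which handles
    sums, limits and square roots directly and is identified with [cpos] only after the
    Kelley-Vaught argument. Double commutation, [bicomm], stands in for functional calculus, and
    negative parts are formed from the square root of a square. *)

Section RealNorm.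
Context {R : realType}.

(** Norms take values in the partially ordered field [R[i]]; their real parts lie in [R], where
    [lra] and [nra] apply. *)
Definition nrm (V : normedModType R[i]) (x : V) : R := complex.Re `|x|.

Lemma normE (V : normedModType R[i]) (x : V) : `|x| = (nrm x)%:C.
Proof. by rewrite /nrm RRe_real // realE normr_ge0. Qed.

Section Theory.
Variable V : normedModType R[i].
Implicit Types x y z : V.

Lemma nrm_ge0 x : 0 <= nrm x.
Proof. by rewrite -lecR -normE normr_ge0. Qed.

Lemma nrm0 : nrm (0 : V) = 0.
Proof. by apply: complexI; rewrite -normE normr0. Qed.

Lemma nrm0_eq0 x : nrm x = 0 -> x = 0.
Proof. by move=> h; apply/normr0_eq0; rewrite normE h. Qed.

Lemma nrmN x : nrm (- x) = nrm x.
Proof. by rewrite /nrm normrN. Qed.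

Lemma nrmBC x y : nrm (x - y) = nrm (y - x).
Proof. by rewrite -nrmN opprB. Qed.

Lemma nrmD x y : nrm (x + y) <= nrm x + nrm y.
Proof. by rewrite -lecR rmorphD /= -!normE ler_normD. Qed.

Lemma nrmB x y : nrm (x - y) <= nrm x + nrm y.
Proof. by rewrite -(nrmN y) nrmD. Qed.

Lemma nrm_dist z x y : nrm (x - y) <= nrm (x - z) + nrm (z - y).
Proof. by have := nrmD (x - z) (z - y); rewrite addrA subrK. Qed.

Lemma nrm_leD x y : nrm x <= nrm y + nrm (x - y).
Proof. by have := nrmD y (x - y); rewrite addrC subrK. Qed.

Lemma nrmZ (c : R[i]) x : nrm (c *: x) = complex.Re `|c| * nrm x.
Proof.
by apply: complexI; rewrite -normE normrZ !normE -rmorphM.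
Qed.

Lemma nrmZr (r : R) x : nrm (r%:C *: x) = `|r| * nrm x.
Proof. by rewrite nrmZ normc_def /= expr0n addr0 sqrtr_sqr. Qed.

Lemma nrmZ1 (c : R[i]) x : `|c| = 1 -> nrm (c *: x) = nrm x.
Proof. by move=> h; rewrite nrmZ h mul1r. Qed.

Lemma nrm_sum (I : Type) (s : seq I) (P : pred I) (f : I -> V) :
  nrm (\sum_(i <- s | P i) f i) <= \sum_(i <- s | P i) nrm (f i).
Proof.
elim/big_ind2: _ => [|x a y b ha hb|//]; first by rewrite nrm0.
exact: le_trans (nrmD _ _) (lerD ha hb).
Qed.

Lemma nrm_arb0 x : (forall e : R, 0 < e -> nrm x <= e) -> x = 0.
Proof.
move=> h; apply: nrm0_eq0; apply/eqP; rewrite eq_le nrm_ge0 andbT.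
by apply/ler_addgt0Pr => e /h; rewrite add0r.
Qed.

Lemma sub_nrm_arb0 x y : (forall e : R, 0 < e -> nrm (x - y) <= e) -> x = y.
Proof. by move=> /nrm_arb0 /eqP; rewrite subr_eq0 => /eqP. Qed.

End Theory.

(** Sequences with real, non-strict bounds; the lemmas up to [cauchy_tendsto] translate between such
    estimates and the topology. *)
Definition tendsto (V : normedModType R[i]) (u : nat -> V) (l : V) : Prop :=
  forall e : R, 0 < e -> exists N, forall n, (N <= n)%N -> nrm (u n - l) <= e.

Lemma pos_complexE (e : R[i]) : 0 < e -> exists2 r : R, 0 < r & e = r%:C.
Proof.
move=> e0; exists (complex.Re e).
  by move: e0; rewrite ltcE => /andP[].
by rewrite RRe_real // realE ltW.
Qed.

Lemma closed_approx (V : normedModType R[i]) (S : set V) :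
  (forall x, (forall e : R, 0 < e -> exists2 y, S y & nrm (x - y) <= e) -> S x) ->
  closed S.
Proof.
move=> h x /= cx; apply: h => e e0.
have [] := cx (ball x e%:C).
  by apply/nbhs_ballP; exists e%:C => //=; rewrite ltcR.
move=> y [Sy]; rewrite -ball_normE /ball_ /= normE ltcR => /ltW.
by exists y.
Qed.

Lemma approx_closed (V : normedModType R[i]) (S : set V) x : closed S ->
  (forall e : R, 0 < e -> exists2 y, S y & nrm (x - y) <= e) -> S x.
Proof.
move=> cS h; apply: cS => B /nbhs_ballP[e /= e0 eB].
have [r r0 re] := pos_complexE e0.
have r20 : 0 < r / 2 by rewrite divr_gt0.
have [y Sy yr] := h _ r20; exists y; split => //; apply: eB.
rewrite -ball_normE /ball_ /= re normE ltcR.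
by apply: le_lt_trans yr _; rewrite ltr_pdivrMr // ltr_pMr // ltr1n.
Qed.

Lemma dense_approx (V : normedModType R[i]) (S : set V) :
  dense S <-> forall x (e : R), 0 < e -> exists2 y, S y & nrm (x - y) <= e.
Proof.
split=> [dS x e e0|h U [x Ux] oU].
  have [||y [+ Sy]] := dS (ball x e%:C).
  - by exists x; apply: ballxx; rewrite ltcR.
  - by apply: ball_open; rewrite ltcR.
  by rewrite -ball_normE /ball_ /= normE ltcR => /ltW; exists y.
have /nbhs_ballP[e /= e0 eU] : nbhs x U by apply: open_nbhs_nbhs.
have [r r0 re] := pos_complexE e0.
have r20 : 0 < r / 2 by rewrite divr_gt0.
have [y Sy yr] := h x _ r20; exists y; split => //; apply: eU.
rewrite -ball_normE /ball_ /= re normE ltcR.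
by apply: le_lt_trans yr _; rewrite ltr_pdivrMr // ltr_pMr // ltr1n.
Qed.

Lemma cauchy_tendsto (V : completeNormedModType R[i]) (u : nat -> V) :
  (forall e : R, 0 < e -> exists N, forall m n,
     (N <= m)%N -> (N <= n)%N -> nrm (u m - u n) <= e) ->
  exists l, tendsto u l.
Proof.
move=> h.
have : cvg (u @ \oo).
  apply/cauchy_cvgP/cauchy_exP => e /pos_complexE[r r0 ->].
  have r20 : 0 < r / 2 by rewrite divr_gt0.
  have [N hN] := h _ r20; exists (u N).
  exists N => // n /= Nn; rewrite -ball_normE /ball_ /= normE ltcR.
  by apply: le_lt_trans (hN N n _ _) _; rewrite // ltr_pdivrMr // ltr_pMr // ltr1n.
move=> /cvg_ex[l /cvgrPdist_lt hl]; exists l => e e0.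
have [|N _ hN] := hl e%:C; first by rewrite ltcR.
by exists N => n /hN /=; rewrite normE ltcR nrmBC => /ltW.
Qed.

Lemma inv_archi (e : R) : 0 < e -> exists N : nat, N.+1%:R^-1 <= e.
Proof.
move=> e0; exists (Num.truncn e^-1).
rewrite -[leRHS]invrK lef_pV2 ?posrE ?ltr0n ?invr_gt0 //.
by apply/ltW/truncnS_gt.
Qed.

(** A failure at [e] would let the sequence climb by [e] again and again, past [M]. *)
Lemma monotone_cauchy (t : nat -> R) (M : R) :
  (forall n, t n <= t n.+1) -> (forall n, t n <= M) ->
  forall e : R, 0 < e -> exists N, forall n, (N <= n)%N -> t n - t N <= e.
Proof.
move=> t_inc tM e e0; apply: contrapT => /forallNP h.
have tmono m n : (m <= n)%N -> t m <= t n.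
  move=> /subnKC <-; elim: (n - m)%N => [|k IH]; first by rewrite addn0.
  by rewrite addnS; apply: le_trans IH _.
have {}h N : exists n, t N + e <= t n.
  have /existsNP[n /not_implyP[Nn /negP]] := h N; rewrite -ltNge => hn.
  by exists n; lra.
have [k] : exists k : nat, M < t 0%N + k%:R * e.
  exists (Num.truncn ((M - t 0%N) / e)).+1.
  by rewrite -ltrBlDl -ltr_pdivrMr // truncnS_gt.
have [n hn] : exists n, t 0%N + k%:R * e <= t n.
  elim: k => [|k [n hn]]; first by exists 0%N; rewrite mul0r addr0.
  have [m hm] := h n; exists m; apply: le_trans hm.
  by rewrite -addn1 natrD mulrDl mul1r; lra.
by move=> h1; have := tM n; lra.
Qed.

(** Method of majorants. No rate of convergence is asked of [t]; this matters for [sqrt_iteration],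
    whose majorant approaches 1 more slowly than any geometric sequence. *)
Lemma dominated_tendsto (V : completeNormedModType R[i]) (u : nat -> V)
    (t : nat -> R) (M : R) :
  (forall n, nrm (u n.+1 - u n) <= t n.+1 - t n) -> (forall n, t n <= M) ->
  exists2 l, tendsto u l & forall n, nrm (u n - l) <= M - t n.
Proof.
move=> ut tM.
have t_inc n : t n <= t n.+1 by rewrite -subr_ge0; apply: le_trans (nrm_ge0 _) (ut n).
have dist m k : nrm (u (m + k)%N - u m) <= t (m + k)%N - t m.
  elim: k => [|k IH]; first by rewrite addn0 !subrr nrm0.
  rewrite addnS; have := ut (m + k)%N.
  have := nrm_dist (u (m + k)%N) (u (m + k).+1) (u m); lra.
have [|l hl] := @cauchy_tendsto V u.
  move=> e e0; have e20 : 0 < e / 2 by rewrite divr_gt0.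
  have [N hN] := monotone_cauchy t_inc tM e20.
  exists N => m n /subnKC <- /subnKC <-.
  have h1 := dist N (m - N)%N; have h2 := dist N (n - N)%N.
  have := hN _ (leq_addr (m - N) N); have := hN _ (leq_addr (n - N) N).
  have := nrm_dist (u N) (u (N + (m - N))%N) (u (N + (n - N))%N).
  rewrite (nrmBC (u N)); lra.
exists l => // n; apply/ler_addgt0Pr => e e0; have [N hN] := hl _ e0.
have := hN (n + N)%N (leq_addl _ _); have := dist n N.
have := tM (n + N)%N; have := nrm_dist (u (n + N)%N) (u n) l.
rewrite (nrmBC (u n) (u _)); lra.
Qed.

Section Limits.
Variables (V W : normedModType R[i]).
Implicit Types (u v : nat -> V).

Lemma tendsto_unique u l l' : tendsto u l -> tendsto u l' -> l = l'.
Proof.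
move=> h h'; apply: sub_nrm_arb0 => e e0.
have e20 : 0 < e / 2 by rewrite divr_gt0.
have [N hN] := h _ e20; have [N' hN'] := h' _ e20.
have := hN (maxn N N') (leq_maxl _ _); have := hN' (maxn N N') (leq_maxr _ _).
have := nrm_dist (u (maxn N N')) l l'; rewrite (nrmBC l (u _)); lra.
Qed.

Lemma tendstoD u v l m : tendsto u l -> tendsto v m ->
  tendsto (fun n => u n + v n) (l + m).
Proof.
move=> h h' e e0; have e20 : 0 < e / 2 by rewrite divr_gt0.
have [N hN] := h _ e20; have [N' hN'] := h' _ e20.
exists (maxn N N') => n; rewrite geq_max => /andP[/hN {}hN /hN' {}hN'].
rewrite opprD addrACA; have := nrmD (u n - l) (v n - m); lra.
Qed.

Lemma tendsto_cst (l : V) : tendsto (fun=> l) l.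
Proof. by move=> e e0; exists 0%N => n _; rewrite subrr nrm0 ltW. Qed.

Lemma tendsto_ext u v l : (forall n, u n = v n) -> tendsto u l -> tendsto v l.
Proof. by move=> h + e e0 => /(_ e e0)[N hN]; exists N => n; rewrite -h; exact: hN. Qed.

Lemma tendsto_lip (f : V -> W) (C : R) u l :
  (forall n, nrm (f (u n) - f l) <= C * nrm (u n - l)) ->
  tendsto u l -> tendsto (f \o u) (f l).
Proof.
move=> fC h e e0; have C0 : 0 < `|C| + 1 by rewrite ltr_wpDl.
have [|N hN] := h (e / (`|C| + 1)); first by rewrite divr_gt0.
exists N => n /hN hn; apply: le_trans (fC n) _.
have : C * nrm (u n - l) <= (`|C| + 1) * nrm (u n - l).
  by rewrite ler_wpM2r ?nrm_ge0 //; apply: le_trans (ler_norm _) _; rewrite lerDl.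
move=> /le_trans; apply; rewrite mulrC; move: hn; rewrite ler_pdivlMr //.
Qed.

Lemma tendstoZ (c : R[i]) u l : tendsto u l -> tendsto (fun n => c *: u n) (c *: l).
Proof.
move=> h e e0; have C0 : 0 < complex.Re `|c| + 1.
  by rewrite ltr_wpDl // -ler0c RRe_real ?realE normr_ge0.
have [|N hN] := h (e / (complex.Re `|c| + 1)); first by rewrite divr_gt0.
exists N => n /hN; rewrite -scalerBr nrmZ ler_pdivlMr // => h1.
by have := nrm_ge0 (u n - l); nra.
Qed.

Lemma tendsto_nrm_le u l (M : R) : tendsto u l -> (forall n, nrm (u n) <= M) ->
  nrm l <= M.
Proof.
move=> h uM; apply/ler_addgt0Pr => e e0; have [N hN] := h _ e0.
have := hN N (leqnn _); have := nrm_leD l (u N); have := uM N; rewrite nrmBC; lra.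
Qed.

End Limits.

End RealNorm.

(** * Square roots and positivity in C*-algebras *)

Section CStarBasics.
Context {R : realType} {A : cstarType R}.
Implicit Types (x y z a b c : A) (r s t : R).

Lemma cmul0l x : 0 ** x = 0.
Proof. by rewrite -[X in X ** _](scale0r (0 : A)) cmulZl scale0r. Qed.

Lemma cmul0r x : x ** 0 = 0.
Proof. by rewrite -[X in _ ** X](scale0r (0 : A)) cmulZr scale0r. Qed.

Lemma cmulNl x y : - x ** y = - (x ** y).
Proof. by rewrite -(scaleN1r x) cmulZl scaleN1r. Qed.

Lemma cmulNr x y : x ** - y = - (x ** y).
Proof. by rewrite -(scaleN1r y) cmulZr scaleN1r. Qed.

Lemma cmulBl x y z : (x - y) ** z = x ** z - y ** z.
Proof. by rewrite cmulDl cmulNl. Qed.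

Lemma cmulBr x y z : x ** (y - z) = x ** y - x ** z.
Proof. by rewrite cmulDr cmulNr. Qed.

Lemma cmul_suml (I : Type) (s : seq I) (P : pred I) (f : I -> A) y :
  (\sum_(i <- s | P i) f i) ** y = \sum_(i <- s | P i) f i ** y.
Proof. exact: (big_morph (fun x => x ** y) (fun u v => cmulDl u v y) (cmul0l y)). Qed.

Lemma cmul_sumr (I : Type) (s : seq I) (P : pred I) (f : I -> A) y :
  y ** (\sum_(i <- s | P i) f i) = \sum_(i <- s | P i) y ** f i.
Proof. exact: (big_morph (cmul y) (cmulDr y) (cmul0r y)). Qed.

Lemma starZr r x : star (r%:C *: x) = r%:C *: star x.
Proof. by rewrite starZ conjc_real. Qed.

Lemma star0 : star (0 : A) = 0.
Proof. by rewrite -[X in star X](scale0r (0 : A)) starZ conjc0 scale0r. Qed.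

Lemma starN x : star (- x) = - star x.
Proof.
have e : -1 = (-1)%:C :> R[i] by rewrite rmorphN1.
by rewrite -(scaleN1r x) -(scaleN1r (star x)) e starZr.
Qed.

Lemma starB x y : star (x - y) = star x - star y.
Proof. by rewrite starD starN. Qed.

Lemma star1 : star cone = cone :> A.
Proof. by rewrite -(cmul1l (star cone)) -[X in X ** _]starK -starM cmul1l starK. Qed.

Lemma star_sum (I : Type) (s : seq I) (P : pred I) (f : I -> A) :
  star (\sum_(i <- s | P i) f i) = \sum_(i <- s | P i) star (f i).
Proof. exact: (big_morph star starD star0). Qed.

Lemma nrmM x y : nrm (x ** y) <= nrm x * nrm y.
Proof. by rewrite -lecR rmorphM /= -!normE cstar_normM. Qed.

Lemma nrm_starM x : nrm (star x ** x) = nrm x ^+ 2.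
Proof. by apply: complexI; rewrite -normE cstar_normE rmorphXn /= -normE. Qed.

Lemma nrm_star x : nrm (star x) = nrm x.
Proof.
have le y : nrm y <= nrm (star y).
  have := nrmM (star y) y; rewrite nrm_starM.
  have [->|yn0] := eqVneq (nrm y) 0; first by rewrite nrm_ge0.
  by rewrite expr2 ler_pM2r // lt_def yn0 nrm_ge0.
by apply/eqP; rewrite eq_le le andbT -[X in _ <= nrm X]starK le.
Qed.

Lemma nrm_Mstar x : nrm (x ** star x) = nrm x ^+ 2.
Proof. by rewrite -[X in X ** _]starK nrm_starM nrm_star. Qed.

Lemma nrm_sq x : star x = x -> nrm (x ** x) = nrm x ^+ 2.
Proof. by move=> xs; rewrite -{1}xs nrm_starM. Qed.

Lemma nrm1_le : nrm (cone : A) <= 1.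
Proof.
have := nrm_starM cone; rewrite star1 cmul1l => h.
by have := nrm_ge0 (cone : A); nra.
Qed.

Lemma nrm_scal_le r : 0 <= r -> nrm (r%:C *: cone : A) <= r.
Proof.
by move=> r0; rewrite nrmZr ger0_norm //; have := nrm1_le; have := nrm_ge0 (cone : A); nra.
Qed.

(** Substitute for membership of [y] in the closed algebra generated by [x]: it survives algebraic
    operations and limits, so it holds for whatever an iteration produces from [x]. *)
Definition bicomm x y : Prop := forall z, z ** x = x ** z -> z ** y = y ** z.

Lemma bicomm_trans x y z : bicomm x y -> bicomm y z -> bicomm x z.
Proof. by move=> h h' w /h /h'. Qed.

Lemma bicomm_scal r x : bicomm x (r%:C *: x).
Proof. by move=> z h; rewrite cmulZl cmulZr h. Qed.

Lemma bicomm_sub r x : bicomm x (r%:C *: cone - x).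
Proof. by move=> z h; rewrite cmulBl cmulBr cmulZl cmulZr cmul1l cmul1r h. Qed.

Lemma bicommM x y z : bicomm x y -> bicomm x z -> bicomm x (y ** z).
Proof. by move=> h h' w hw; rewrite cmulA h // -cmulA h' // cmulA. Qed.

Lemma bicommD x y z : bicomm x y -> bicomm x z -> bicomm x (y + z).
Proof. by move=> h h' w hw; rewrite cmulDl cmulDr h // h'. Qed.

Lemma bicommZ k x y : bicomm x y -> bicomm x (k *: y).
Proof. by move=> h w hw; rewrite cmulZl cmulZr h. Qed.

Lemma bicomm1 x : bicomm x cone.
Proof. by move=> w _; rewrite cmul1l cmul1r. Qed.

Lemma bicomm0 x : bicomm x 0.
Proof. by move=> w _; rewrite cmul0l cmul0r. Qed.

Lemma tendstoMl (u : nat -> A) x y : tendsto u y -> tendsto (fun n => x ** u n) (x ** y).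
Proof.
by apply: (tendsto_lip (f := cmul x) (C := nrm x)) => n; rewrite -cmulBr nrmM.
Qed.

Lemma tendstoMr (u : nat -> A) x y : tendsto u y -> tendsto (fun n => u n ** x) (y ** x).
Proof.
apply: (tendsto_lip (f := fun z => z ** x) (C := nrm x)) => n.
by rewrite -cmulBl mulrC nrmM.
Qed.

Lemma tendsto_star (u : nat -> A) y : tendsto u y -> tendsto (fun n => star (u n)) (star y).
Proof.
by apply: (tendsto_lip (f := star) (C := 1)) => n; rewrite -starB nrm_star mul1r.
Qed.

Lemma tendstoM (u v : nat -> A) y z : tendsto u y -> tendsto v z ->
  tendsto (fun n => u n ** v n) (y ** z).
Proof.
move=> uy vz e e0.
have C0 : 0 < nrm y + 1 + nrm z by have := nrm_ge0 y; have := nrm_ge0 z; lra.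
have d0 : 0 < e / (nrm y + 1 + nrm z) by rewrite divr_gt0.
have [N1 h1] := uy _ ltr01; have [N2 h2] := uy _ d0; have [N3 h3] := vz _ d0.
exists (maxn N1 (maxn N2 N3)) => n; rewrite !geq_max => /and3P[/h1 n1 /h2 n2 /h3 n3].
have -> : u n ** v n - y ** z = u n ** (v n - z) + (u n - y) ** z.
  by rewrite cmulBl cmulBr addrA subrK.
move: n2 n3; rewrite !ler_pdivlMr // => n2 n3.
have := nrmD (u n ** (v n - z)) ((u n - y) ** z).
have := nrmM (u n) (v n - z); have := nrmM (u n - y) z.
have := nrm_leD (u n) y; have := nrm_ge0 (u n - y); have := nrm_ge0 (v n - z).
have := nrm_ge0 y; have := nrm_ge0 z; have := nrm_ge0 (u n).
move: n1 n2 n3 C0.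
move: (nrm (u n)) (nrm y) (nrm z) (nrm (u n - y)) (nrm (v n - z)) => a b c d f.
move: (nrm _) (nrm _) (nrm _) => g h k n1 n2 n3 C0 a0 c0 b0 f0 d0' h4 h5 h6 h7.
have h8 : a * f <= (b + 1) * f by apply: ler_wpM2r; lra.
have : (b + 1 + c) * (a * f + d * c) <= (b + 1 + c) * e.
  have : (b + 1) * (f * (b + 1 + c)) <= (b + 1) * e by apply: ler_wpM2l; lra.
  have : c * (d * (b + 1 + c)) <= c * e by apply: ler_wpM2l; lra.
  nra.
rewrite ler_pM2l //; lra.
Qed.

Lemma tendsto_bicomm (u : nat -> A) x y : (forall n, bicomm x (u n)) -> tendsto u y ->
  bicomm x y.
Proof.
move=> uc uy z zx; apply: tendsto_unique (tendstoMl z uy) _.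
by apply: tendsto_ext (tendstoMr z uy) => n /=; rewrite uc.
Qed.

(* The iteration [u <- (x + u^2)/2] is dominated by the same iteration for [x = 1],
   which increases to 1; so the limit [y] exists even when [nrm x = 1], and
   [(1 - y)^2 = 1 - x]. *)
Lemma sqrt_iteration x : star x = x -> nrm x <= 1 -> exists y,
  [/\ y + y = x + y ** y, star y = y, nrm y <= 1 & bicomm x y].
Proof.
move=> xs x1.
pose h : R := 2^-1.
pose u := fix u n := if n is m.+1 then h%:C *: (x + u m ** u m) else 0.
pose t := fix t n := if n is m.+1 then h * (1 + t m ^+ 2) else 0.
have h0 : 0 < h by rewrite invr_gt0.
have h2 : h + h = 1 by rewrite /h; lra.
have t01 n : 0 <= t n <= 1.
  elim: n => [|n /andP[IH IH1]] /=; first by rewrite lexx ler01.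
  have := sqr_ge0 (t n); have : t n ^+ 2 <= 1 by rewrite expr_le1.
  by move=> ? ?; apply/andP; split; nra.
have ut n : nrm (u n) <= t n.
  elim: n => [|n IH] /=; first by rewrite nrm0.
  rewrite nrmZr gtr0_norm // ler_pM2l //.
  apply: le_trans (nrmD _ _) _; apply: lerD => //.
  by apply: le_trans (nrmM _ _) _; rewrite expr2 ler_pM ?nrm_ge0.
have ud n : nrm (u n.+1 - u n) <= t n.+1 - t n.
  elim: n => [|n IH].
    rewrite /= cmul0l addr0 expr0n addr0 mulr1 !subr0 nrmZr gtr0_norm //.
    by rewrite ler_piMr // ltW.
  (* A difference of squares is split as [a (a - b) + (a - b) b], which needs no commutation. *)
  have -> : u n.+2 - u n.+1 =
      h%:C *: (u n.+1 ** (u n.+1 - u n) + (u n.+1 - u n) ** u n).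
    rewrite cmulBl cmulBr addrA subrK -[u n.+2]/(h%:C *: (x + u n.+1 ** u n.+1)).
    by rewrite -[u n.+1 in X in _ - X]/(h%:C *: (x + u n ** u n)) -scalerBr opprD
       addrACA subrr add0r.
  have -> : t n.+2 - t n.+1 = h * ((t n.+1 - t n) * (t n.+1 + t n)).
    by rewrite -subr_sqr -[t n.+2]/(h * (1 + t n.+1 ^+ 2))
       -[X in _ - X]/(h * (1 + t n ^+ 2)); lra.
  rewrite nrmZr gtr0_norm // ler_pM2l //.
  have := nrmD (u n.+1 ** (u n.+1 - u n)) ((u n.+1 - u n) ** u n).
  have := nrmM (u n.+1) (u n.+1 - u n); have := nrmM (u n.+1 - u n) (u n).
  have := ut n; have := ut n.+1; have := nrm_ge0 (u n); have := nrm_ge0 (u n.+1).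
  have := nrm_ge0 (u n.+1 - u n); move: IH.
  move: (nrm (u n.+1 - u n)) (nrm (u n)) (nrm (u n.+1)) (t n) (t n.+1) => a b c d e.
  by move=> *; nra.
have [|y uy _] := dominated_tendsto (M := 1) ud; first by move=> n; case/andP: (t01 n).
have uS : tendsto (fun n => u n.+1) y.
  by move=> e e0; have [N hN] := uy _ e0; exists N => n Nn; apply/hN/leqW.
have uy1 n : nrm (u n) <= 1 by apply: le_trans (ut n) _; case/andP: (t01 n).
have ny1 : nrm y <= 1 by apply: tendsto_nrm_le uy _.
have uc n : bicomm x (u n).
  elim: n => [|n IH] /=; first exact: bicomm0.
  by apply/bicommZ/bicommD => //; apply: bicommM.
have us n : star (u n) = u n.
  elim: n => [|n IH] /=; first exact: star0.
  by rewrite starZr starD starM IH xs.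
have uyy := tendstoM uy uy.
exists y; split=> //.
- have yE : y = h%:C *: (x + y ** y).
    by apply: tendsto_unique uS (tendstoZ _ (tendstoD (tendsto_cst x) uyy)).
  by rewrite {1 2}yE -scalerDl -rmorphD /= h2 scale1r.
- by apply: tendsto_unique (tendsto_star uy) _; apply: tendsto_ext uy.
- exact: tendsto_bicomm uy.
Qed.

(** The Neumann series for the inverse of [1 - x], with increments dominated by those of the
    geometric series in [r]. *)
Lemma neumann x r : star x = x -> nrm x <= r -> r < 1 -> exists z,
  [/\ z = cone + x ** z, star z = z & bicomm x z].
Proof.
move=> xs xr r1; have r0 : 0 <= r by apply: le_trans (nrm_ge0 x) xr.
pose u := fix u n := if n is m.+1 then cone + x ** u m else 0.
pose t := fix t n := if n is m.+1 then 1 + r * t m else 0.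
have tM n : t n <= (1 - r)^-1.
  elim: n => [|n IH] /=; first by rewrite invr_ge0; lra.
  have nz : 1 - r != 0 by rewrite subr_eq0 gt_eqF.
  have := mulfV nz; move: IH; set q := (1 - r)^-1 => IH h; nra.
have ud n : nrm (u n.+1 - u n) <= t n.+1 - t n.
  elim: n => [|n IH]; first by rewrite /= cmul0r mulr0 !addr0 !subr0 nrm1_le.
  have -> : u n.+2 - u n.+1 = x ** (u n.+1 - u n).
    by rewrite cmulBr /= opprD addrACA subrr add0r.
  have -> : t n.+2 - t n.+1 = r * (t n.+1 - t n) by rewrite /=; ring.
  by apply: le_trans (nrmM _ _) _; apply: ler_pM; rewrite ?nrm_ge0.
have [z uz _] := dominated_tendsto ud tM.
have uS : tendsto (fun n => u n.+1) z.
  by move=> e e0; have [N hN] := uz _ e0; exists N => n Nn; apply/hN/leqW.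
have uc n : bicomm x (u n).
  elim: n => [|n IH] /=; first exact: bicomm0.
  by apply: bicommD; [exact: bicomm1|exact: bicommM].
have us n : star (u n) = u n.
  elim: n => [|n IH] /=; first exact: star0.
  by rewrite starD star1 starM IH xs -uc.
exists z; split.
- exact: tendsto_unique uS (tendstoD (tendsto_cst _) (tendstoMl x uz)).
- by apply: tendsto_unique (tendsto_star uz) _; apply: tendsto_ext uz.
- exact: tendsto_bicomm uz.
Qed.

End CStarBasics.

(** * Identities of the free noncommutative algebra, by reflection *)

Section NonCommutativeNormalisation.
Context {R : realType} {A : cstarType R}.

Inductive ncexp :=
  | NVar of nat | N0 | N1 | NAdd of ncexp & ncexp | NOpp of ncexp
  | NMul of ncexp & ncexp | NScale of R[i] & ncexp.

Fixpoint nceval (env : seq A) (e : ncexp) : A :=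
  match e with
  | NVar i => nth 0 env i
  | N0 => 0
  | N1 => cone
  | NAdd a b => nceval env a + nceval env b
  | NOpp a => - nceval env a
  | NMul a b => nceval env a ** nceval env b
  | NScale c a => c *: nceval env a
  end.

Fixpoint ncword (env : seq A) (w : seq nat) : A :=
  if w is i :: w' then nth 0 env i ** ncword env w' else cone.

Definition ncsum env (p : seq (R[i] * seq nat)) : A :=
  \sum_(m <- p) m.1 *: ncword env m.2.

Fixpoint nclmul (c : R[i]) (w : seq nat) (p : seq (R[i] * seq nat)) :=
  if p is m :: p' then (c * m.1, w ++ m.2) :: nclmul c w p' else [::].

Fixpoint ncmul (p q : seq (R[i] * seq nat)) :=
  if p is m :: p' then nclmul m.1 m.2 q ++ ncmul p' q else [::].

Fixpoint ncnorm (e : ncexp) : seq (R[i] * seq nat) :=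
  match e with
  | NVar i => [:: (1, [:: i])]
  | N0 => [::]
  | N1 => [:: (1, [::])]
  | NAdd a b => ncnorm a ++ ncnorm b
  | NOpp a => nclmul (- 1) [::] (ncnorm a)
  | NMul a b => ncmul (ncnorm a) (ncnorm b)
  | NScale c a => nclmul c [::] (ncnorm a)
  end.

Lemma ncword_cat env v w : ncword env (v ++ w) = ncword env v ** ncword env w.
Proof. by elim: v => [|i v IH] /=; rewrite ?cmul1l // IH cmulA. Qed.

Lemma ncsum_cat env p q : ncsum env (p ++ q) = ncsum env p + ncsum env q.
Proof. by rewrite /ncsum big_cat. Qed.

Lemma ncsum_lmul env c w p :
  ncsum env (nclmul c w p) = c *: (ncword env w ** ncsum env p).
Proof.
elim: p => [|m p IH]; first by rewrite /ncsum /= !big_nil cmul0r scaler0.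
rewrite /ncsum /= !big_cons -/(ncsum _ _) IH /= ncword_cat cmulDr scalerDr.
by rewrite cmulZr scalerA.
Qed.

Lemma ncnormE env e : nceval env e = ncsum env (ncnorm e).
Proof.
elim: e => [i|||a IHa b IHb|a IH|a IHa b IHb|c a IH] /=.
- by rewrite /ncsum big_seq1 scale1r /= cmul1r.
- by rewrite /ncsum big_nil.
- by rewrite /ncsum big_seq1 scale1r.
- by rewrite ncsum_cat IHa IHb.
- by rewrite ncsum_lmul IH cmul1l scaleN1r.
- rewrite IHa IHb; elim: (ncnorm a) => [|m p IH] /=.
    by rewrite /ncsum big_nil cmul0l.
  rewrite ncsum_cat -IH ncsum_lmul {1}/ncsum big_cons -/(ncsum _ _).
  by rewrite cmulDl cmulZl.
- by rewrite ncsum_lmul IH cmul1l.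
Qed.

(** Written with [Nat.eqb] and [if] so that the [cbv] of [ncring] evaluates it on closed words
    without unfolding scalars. *)
Fixpoint nceqw (v w : seq nat) : bool :=
  match v, w with
  | [::], [::] => true
  | i :: v', j :: w' => if Nat.eqb i j then nceqw v' w' else false
  | _, _ => false
  end.

Fixpoint ncins (c : R[i]) (w : seq nat) (p : seq (R[i] * seq nat)) :=
  if p is m :: p' then
    if nceqw w m.2 then (c + m.1, w) :: p' else m :: ncins c w p'
  else [:: (c, w)].

Fixpoint nccollect (p : seq (R[i] * seq nat)) :=
  if p is m :: p' then ncins m.1 m.2 (nccollect p') else [::].

(** A proposition rather than a test: whether a coefficient in [R[i]] vanishes cannot be computed,
    so each one becomes a goal for [ring]. *)
Fixpoint ncnull (p : seq (R[i] * seq nat)) : Prop :=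
  if p is m :: p' then m.1 = 0 /\ ncnull p' else True.

Lemma nceqwP v w : nceqw v w -> v = w.
Proof.
elim: v w => [|i v IH] [|j w] //=.
case e : (Nat.eqb i j) => // /IH ->.
by rewrite (proj1 (PeanoNat.Nat.eqb_eq i j) e).
Qed.

Lemma ncsum_ins env c w p : ncsum env (ncins c w p) = c *: ncword env w + ncsum env p.
Proof.
elim: p => [|m p IH] /=; first by rewrite /ncsum big_seq1 big_nil addr0.
case e : (nceqw w m.2); rewrite /ncsum !big_cons -!/(ncsum _ _).
  by rewrite (nceqwP e) scalerDl addrA.
by rewrite IH addrCA.
Qed.

Lemma ncnull_sum env p : ncnull (nccollect p) -> ncsum env p = 0.
Proof.
have -> : ncsum env p = ncsum env (nccollect p).
  elim: p => [|m p IH] //=.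
  by rewrite ncsum_ins -IH /ncsum big_cons.
elim: (nccollect p) => [|m q IH] /=; first by rewrite /ncsum big_nil.
by move=> [m0 /IH q0]; rewrite /ncsum big_cons -/(ncsum _ _) q0 m0 scale0r addr0.
Qed.

Lemma ncnorm_correct env e1 e2 :
  ncnull (nccollect (ncnorm (NAdd e1 (NOpp e2)))) -> nceval env e1 = nceval env e2.
Proof.
by move=> /(ncnull_sum env); rewrite -ncnormE /= => /eqP; rewrite subr_eq0 => /eqP.
Qed.

End NonCommutativeNormalisation.

Ltac nc_mem x l :=
  match l with
  | nil => constr:(false)
  | cons x _ => constr:(true)
  | cons _ ?l' => nc_mem x l'
  end.

Ltac nc_add x l :=
  match nc_mem x l with true => l | false => constr:(cons x l) end.

Ltac nc_atoms l e :=
  lazymatch e with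
  | (?a + ?b)%R => let l := nc_atoms l a in nc_atoms l b
  | (- ?a)%R => nc_atoms l a
  | (?a ** ?b)%R => let l := nc_atoms l a in nc_atoms l b
  | (?c *: ?a)%R => nc_atoms l a
  | 0%R => l
  | cone => l
  | _ => nc_add e l
  end.

Ltac nc_index x l :=
  lazymatch l with
  | cons x _ => constr:(O)
  | cons _ ?l' => let n := nc_index x l' in constr:(S n)
  end.

Ltac nc_reify R l e :=
  lazymatch e with
  | (?a + ?b)%R =>
      let a := nc_reify R l a in let b := nc_reify R l b in constr:(@NAdd R a b)
  | (- ?a)%R => let a := nc_reify R l a in constr:(@NOpp R a)
  | (?a ** ?b)%R =>
      let a := nc_reify R l a in let b := nc_reify R l b in constr:(@NMul R a b)
  | (?c *: ?a)%R => let a := nc_reify R l a in constr:(@NScale R c a)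
  | 0%R => constr:(@N0 R)
  | cone => constr:(@N1 R)
  | _ => let n := nc_index e l in constr:(@NVar R n)
  end.

(* Identities of the free noncommutative algebra: the two sides are expanded into
   words in the atoms, and the coefficients are compared by [ring]. *)
Ltac ncring :=
  lazymatch goal with
  | |- @eq _ ?a ?b =>
      let T := type of a in
      (* Elaborating [cone] at the type of the goal makes unification find its C*-structure. *)
      lazymatch constr:(@cone _ _ : T) with
      | @cone ?R ?A : _ =>
        let l := nc_atoms (@nil (CStar.sort A)) a in
        let l := nc_atoms l b in
        let ea := nc_reify R l a in
        let eb := nc_reify R l b in
        refine (@ncnorm_correct R A l ea eb _);
        cbv [ncnull nccollect ncins ncnorm ncmul nclmul cat nceqw Nat.eqb fst snd];
        repeat (split; [try ring|]); try exact I
      end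
  end.

(** * Positive elements, square roots and the order *)

Section Positive.
Context {R : realType} {A : cstarType R}.
Implicit Types (x y z a b c p q : A) (r s t : R).

Lemma conjc_i : ('i%C : R[i])^*%C = - 'i%C.
Proof. by apply/eqP; rewrite eq_complex /= oppr0 !eqxx. Qed.

(** For self-adjoint [a] the bound says that the spectrum lies in [[0, 2t]], without mentioning
    spectra. In this form sums are immediate and [1 - a/t] has norm at most 1, as the square root
    iteration requires; [posP] gives the agreement with [cpos]. *)
Definition pos a : Prop := star a = a /\ exists t : R, nrm (t%:C *: cone - a) <= t.

Lemma pos_sa a : pos a -> star a = a. Proof. by case. Qed.

Lemma pos0 : pos (0 : A).
Proof. by split; [exact: star0|exists 0; rewrite scale0r subr0 nrm0]. Qed.

Lemma posD a b : pos a -> pos b -> pos (a + b).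
Proof.
move=> [sa [t ta]] [sb [s sb']]; split; first by rewrite starD sa sb.
exists (t + s); rewrite rmorphD scalerDl /= opprD addrACA.
by apply: le_trans (nrmD _ _) (lerD _ _).
Qed.

Lemma pos_sum (I : Type) (s : seq I) (P : pred I) (f : I -> A) :
  (forall i, P i -> pos (f i)) -> pos (\sum_(i <- s | P i) f i).
Proof. by move=> h; elim/big_rec: _ => [|i x Pi px]; [exact: pos0|exact/posD/px/h]. Qed.

Lemma posZ r a : 0 <= r -> pos a -> pos (r%:C *: a).
Proof.
move=> r0 [sa [t ta]]; split; first by rewrite starZr sa.
exists (r * t); rewrite rmorphM -scalerA -scalerBr nrmZr ger0_norm //.
by apply: ler_wpM2l.
Qed.

Lemma pos_scalB t a : star a = a -> nrm a <= t -> pos (t%:C *: cone - a).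
Proof.
move=> sa at_; split; first by rewrite starB starZr star1 sa.
by exists t; rewrite opprB addrC subrK.
Qed.

(** For [t > 0] the element [x = 1 - a/t] has norm at most 1, and [sqrt_iteration] gives
    [(1 - y)^2 = 1 - x = a/t]; hence the root [sqrt t (1 - y)]. *)
Lemma pos_sqrt a : pos a -> exists b, [/\ b ** b = a, pos b & bicomm a b].
Proof.
case=> sa [t ta]; have : 0 <= t by apply: le_trans (nrm_ge0 _) ta.
rewrite le_eqVlt => /orP[/eqP t0|t0].
  have -> : a = 0.
    apply: nrm0_eq0; apply/eqP; rewrite eq_le nrm_ge0 andbT.
    by move: ta; rewrite -t0 scale0r sub0r nrmN.
  by exists 0; split; [exact: cmul0l|exact: pos0|exact: bicomm0].
have tn0 : t != 0 by rewrite gt_eqF.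
pose x := cone + (- t^-1)%:C *: a.
have xE : x = t^-1%:C *: (t%:C *: cone - a).
  rewrite scalerBr scalerA -rmorphM /= mulVf // scale1r /x.
  by rewrite rmorphN scaleNr.
have sx : star x = x by rewrite starD starZr star1 sa.
have x1 : nrm x <= 1.
  rewrite xE nrmZr gtr0_norm ?invr_gt0 //.
  by rewrite -(mulVf tn0) ler_wpM2l // invr_ge0 ltW.
have [y [yE sy y1 yc]] := sqrt_iteration sx x1.
exists ((Num.sqrt t)%:C *: (cone - y)); split.
- rewrite cmulZl cmulZr scalerA -rmorphM /= -expr2 sqr_sqrtr ?(ltW t0) //.
  have -> : (cone - y) ** (cone - y) = cone + y ** y - (y + y) by ncring.
  have -> : cone + y ** y - (y + y) = t^-1%:C *: a.
    rewrite yE /x rmorphN; ncring.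
  by rewrite scalerA -rmorphM /= mulfV // scale1r.
- split; first by rewrite starZr starB star1 sy.
  exists (Num.sqrt t); rewrite scalerBr opprB addrC subrK nrmZr.
  by rewrite ger0_norm ?sqrtr_ge0 // ler_piMr // sqrtr_ge0.
- apply/bicommZ/bicommD; first exact: bicomm1.
  have h : bicomm a y.
    apply: bicomm_trans yc; apply: bicommD; first exact: bicomm1.
    exact: bicomm_scal.
  by move=> z /h hz; rewrite cmulNl cmulNr hz.
Qed.

(* [p] is the real part of [u = p + i q], and [u^* u = p^2 + q^2]. *)
Lemma nrm_sq_le_sum p q : star p = p -> star q = q -> p ** q = q ** p ->
  nrm p ^+ 2 <= nrm (p ** p + q ** q).
Proof.
move=> sp sq pq; pose u := p + 'i%C *: q.
have su : star u = p - 'i%C *: q by rewrite starD starZ sp sq conjc_i scaleNr.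
have uu : star u ** u = p ** p + q ** q.
  have i2 : 'i%C * 'i%C = -1 :> R[i] by rewrite -expr2 sqr_i.
  rewrite su cmulBl !cmulDr !cmulZl !cmulZr scalerA i2 pq; ncring.
have -> : p ** p + q ** q = star u ** u by [].
have np : nrm p <= nrm u.
  have e : (2%:R : R)%:C *: p = u + star u.
    by rewrite su addrACA subrr addr0 -mulr2n rmorph_nat scaler_nat.
  have := nrmD u (star u); rewrite -e nrmZr nrm_star normr_nat; lra.
rewrite nrm_starM; have := nrm_ge0 p; nra.
Qed.

(** Put [c = b / sqrt t] and let [s] be the root of [1 - c^2], which commutes with [b]. From
    [s^2 + c^2 = 1] and [nrm_sq_le_sum] follows that [s] has norm at most 1, and [t - b^2 = t s^2].
    The root exists because [c^2] is self-adjoint of norm at most 1, so positivity of squares is not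
    presupposed. *)
Lemma nrm_scalB_sq b t : star b = b -> nrm b ^+ 2 <= t ->
  nrm (t%:C *: cone - b ** b) <= t.
Proof.
move=> sb; have [->|b0 bt] := eqVneq b 0.
  by rewrite nrm0 expr0n cmul0l subr0 => t0; exact: nrm_scal_le.
have nb0 : 0 < nrm b.
  by rewrite lt_def nrm_ge0 andbT; apply: contra_neq b0; exact: nrm0_eq0.
have t0 : 0 < t by apply: lt_le_trans bt; rewrite exprn_gt0.
have tn0 : t != 0 by rewrite gt_eqF.
pose x := t^-1%:C *: (b ** b).
have sx : star x = x by rewrite starZr starM sb.
have x1 : nrm x <= 1.
  rewrite nrmZr gtr0_norm ?invr_gt0 // nrm_sq //.
  by rewrite -(mulVf tn0) ler_wpM2l // invr_ge0 ltW.
have [|s [ss ps sc]] := @pos_sqrt (1%:C *: cone - x); first exact: pos_scalB.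
have bs : b ** s = s ** b.
  by apply/sc/bicomm_sub; apply/bicomm_scal; rewrite cmulA.
pose c := (Num.sqrt t^-1)%:C *: b.
have cc : c ** c = x.
  by rewrite cmulZl cmulZr scalerA -rmorphM /= -expr2 sqr_sqrtr // invr_ge0 ltW.
have := @nrm_sq_le_sum s c (pos_sa ps).
rewrite starZr sb cmulZl cmulZr bs => /(_ erefl erefl).
rewrite cc ss subrK scale1r => h.
have -> : t%:C *: cone - b ** b = t%:C *: (s ** s).
  by rewrite ss scalerBr !scalerA -!rmorphM /= mulr1 mulfV // scale1r.
rewrite nrmZr (gtr0_norm t0) nrm_sq ?pos_sa // ler_piMr ?(ltW t0) //.
exact: le_trans h nrm1_le.
Qed.

Lemma pos_sq b : star b = b -> pos (b ** b).
Proof.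
by move=> sb; split; [rewrite starM sb|exists (nrm b ^+ 2); exact: nrm_scalB_sq].
Qed.

Lemma pos_nrm_le a t : pos a -> nrm a <= t -> nrm (t%:C *: cone - a) <= t.
Proof.
move=> /pos_sqrt[b [<- /pos_sa sb _]]; rewrite nrm_sq //; exact: nrm_scalB_sq.
Qed.

(** The approximants come with unrelated witnesses [t]. By [pos_nrm_le] the single value [nrm a + 1]
    serves for all those within distance 1 of [a], and the inequality then passes to the limit. *)
Lemma pos_closed a : (forall e : R, 0 < e -> exists2 b, pos b & nrm (a - b) <= e) ->
  pos a.
Proof.
move=> h; split.
  apply: sub_nrm_arb0 => e e0; have e20 : 0 < e / 2 by rewrite divr_gt0.
  have [b pb ab] := h _ e20.
  have := nrm_dist b (star a) a; rewrite -{1}(pos_sa pb) -starB nrm_star (nrmBC b a).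
  lra.
exists (nrm a + 1); apply/ler_addgt0Pr => e e0.
have m0 : 0 < Num.min e 1 by rewrite lt_min e0 ltr01.
have [b pb ab] := h _ m0.
have : nrm b <= nrm a + 1.
  have := nrm_leD b a; rewrite nrmBC.
  have : Num.min e 1 <= 1 by rewrite ge_min lexx orbT.
  lra.
move=> /(pos_nrm_le pb).
have := nrm_dist ((nrm a + 1)%:C *: cone - b) ((nrm a + 1)%:C *: cone - a) 0.
have -> : (nrm a + 1)%:C *: cone - a - ((nrm a + 1)%:C *: cone - b) = b - a by ncring.
rewrite !subr0 (nrmBC b a).
have : Num.min e 1 <= e by rewrite ge_min lexx.
lra.
Qed.

(** Both [p] and [nrm q - p] are positive and they commute, so their square roots commute too; the
    squares of these roots add up to the scalar [nrm q], and [nrm_sq_le_sum] applies. *)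
Lemma nrm_pos_mono p q : pos p -> pos (q - p) -> nrm p <= nrm q.
Proof.
move=> pp pqp; have pq : pos q by have := posD pqp pp; rewrite subrK.
have pM : pos ((nrm q)%:C *: cone - p).
  have := posD pqp (pos_scalB (pos_sa pq) (lexx (nrm q))).
  by rewrite addrC addrA subrK.
have [p1 [p1E pp1 p1c]] := pos_sqrt pp; have [s [sE ps sc]] := pos_sqrt pM.
have : p1 ** s = s ** p1.
  by apply/sc/bicomm_sub; rewrite -p1E cmulA.
move=> /(nrm_sq_le_sum (pos_sa pp1) (pos_sa ps)).
rewrite p1E sE addrC subrK -nrm_sq ?pos_sa // p1E => /le_trans; apply.
exact/nrm_scal_le/nrm_ge0.
Qed.

Lemma pos_nrm_le_scal a t : pos a -> pos (t%:C *: cone - a) -> 0 <= t -> nrm a <= t.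
Proof. by move=> pa h t0; apply: le_trans (nrm_pos_mono pa h) (nrm_scal_le t0). Qed.

(* With [y = - c^* c >= 0] and [N = nrm y], the element [c^* (N - c c^* )^2 c] equals
   [- y (N + y)^2]; its norm is at most [N^3] because [c c^* >= 0], and at least [2 N^3]. *)
Lemma pos_Mstar_neg c : pos (c ** star c) -> pos (- (star c ** c)) -> c = 0.
Proof.
move=> pc pn; pose N := nrm c ^+ 2; pose y := - (star c ** c).
have N0 : 0 <= N by rewrite sqr_ge0.
have ny : nrm y = N by rewrite nrmN nrm_starM.
pose h := N%:C *: cone - c ** star c.
have nh : nrm h <= N by apply: pos_nrm_le; rewrite ?nrm_Mstar.
pose k := N%:C *: cone + y.
have hc : h ** c = c ** k.
  by rewrite /h /k /y; ncring.
have lhsE : star c ** (h ** h ** c) = - (y ** k ** k).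
  rewrite -(cmulA h) hc (cmulA h c) hc /y; ncring.
have [e [eE /pos_sa se _]] := pos_sqrt pn.
have yk : y ** k ** k = (N ^+ 2)%:C *: y + ((2 * N)%:C *: (y ** y) + y ** y ** y).
  rewrite /k; ncring.
have sy : star y = y := pos_sa pn.
have ey : e ** y = y ** e by rewrite /y -eE; ncring.
have py3 : pos (y ** y ** y).
  have -> : y ** y ** y = (e ** y) ** (e ** y).
    by rewrite {1}ey; transitivity (y ** (e ** e) ** y); [rewrite eE|ncring].
  by apply: pos_sq; rewrite starM sy se ey.
have N20 : 0 <= 2 * N by apply: mulr_ge0.
have le : 2 * N ^+ 3 <= nrm (y ** k ** k).
  have <- : nrm ((2 * N)%:C *: (y ** y)) = 2 * N ^+ 3.
    by rewrite nrmZr ger0_norm // nrm_sq // ny; ring.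
  apply: nrm_pos_mono; first by apply: posZ => //; exact: pos_sq.
  have -> : y ** k ** k - (2 * N)%:C *: (y ** y) = (N ^+ 2)%:C *: y + y ** y ** y.
    rewrite yk; ncring.
  by apply: posD => //; apply: posZ; rewrite // exprn_ge0.
have ge : nrm (y ** k ** k) <= N ^+ 3.
  rewrite -nrmN -lhsE.
  have := nrmM (star c) (h ** h ** c); have := nrmM (h ** h) c; have := nrmM h h.
  rewrite nrm_star cmulA cmulA; have := nrm_ge0 c; have := nrm_ge0 (h ** h).
  have := nrm_ge0 (h ** h ** c); have := nrm_ge0 h.
  move: nh; rewrite /N.
  move: (nrm h) (nrm c) (nrm (h ** h)) (nrm (h ** h ** c)) => a b d f ab a0 f0 d0 b0 h1 h2 h3.
  apply: le_trans h3 _.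
  have h4 : d <= (b ^+ 2) ^+ 2 by nra.
  have h5 : f <= (b ^+ 2) ^+ 2 * b by nra.
  have -> : (b ^+ 2) ^+ 3 = b * ((b ^+ 2) ^+ 2 * b) by ring.
  by rewrite ler_wpM2l.
have N3 : N ^+ 3 = 0.
  by apply/eqP; rewrite eq_le exprn_ge0 // andbT; lra.
apply: nrm0_eq0; move/eqP: N3; rewrite expf_eq0 /= /N expf_eq0 /=.
by move/eqP.
Qed.

(* Kelley-Vaught. With [a = b^* b], [p = |a|] and [g = p - a] one has
   [g a g = - g p g], so [c = b g] satisfies [c^* c <= 0], which forces [c = 0]; then
   [g^2 = 2 p g = 0], hence [a = p]. *)
Lemma pos_starM b : pos (star b ** b).
Proof.
pose a := star b ** b.
have sa : star a = a by rewrite starM starK.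
have [p [pE pp pc]] := pos_sqrt (pos_sq sa).
have [f [fE /pos_sa sf fc]] := pos_sqrt pp.
have ap : a ** p = p ** a by apply: pc; rewrite cmulA.
have fa : a ** f = f ** a by apply: fc.
have fp : p ** f = f ** p by apply: fc.
pose g := p - a.
have sg : star g = g by rewrite starB sa pos_sa.
have gf : g ** f = f ** g by rewrite cmulBl cmulBr fa fp.
have ag : a ** g = - (p ** g) by rewrite /g cmulBr cmulBr ap pE; ncring.
have gagE : g ** a ** g = - ((f ** g) ** (f ** g)).
  by rewrite -cmulA ag -fE -[X in _ = - (X ** _)]gf; ncring.
pose c := b ** g.
have ccE : star c ** c = - ((f ** g) ** (f ** g)).
  by rewrite -gagE /c starM sg /a; ncring.
have pfg : pos ((f ** g) ** (f ** g)) by apply: pos_sq; rewrite starM sg sf gf.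
have c0 : c = 0.
  apply: pos_Mstar_neg; last by rewrite ccE opprK.
  have -> : c ** star c = (c ** star c + star c ** c) + (f ** g) ** (f ** g).
    by rewrite ccE; ncring.
  apply: posD => //.
  (* Twice the real and, up to sign, the imaginary part of [c]: half the sum of their squares is
     [c c^* + c^* c], so only positivity of squares of self-adjoint elements is used. *)
  pose h := c + star c; pose k := 'i%C *: (c - star c).
  have sh : star h = h by rewrite starD starK addrC.
  have sk : star k = k.
    by rewrite starZ starB starK conjc_i scaleNr -scalerN opprB.
  have -> : c ** star c + star c ** c = (2^-1)%:C *: (h ** h + k ** k).
    have i2 : 'i%C * 'i%C = -1 :> R[i] by rewrite -expr2 sqr_i.
    rewrite /h /k cmulZl cmulZr scalerA i2.
    have -> : (2^-1)%:C = 2^-1 :> R[i] by rewrite fmorphV rmorph_nat.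
    by ncring; field.
  by apply: posZ; rewrite ?invr_ge0 //; apply: posD; exact: pos_sq.
have fg0 : f ** g = 0.
  apply: nrm0_eq0; apply/eqP; rewrite -sqrf_eq0 -nrm_sq.
    by rewrite -[X in nrm X]opprK -ccE c0 cmul0r oppr0 nrm0.
  by rewrite starM sg sf gf.
have pg0 : p ** g = 0 by rewrite -fE -cmulA fg0 cmul0r.
have g0 : g = 0.
  apply: nrm0_eq0; apply/eqP; rewrite -sqrf_eq0 -nrm_sq //.
  have -> : g ** g = p ** g + p ** g.
    by rewrite {1}/g cmulBl ag opprK.
  by rewrite pg0 addr0 nrm0.
by move/eqP: g0; rewrite subr_eq0 => /eqP pa; rewrite -/a -pa.
Qed.

Lemma posP a : pos a <-> cpos a.
Proof.
split=> [/pos_sqrt[b [bE pb _]]|[b ->]]; last exact: pos_starM.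
by exists b; rewrite (pos_sa pb).
Qed.

Lemma pos_conj a c : pos a -> pos (star c ** a ** c).
Proof.
move=> /pos_sqrt[b [<- /pos_sa sb _]].
have -> : star c ** (b ** b) ** c = star (b ** c) ** (b ** c).
  by rewrite starM sb; ncring.
exact: pos_starM.
Qed.

Lemma pos_Mstar b : pos (b ** star b).
Proof. by rewrite -[X in X ** _]starK; exact: pos_starM. Qed.

Lemma pos_le_sqnrm c : pos ((nrm c ^+ 2)%:C *: cone - star c ** c).
Proof.
apply: pos_scalB; first exact: pos_sa (pos_starM c).
by rewrite nrm_starM.
Qed.

(* Only the positivity of the Gram form on [x c - y] is used, at [c = <x, y> / N]. *)
Lemma cauchy_schwarz_pos xx xy yy (N : R) : 0 < N -> pos xx -> nrm xx <= N ->
  (forall c, pos (star c ** xx ** c - star c ** xy - star xy ** c + yy)) ->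
  pos (yy - N^-1%:C *: (star xy ** xy)).
Proof.
move=> N0 pxx xxN h.
have Nn0 : N%:C != 0 :> R[i] by rewrite fmorph_eq0 gt_eqF.
have pN : pos (N%:C *: cone - xx) by apply: pos_scalB; rewrite ?pos_sa.
have N2 : 0 <= N^-1 ^+ 2 by rewrite exprn_ge0 // invr_ge0 ltW.
(* At [c = xy / N] the form contains [N^-2 xy^* xx xy]; the second summand, from [xx <= N], trades
   it for [N^-1 xy^* xy]. *)
have := posD (h (N^-1%:C *: xy)) (posZ N2 (pos_conj xy pN)); congr pos.
rewrite starZr rmorphXn fmorphV; ncring; by field.
Qed.

Lemma cauchy_schwarz xx xy yy : pos xx ->
  (forall c, pos (star c ** xx ** c - star c ** xy - star xy ** c + yy)) ->
  nrm xy ^+ 2 <= nrm xx * nrm yy.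
Proof.
move=> pxx h; apply/ler_addgt0Pr => e e0.
have y10 : 0 < nrm yy + 1 by have := nrm_ge0 yy; lra.
(* The slack makes [N] invertible even when [xx] vanishes, and costs at most [d * nrm yy <= e]. *)
pose d := e / (nrm yy + 1); have d0 : 0 < d by rewrite divr_gt0.
pose N := nrm xx + d; have N0 : 0 < N by have := nrm_ge0 xx; rewrite /N; lra.
have NV0 : 0 < N^-1 by rewrite invr_gt0.
have xxN : nrm xx <= N by rewrite /N; lra.
have := nrm_pos_mono (posZ (ltW NV0) (pos_starM xy)) (cauchy_schwarz_pos N0 pxx xxN h).
rewrite nrmZr nrm_starM gtr0_norm // ler_pdivrMl // => /le_trans; apply.
have : d * (nrm yy + 1) = e by rewrite /d divfK // gt_eqF.
rewrite /N; nra.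
Qed.

(* The element [w] plays the role of [y^{-1/2}]. *)
Lemma pos_inv_sqrt y r : star y = y -> 0 < r -> pos (y - r%:C *: cone) ->
  exists w, star w = w /\ w ** y ** w = cone.
Proof.
move=> sy r0 py; pose M := nrm y + r.
have M0 : 0 < M by rewrite /M; have := nrm_ge0 y; lra.
have Mn0 : M%:C != 0 :> R[i] by rewrite fmorph_eq0 gt_eqF.
have pM : pos (M%:C *: cone - y) by apply: pos_scalB; rewrite // /M; lra.
have nM : nrm (M%:C *: cone - y) <= M - r.
  have := @nrm_pos_mono _ ((M - r)%:C *: cone) pM.
  have -> : (M - r)%:C *: cone - (M%:C *: cone - y) = y - r%:C *: cone.
    by rewrite rmorphB; ncring.
  by move=> /(_ py) /le_trans; apply; apply: nrm_scal_le; rewrite /M addrK nrm_ge0.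
(* This is [1 - y/M], of norm at most [1 - r/M < 1]; its Neumann series divided by [M] is the
   inverse [Z] of [y], and [w] will be the square root of [Z]. *)
pose x := M^-1%:C *: (M%:C *: cone - y).
have sx : star x = x by rewrite starZr (pos_sa pM).
have nx : nrm x <= (M - r) / M.
  by rewrite nrmZr gtr0_norm ?invr_gt0 // mulrC ler_pM2r ?invr_gt0.
have [|z [zE sz zc]] := neumann sx nx.
  by rewrite ltr_pdivrMr // mul1r; lra.
pose Z := M^-1%:C *: z.
have sZ : star Z = Z by rewrite starZr sz.
have Zc : bicomm y Z.
  apply: bicommZ; apply: bicomm_trans zc; apply: bicommZ; exact: bicomm_sub.
have yZ : y ** Z = cone.
  have : z - x ** z = cone by rewrite {1}zE addrK.
  move=> <-; rewrite /Z /x fmorphV; ncring; by field.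
have Zy : Z ** y = cone by rewrite -Zc.
have pY : pos y.
  have := posD py (posZ (ltW r0) (pos_sq star1)).
  by rewrite cmul1l subrK.
have [g [gE /pos_sa sg gc]] := pos_sqrt pY.
have gZ : g ** Z = Z ** g by apply: Zc; rewrite -gE cmulA.
have pZ : pos Z.
  have -> : Z = (g ** Z) ** (g ** Z).
    by rewrite {1}gZ -cmulA (cmulA g) gE yZ cmul1r.
  by apply: pos_sq; rewrite starM sg sZ gZ.
have [w [wE /pos_sa sw wc]] := pos_sqrt pZ.
exists w; split=> //.
have yw : y ** w = w ** y by apply: wc; rewrite yZ Zy.
by rewrite -yw -cmulA wE yZ.
Qed.

End Positive.

(** * Contractive and isometric *-homomorphisms *)

Section StarHom.
Context {R : realType} {A B : cstarType R} (f : A -> B) (hf : star_hom f).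

Lemma hom0 : f 0 = 0.
Proof. by rewrite -(scale0r (0 : A)) (star_homZ hf) scale0r. Qed.

Lemma homN x : f (- x) = - f x.
Proof. by rewrite -(scaleN1r x) (star_homZ hf) scaleN1r. Qed.

Lemma homB x y : f (x - y) = f x - f y.
Proof. by rewrite (star_homD hf) homN. Qed.

Lemma hom_sum (I : Type) (s : seq I) (P : pred I) (g : I -> A) :
  f (\sum_(i <- s | P i) g i) = \sum_(i <- s | P i) f (g i).
Proof. exact: (big_morph f (star_homD hf) hom0). Qed.

Lemma pos_hom a : pos a -> pos (f a).
Proof.
move=> /pos_sqrt[b [<- /pos_sa sb _]].
by rewrite (star_homM hf); apply: pos_sq; rewrite -(star_homS hf) sb.
Qed.

(** The image of the positive element [nrm x ^2 - x^* x] is positive, which bounds the norm of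
    [(f x)^* f x]. *)
Lemma nrm_hom_le x : nrm (f x) <= nrm x.
Proof.
have := pos_hom (pos_le_sqnrm x).
rewrite homB (star_homZ hf) (star_hom1 hf) (star_homM hf) (star_homS hf) => h.
have := pos_nrm_le_scal (pos_starM (f x)) h (sqr_ge0 _); rewrite nrm_starM.
by rewrite ler_sqr ?nnegrE ?nrm_ge0.
Qed.

Hypothesis f_iso : forall x, `|f x| = `|x|.

Lemma nrm_iso x : nrm (f x) = nrm x.
Proof. by rewrite /nrm f_iso. Qed.

Lemma iso_inj : injective f.
Proof. by move=> x y e; apply: sub_nrm_arb0 => r /ltW r0; rewrite -nrm_iso homB e subrr nrm0. Qed.

(** Positivity is reflected as well as preserved, because [pos] speaks only of the unit, the
    involution and the norm. *)
Lemma pos_iso a : pos (f a) -> pos a.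
Proof.
move=> [sa [t ta]]; split; first by apply: iso_inj; rewrite (star_homS hf).
by exists t; rewrite -nrm_iso homB (star_homZ hf) (star_hom1 hf).
Qed.

Lemma iso_complete (u : nat -> A) (y : B) : tendsto (fun n => f (u n)) y ->
  exists2 x, f x = y & tendsto u x.
Proof.
move=> uy; have [|x ux] := @cauchy_tendsto R A u.
  move=> e e0; have e20 : 0 < e / 2 by rewrite divr_gt0.
  have [N hN] := uy _ e20; exists N => m n /hN hm /hN hn.
  rewrite -nrm_iso homB; have := nrm_dist y (f (u m)) (f (u n)).
  by rewrite (nrmBC y (f (u n))); lra.
exists x => //; apply: tendsto_unique uy => e /ux[N hN].
by exists N => n /hN; rewrite -homB nrm_iso.
Qed.

End StarHom.

(** * Unconditional sums and square-summable families *)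

Section UnconditionalSums.
Context {R : realType} {I : choiceType}.
Implicit Types (s t : seq I).

(* Limits over the finite subsets of [I], represented by duplicate-free lists, so that
   translations of the index set [int] preserve sums. *)
Definition has_gsum (V : normedModType R[i]) (f : I -> V) (v : V) : Prop :=
  forall e : R, 0 < e -> exists s, forall t, uniq t -> {subset s <= t} ->
    nrm (\sum_(i <- t) f i - v) <= e.

Definition gsum (V : normedModType R[i]) (f : I -> V) : V := xget 0 (has_gsum f).

Lemma sum_uniq_sub (V : zmodType) (f : I -> V) s t : uniq s -> uniq t ->
  {subset s <= t} ->
  \sum_(i <- t) f i = \sum_(i <- s) f i + \sum_(i <- [seq i <- t | i \notin s]) f i.
Proof.
move=> us ut st; rewrite -big_cat; apply: perm_big; apply: uniq_perm => //.
  rewrite cat_uniq us filter_uniq // andbT /=; apply/hasPn => i.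
  by rewrite mem_filter => /andP[].
by move=> i; rewrite mem_cat mem_filter; case: (boolP (i \in s)) => [/st ->|].
Qed.

Lemma sum_off_support (V : zmodType) (f : I -> V) s t : uniq s -> uniq t ->
  {subset s <= t} -> (forall i, i \notin s -> f i = 0) ->
  \sum_(i <- t) f i = \sum_(i <- s) f i.
Proof.
move=> us ut st f0; rewrite (sum_uniq_sub f us ut st) [X in _ + X]big1_seq ?addr0 //.
by move=> i /andP[_]; rewrite mem_filter => /andP[/f0].
Qed.

Lemma has_gsum_unique (V : normedModType R[i]) (f : I -> V) v w :
  has_gsum f v -> has_gsum f w -> v = w.
Proof.
move=> hv hw; apply: sub_nrm_arb0 => e e0; have e20 : 0 < e / 2 by rewrite divr_gt0.
have [s hs] := hv _ e20; have [s' hs'] := hw _ e20.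
pose t := undup (s ++ s').
have := hs t (undup_uniq _) _; have := hs' t (undup_uniq _) _.
have st : {subset s <= t} by move=> i; rewrite mem_undup mem_cat => ->.
have st' : {subset s' <= t} by move=> i; rewrite mem_undup mem_cat orbC => ->.
move=> /(_ st') h1 /(_ st) h2.
have := nrm_dist (\sum_(i <- t) f i) v w; rewrite (nrmBC v (\sum_(i <- t) _)); lra.
Qed.

Lemma gsumE (V : normedModType R[i]) (f : I -> V) v : has_gsum f v -> gsum f = v.
Proof.
move=> h; suff hg : has_gsum f (gsum f) by exact: has_gsum_unique hg h.
by apply: (xgetPex 0 (P := has_gsum f)); exists v.
Qed.

Lemma has_gsum_fin (V : normedModType R[i]) (f : I -> V) s : uniq s ->
  (forall i, i \notin s -> f i = 0) -> has_gsum f (\sum_(i <- s) f i).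
Proof.
move=> us f0 e e0; exists s => t ut st.
by rewrite (sum_off_support us ut st f0) subrr nrm0 ltW.
Qed.

Lemma has_gsumD (V : normedModType R[i]) (f g : I -> V) v w :
  has_gsum f v -> has_gsum g w -> has_gsum (fun i => f i + g i) (v + w).
Proof.
move=> hv hw e e0; have e20 : 0 < e / 2 by rewrite divr_gt0.
have [s hs] := hv _ e20; have [s' hs'] := hw _ e20; exists (s ++ s') => t ut st.
have h1 : nrm (\sum_(i <- t) f i - v) <= e / 2.
  by apply: hs => // i si; apply: st; rewrite mem_cat si.
have h2 : nrm (\sum_(i <- t) g i - w) <= e / 2.
  by apply: hs' => // i si; apply: st; rewrite mem_cat si orbT.
rewrite big_split /= opprD addrACA.
have := nrmD (\sum_(i <- t) f i - v) (\sum_(i <- t) g i - w); lra.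
Qed.

Lemma has_gsum_map (V W : normedModType R[i]) (h : V -> W) (C : R) (f : I -> V) v :
  (forall x y, h (x - y) = h x - h y) -> (forall x, nrm (h x) <= C * nrm x) ->
  has_gsum f v -> has_gsum (fun i => h (f i)) (h v).
Proof.
move=> hB hC hv e e0; have C0 : 0 < `|C| + 1 by rewrite ltr_wpDl.
have [|s hs] := hv (e / (`|C| + 1)); first by rewrite divr_gt0.
exists s => t ut st; have := hs t ut st; rewrite ler_pdivlMr // => h1.
have h0 : h 0 = 0 by rewrite -(subrr 0) hB subrr.
have hD x y : h (x + y) = h x + h y.
  by rewrite -[y in LHS]opprK hB -[in RHS](opprK y) -(sub0r (- y)) [in RHS]hB h0 sub0r.
rewrite -(big_morph h hD h0) -hB; apply: le_trans (hC _) _.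
have := nrm_ge0 (\sum_(i <- t) f i - v); have := ler_norm C; nra.
Qed.

Lemma has_gsum_cauchy (V : completeNormedModType R[i]) (f : I -> V) :
  (forall e : R, 0 < e -> exists2 s, uniq s & forall t, uniq t ->
     {in t, forall i, i \notin s} -> nrm (\sum_(i <- t) f i) <= e) ->
  has_gsum f (gsum f).
Proof.
move=> h; suff [v hv] : exists v, has_gsum f v by rewrite (gsumE hv).
have hn n : exists s, uniq s /\ forall t, uniq t -> {subset s <= t} ->
    nrm (\sum_(i <- t) f i - \sum_(i <- s) f i) <= n.+1%:R^-1.
  have [|s us hs] := h n.+1%:R^-1; first by rewrite invr_gt0 ltr0n.
  exists s; split=> // t ut st; rewrite (sum_uniq_sub f us ut st) addrC addKr.
  apply: hs; first exact: filter_uniq.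
  by move=> i; rewrite mem_filter => /andP[].
have [s hs] := choice hn.
(* Cumulative unions: [w n] contains every [s m] with [m <= n], which makes the sums over [w n] a
   Cauchy sequence. *)
pose w n := undup (flatten [seq s m | m <- iota 0 n.+1]).
have sw m n : (m <= n)%N -> {subset s m <= w n}.
  move=> mn i im; rewrite mem_undup; apply/flattenP; exists (s m) => //.
  by apply/mapP; exists m => //; rewrite mem_iota.
have inv2 (e : R) : 0 < e -> exists N : nat, N.+1%:R^-1 <= e / 2.
  by move=> e0; apply: inv_archi; rewrite divr_gt0.
have [|v hv] := @cauchy_tendsto R V (fun n => \sum_(i <- w n) f i).
  move=> e /inv2[N hN]; exists N => m n /sw Nm /sw Nn.
  have [us sN] := hs N.
  have := le_trans (sN (w m) (undup_uniq _) Nm) hN.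
  have := le_trans (sN (w n) (undup_uniq _) Nn) hN.
  have := nrm_dist (\sum_(i <- s N) f i) (\sum_(i <- w m) f i) (\sum_(i <- w n) f i).
  rewrite (nrmBC (\sum_(i <- s N) f i) (\sum_(i <- w n) f i)); lra.
exists v => e e0.
have [|N hN] := inv2 (e / 2); first by rewrite divr_gt0.
have [|M hM] := hv (e / 2); first by rewrite divr_gt0.
have [us sN] := hs N; exists (s N) => t ut st.
pose n := maxn N M.
have := le_trans (sN t ut st) hN.
have := le_trans (sN (w n) (undup_uniq _) (sw N n (leq_maxl _ _))) hN.
have := hM n (leq_maxr _ _).
have := nrm_dist (\sum_(i <- s N) f i) (\sum_(i <- t) f i) v.
have := nrm_dist (\sum_(i <- w n) f i) (\sum_(i <- s N) f i) v.
rewrite (nrmBC (\sum_(i <- s N) f i) (\sum_(i <- w n) f i)); lra.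
Qed.

Lemma has_gsum_nrm_le (V : normedModType R[i]) (f : I -> V) v (M : R) :
  has_gsum f v -> (forall s, uniq s -> nrm (\sum_(i <- s) f i) <= M) -> nrm v <= M.
Proof.
move=> hv hM; apply/ler_addgt0Pr => e e0; have [s hs] := hv _ e0.
have h : nrm (\sum_(i <- undup s) f i - v) <= e.
  by apply: hs => [|i]; [exact: undup_uniq|rewrite mem_undup].
have := hM _ (undup_uniq s); have := nrm_leD v (\sum_(i <- undup s) f i).
rewrite (nrmBC v); lra.
Qed.

End UnconditionalSums.

Lemma has_gsum_reindex (R : realType) (I J : choiceType) (V : normedModType R[i])
    (f : I -> V) v (h : J -> I) (h' : I -> J) : cancel h h' -> cancel h' h ->
  has_gsum f v -> has_gsum (fun j => f (h j)) v.
Proof.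
move=> hK h'K hv e /hv[s hs]; exists (map h' s) => t ut st.
have := hs (map h t); rewrite big_map; apply.
  by rewrite map_inj_uniq //; exact: can_inj hK.
by move=> i si; apply/mapP; exists (h' i) => //; apply/st/map_f.
Qed.

Section Gram.
Context {R : realType} {A : cstarType R} {I : choiceType}.
Implicit Types (s t : seq I) (x y : I -> A).

Definition gram s x y : A := \sum_(i <- s) star (x i) ** y i.

Lemma gram_pos s x : pos (gram s x x).
Proof. by apply: pos_sum => i _; exact: pos_starM. Qed.

Lemma gram_cs s x y : nrm (gram s x y) ^+ 2 <= nrm (gram s x x) * nrm (gram s y y).
Proof.
apply: cauchy_schwarz (gram_pos s x) _ => c.
rewrite /gram cmul_sumr cmul_suml cmul_sumr star_sum cmul_suml -!sumrB -big_split /=.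
apply: pos_sum => i _.
have := pos_starM (x i ** c - y i); congr pos.
by rewrite starB !starM starK; ncring.
Qed.

Lemma gramD_le s x y :
  nrm (gram s (fun i => x i + y i) (fun i => x i + y i)) <=
  2 * (nrm (gram s x x) + nrm (gram s y y)).
Proof.
have -> : gram s (fun i => x i + y i) (fun i => x i + y i) =
    gram s x x + gram s x y + (gram s y x + gram s y y).
  rewrite /gram -!big_split /=; apply: eq_bigr => i _.
  by rewrite starD; ncring.
have := nrmD (gram s x x + gram s x y) (gram s y x + gram s y y).
have := nrmD (gram s x x) (gram s x y); have := nrmD (gram s y x) (gram s y y).
have := gram_cs s x y; have := gram_cs s y x.
have := nrm_ge0 (gram s x x); have := nrm_ge0 (gram s y y).
have := nrm_ge0 (gram s x y); have := nrm_ge0 (gram s y x).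
move: (nrm (gram s x x)) (nrm (gram s y y)) (nrm (gram s x y)) (nrm (gram s y x)).
move=> a b c d d0 c0 b0 a0 hd hc.
have hc' : 2 * c <= a + b.
  rewrite -ler_sqr ?nnegrE ?mulr_ge0 ?addr_ge0 //; have := sqr_ge0 (a - b); nra.
have hd' : 2 * d <= a + b.
  rewrite -ler_sqr ?nnegrE ?mulr_ge0 ?addr_ge0 //; have := sqr_ge0 (a - b); nra.
lra.
Qed.

(** Smallness is asked of the norm of the Gram sum, not of the sum of the squared norms; the latter
    is a stronger condition in a Hilbert module. *)
Definition sumsq x : Prop := forall e : R, 0 < e -> exists2 s, uniq s &
  forall t, uniq t -> {in t, forall i, i \notin s} -> nrm (gram t x x) <= e.

Lemma sumsq_fin x s : (forall i, i \notin s -> x i = 0) -> sumsq x.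
Proof.
move=> x0 e e0; exists (undup s); first exact: undup_uniq.
move=> t ut ts; rewrite /gram big1_seq ?nrm0 ?ltW // => i /andP[_ /ts].
by rewrite mem_undup => /x0 ->; rewrite cmul0r.
Qed.

Lemma sumsqD x y : sumsq x -> sumsq y -> sumsq (fun i => x i + y i).
Proof.
move=> hx hy e e0; have e40 : 0 < e / 4 by rewrite divr_gt0.
have [s us hs] := hx _ e40; have [s' us' hs'] := hy _ e40.
exists (undup (s ++ s')); first exact: undup_uniq.
move=> t ut ts; apply: le_trans (gramD_le _ _ _) _.
have h1 : nrm (gram t x x) <= e / 4.
  by apply: hs => // i /ts; rewrite mem_undup mem_cat; apply: contra => ->.
have h2 : nrm (gram t y y) <= e / 4.
  by apply: hs' => // i /ts; rewrite mem_undup mem_cat orbC; apply: contra => ->.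
lra.
Qed.

Lemma sumsq_dom x y (C : R) : (forall s, nrm (gram s y y) <= C * nrm (gram s x x)) ->
  sumsq x -> sumsq y.
Proof.
move=> yx hx e e0; have C0 : 0 < `|C| + 1 by rewrite ltr_wpDl.
have [|s us hs] := hx (e / (`|C| + 1)); first by rewrite divr_gt0.
exists s => // t ut ts; have := hs t ut ts; rewrite ler_pdivlMr // => h1.
apply: le_trans (yx _) _.
have := nrm_ge0 (gram t x x); have := ler_norm C; nra.
Qed.

(** The factor sits between [x i^*] and [x i] and cannot be taken out of the sum; instead
    [a^* a <= nrm a ^2] is conjugated by each [x i]. *)
Lemma gram_Ml s a x :
  nrm (gram s (fun i => a ** x i) (fun i => a ** x i)) <= nrm a ^+ 2 * nrm (gram s x x).
Proof.
have := @nrm_pos_mono _ _ (gram s (fun i => a ** x i) (fun i => a ** x i))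
  ((nrm a ^+ 2)%:C *: gram s x x).
rewrite nrmZr ger0_norm ?sqr_ge0 //; apply; first exact: gram_pos.
rewrite /gram scaler_sumr -sumrB; apply: pos_sum => i _.
have := pos_conj (x i) (pos_le_sqnrm a); congr pos.
by rewrite starM; ncring.
Qed.

Lemma gram_Mr s a x :
  nrm (gram s (fun i => x i ** a) (fun i => x i ** a)) <= nrm a ^+ 2 * nrm (gram s x x).
Proof.
have -> : gram s (fun i => x i ** a) (fun i => x i ** a) = star a ** gram s x x ** a.
  rewrite /gram cmul_sumr cmul_suml; apply: eq_bigr => i _.
  by rewrite starM !cmulA.
have := nrmM (star a ** gram s x x) a; have := nrmM (star a) (gram s x x).
rewrite nrm_star; have := nrm_ge0 a.
have := nrm_ge0 (star a ** gram s x x); nra.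
Qed.

Lemma gramZ s (k : R[i]) x :
  nrm (gram s (fun i => k *: x i) (fun i => k *: x i)) =
  (complex.Re `|k|) ^+ 2 * nrm (gram s x x).
Proof.
have -> : gram s (fun i => k *: x i) (fun i => k *: x i) = (k * k^*%C) *: gram s x x.
  rewrite /gram scaler_sumr; apply: eq_bigr => i _.
  by rewrite starZ cmulZl cmulZr scalerA mulrC.
have e : `|k| = (complex.Re `|k|)%:C by rewrite RRe_real // realE normr_ge0.
by rewrite nrmZ -sqr_normc normrX normr_id {1}e -rmorphXn.
Qed.

Lemma sumsqZ (k : R[i]) x : sumsq x -> sumsq (fun i => k *: x i).
Proof. by apply: (sumsq_dom (C := (complex.Re `|k|) ^+ 2)) => s; rewrite gramZ. Qed.

Lemma gram_gsum x y : sumsq x -> sumsq y ->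
  has_gsum (fun i => star (x i) ** y i) (gsum (fun i => star (x i) ** y i)).
Proof.
move=> hx hy; apply: has_gsum_cauchy => e e0.
have [s us hs] := hx _ e0; have [s' us' hs'] := hy _ e0.
exists (undup (s ++ s')); first exact: undup_uniq.
move=> t ut ts.
have h1 : nrm (gram t x x) <= e.
  by apply: hs => // i /ts; rewrite mem_undup mem_cat; apply: contra => ->.
have h2 : nrm (gram t y y) <= e.
  by apply: hs' => // i /ts; rewrite mem_undup mem_cat orbC; apply: contra => ->.
rewrite -ler_sqr ?nnegrE ?nrm_ge0 ?(ltW e0) //.
have := gram_cs t x y; rewrite -/(gram t x y).
by have := nrm_ge0 (gram t x x); have := nrm_ge0 (gram t y y); nra.
Qed.

End Gram.

Record csub (R : realType) (A : cstarType R) := CSub {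
  cs_set :> set A;
  cs_closed : closed cs_set;
  cs0 : cs_set 0;
  cs_lin : forall (c : R[i]) x y, cs_set x -> cs_set y -> cs_set (c *: x + y)
}.

Section SeqComplete.
Context {R : realType} (V : normedModType R[i]).
Hypothesis V_seq : forall u : nat -> V,
  (forall e : R, 0 < e -> exists N, forall m n,
     (N <= m)%N -> (N <= n)%N -> nrm (u m - u n) <= e) ->
  exists l, tendsto u l.

(** From a Cauchy filter take centres of balls of radius [1/(n+1)] that belong to it. Any two of
    these balls meet, so the centres form a Cauchy sequence, and its limit is the limit of the
    filter. *)
Lemma seq_complete (F : set_system V) : ProperFilter F -> cauchy F -> cvg F.
Proof.
move=> FF /cauchyP cF.
have hn n : exists x : V, F (ball x (n.+1%:R^-1)%:C).
  by apply: cF; rewrite ltcR invr_gt0 ltr0n.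
have [u hu] := choice hn.
have near m n (e : R) : m.+1%:R^-1 <= e -> n.+1%:R^-1 <= e -> nrm (u m - u n) <= e + e.
  move=> me ne; have [z []] := filter_ex (filterI (hu m) (hu n)).
  rewrite -!ball_normE /ball_ /= !normE !ltcR.
  move=> /lt_le_trans/(_ me) h1 /lt_le_trans/(_ ne) h2.
  have := nrm_dist z (u m) (u n); rewrite (nrmBC z (u n)); lra.
have inv_mono N n : (N <= n)%N -> n.+1%:R^-1 <= N.+1%:R^-1 :> R.
  by move=> Nn; rewrite lef_pV2 ?posrE ?ltr0n // ler_nat.
have [|l hl] := V_seq (u := u).
  move=> e e0; have [|N hN] := @inv_archi R (e / 2); first by rewrite divr_gt0.
  exists N => m n /inv_mono Nm /inv_mono Nn.
  apply: le_trans (near m n (e / 2) _ _) _; last by lra.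
    exact: le_trans Nm hN.
  exact: le_trans Nn hN.
apply/cvg_ex; exists l; apply/cvgrPdist_lt => _ /pos_complexE[e e0 ->].
have e40 : 0 < e / 4 by rewrite divr_gt0.
have [N hN] := inv_archi e40; have [M hM] := hl _ e40.
pose n := maxn N M.
have h1 := le_trans (inv_mono N n (leq_maxl _ _)) hN; have h2 := hM n (leq_maxr _ _).
apply: filterS (hu n) => z; rewrite -ball_normE /ball_ /= !normE !ltcR => h3.
have h4 := lt_le_trans h3 h1.
have := nrm_dist (u n) l z; rewrite (nrmBC l (u n)); lra.
Qed.

End SeqComplete.

(** * The Banach space of square-summable families with entries in given closed subspaces *)

Section L2.
Context {R : realType} {A : cstarType R} {I : choiceType}.
Variable S : I -> csub A.

(** A Boolean predicate on functions, so that the subtype inherits its module structure from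
    [I -> A]. *)
Definition l2pred : {pred I -> A} :=
  [pred x | `[< (forall i, cs_set (S i) (x i)) /\ sumsq x >]].

Lemma l2_submod : submod_closed l2pred.
Proof.
split=> [|c x y /asboolP[xS hx] /asboolP[yS hy]]; apply/asboolP.
  split=> [i|]; first exact: cs0.
  by apply: (sumsq_fin (s := [::])) => i _.
split=> [i|]; first exact: cs_lin.
exact: sumsqD (sumsqZ c hx) hy.
Qed.

HB.instance Definition _ := GRing.isSubmodClosed.Build R[i] (I -> A) l2pred l2_submod.

Record l2 := L2 { l2val :> I -> A; l2valP : l2val \in l2pred }.

HB.instance Definition _ := [isSub for l2val].
HB.instance Definition _ := [Choice of l2 by <:].
HB.instance Definition _ := [SubChoice_isSubLmodule of l2 by <:].

Implicit Types x y z : l2.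

Lemma l2S x i : cs_set (S i) (x i).
Proof. by have /asboolP[] := l2valP x. Qed.

Lemma l2_sumsq x : sumsq x.
Proof. by have /asboolP[] := l2valP x. Qed.

Definition mkl2 (f : I -> A) (fS : forall i, cs_set (S i) (f i)) (hf : sumsq f) : l2 :=
  L2 (introT (asboolP _) (conj fS hf)).

Lemma l2_ext x y : (forall i, x i = y i) -> x = y.
Proof. by move=> h; apply/val_inj/funext. Qed.

Lemma l2D x y i : (x + y) i = x i + y i. Proof. by []. Qed.
Lemma l2N x i : (- x) i = - x i. Proof. by []. Qed.
Lemma l2Z c x i : (c *: x) i = c *: x i. Proof. by []. Qed.
Lemma l20 i : (0 : l2) i = 0. Proof. by []. Qed.
Lemma l2_sum (J : Type) (s : seq J) (P : pred J) (f : J -> l2) i :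
  (\sum_(j <- s | P j) f j) i = \sum_(j <- s | P j) f j i.
Proof. exact: (big_morph (fun x => x i) (fun x y => l2D x y i) (l20 i)). Qed.

Definition ip x y : A := gsum (fun i => star (x i) ** y i).

Lemma ipP x y : has_gsum (fun i => star (x i) ** y i) (ip x y).
Proof. exact: gram_gsum (l2_sumsq x) (l2_sumsq y). Qed.

Lemma ipD x y z : ip x (y + z) = ip x y + ip x z.
Proof.
apply: gsumE; have := has_gsumD (ipP x y) (ipP x z).
by congr has_gsum; apply/funext => i; rewrite l2D cmulDr.
Qed.

Lemma ipZ (c : R[i]) x y : ip x (c *: y) = c *: ip x y.
Proof.
apply: gsumE.
have := has_gsum_map (h := *:%R c) (scalerBr c) _ (ipP x y).
move=> /(_ (complex.Re `|c|)) h.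
have {h} := h (fun v => eq_ind_r (fun a => a <= _) (lexx _) (nrmZ c v)).
by congr has_gsum; apply/funext => i; rewrite l2Z cmulZr.
Qed.

Lemma ip_star x y : star (ip x y) = ip y x.
Proof.
apply/esym/gsumE.
have := has_gsum_map (h := @star R A) (C := 1) starB _ (ipP x y).
have h1 (v : A) : nrm (star v) <= 1 * nrm v by rewrite nrm_star mul1r.
move=> /(_ h1); congr has_gsum; apply/funext => i; by rewrite starM starK.
Qed.

Lemma ip_pos x : pos (ip x x).
Proof.
apply: pos_closed => e e0; have [s hs] := ipP x x e0.
exists (gram (undup s) x x); first exact: gram_pos.
by rewrite nrmBC; apply: hs; [exact: undup_uniq|move=> i; rewrite mem_undup].
Qed.

Lemma ipDl x y z : ip (x + y) z = ip x z + ip y z.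
Proof. by rewrite -ip_star ipD starD !ip_star. Qed.

Lemma ipZl (c : R[i]) x y : ip (c *: x) y = c^*%C *: ip x y.
Proof. by rewrite -ip_star ipZ starZ ip_star. Qed.

Lemma ip_nrm_le x (M : R) : (forall s, uniq s -> nrm (gram s x x) <= M) ->
  nrm (ip x x) <= M.
Proof. exact: has_gsum_nrm_le (ipP x x). Qed.

Lemma pos_gsum_tail (f : I -> A) v s : has_gsum f v -> (forall i, pos (f i)) ->
  uniq s -> pos (v - \sum_(i <- s) f i).
Proof.
move=> hv pf us; apply: pos_closed => e e0; have [t ht] := hv _ e0.
pose w := undup (s ++ t).
have sw : {subset s <= w} by move=> i; rewrite mem_undup mem_cat => ->.
exists (\sum_(i <- w) f i - \sum_(i <- s) f i).
  rewrite (sum_uniq_sub f us (undup_uniq _) sw) addrC addKr.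
  by apply: pos_sum => i _.
rewrite opprB addrA subrK nrmBC; apply: ht; first exact: undup_uniq.
by move=> i; rewrite mem_undup mem_cat orbC => ->.
Qed.

Lemma gram_le_ip x s : uniq s -> nrm (gram s x x) <= nrm (ip x x).
Proof.
move=> us; apply: nrm_pos_mono (gram_pos s x) _.
by apply: pos_gsum_tail (ipP x x) _ us => i; exact: pos_starM.
Qed.

Lemma l2_coord_le x i : nrm (x i) ^+ 2 <= nrm (ip x x).
Proof.
by have := gram_le_ip x (s := [:: i]) isT; rewrite /gram big_seq1 nrm_starM.
Qed.

Lemma ip_cs x y : nrm (ip x y) ^+ 2 <= nrm (ip x x) * nrm (ip y y).
Proof.
apply: cauchy_schwarz (ip_pos x) _ => c.
have hMl (a : A) (f : I -> A) v : has_gsum f v -> has_gsum (fun i => a ** f i) (a ** v).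
  refine (has_gsum_map (h := cmul a) (cmulBr a) (nrmM a)).
have hMr (a : A) (f : I -> A) v : has_gsum f v -> has_gsum (fun i => f i ** a) (v ** a).
  refine (has_gsum_map (h := fun b : A => b ** a) (C := nrm a) _ _) => [b w|b].
    by rewrite cmulBl.
  by rewrite mulrC nrmM.
have hN (f : I -> A) v : has_gsum f v -> has_gsum (fun i => - f i) (- v).
  refine (has_gsum_map (h := fun b : A => - b) (C := 1) _ _) => [b w|b]; first by rewrite opprD.
  by rewrite nrmN mul1r.
have h1 := hMl (star c) _ _ (hMr c _ _ (ipP x x)).
have h2 := hN _ _ (hMl (star c) _ _ (ipP x y)).
have h3 := hN _ _ (hMr c _ _ (ipP y x)).
have h := has_gsumD (has_gsumD (has_gsumD h1 h2) h3) (ipP y y).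
(* With the empty list, [pos_gsum_tail] says that a sum of positive terms is positive; it reduces
   the claim to a square at each index. *)
have := pos_gsum_tail (s := [::]) h; rewrite big_nil subr0 cmulA -(ip_star x y).
apply=> // i; have := pos_starM (x i ** c - y i); congr pos.
by rewrite starB !starM; ncring.
Qed.

Definition l2norm x : R := Num.sqrt (nrm (ip x x)).

Lemma l2norm_sqr x : l2norm x ^+ 2 = nrm (ip x x).
Proof. by rewrite sqr_sqrtr ?nrm_ge0. Qed.

Lemma l2norm_ge0 x : 0 <= l2norm x. Proof. exact: sqrtr_ge0. Qed.

Lemma l2normD x y : l2norm (x + y) <= l2norm x + l2norm y.
Proof.
have cs u v : nrm (ip u v) <= l2norm u * l2norm v.
  rewrite -ler_sqr ?nnegrE ?mulr_ge0 ?l2norm_ge0 ?nrm_ge0 //.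
  by rewrite exprMn !l2norm_sqr ip_cs.
rewrite -ler_sqr ?nnegrE ?addr_ge0 ?l2norm_ge0 // l2norm_sqr.
have -> : ip (x + y) (x + y) = ip x x + ip x y + (ip y x + ip y y).
  by rewrite ipD !ipDl addrACA.
have := nrmD (ip x x + ip x y) (ip y x + ip y y).
have := nrmD (ip x x) (ip x y); have := nrmD (ip y x) (ip y y).
have := cs x y; have := cs y x; rewrite -!l2norm_sqr; nra.
Qed.

Lemma l2normZ (c : R[i]) x : l2norm (c *: x) = complex.Re `|c| * l2norm x.
Proof.
rewrite /l2norm ipZ ipZl !nrmZ normcJ mulrA -expr2 sqrtrM ?sqr_ge0 //.
by rewrite sqrtr_sqr ger0_norm // -ler0c RRe_real ?realE normr_ge0.
Qed.

Lemma l2norm0_eq0 x : l2norm x = 0 -> x = 0.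
Proof.
move=> x0; apply: l2_ext => i; apply: nrm0_eq0; apply/eqP.
rewrite -sqrf_eq0 eq_le sqr_ge0 andbT.
by apply: le_trans (l2_coord_le x i) _; rewrite -l2norm_sqr x0 expr0n.
Qed.

Lemma l2_normD x y : (l2norm (x + y))%:C <= (l2norm x)%:C + (l2norm y)%:C.
Proof. by rewrite -rmorphD lecR l2normD. Qed.

Lemma l2_normZ (c : R[i]) x : (l2norm (c *: x))%:C = `|c| * (l2norm x)%:C.
Proof.
have e : `|c| = (complex.Re `|c|)%:C by rewrite RRe_real // realE normr_ge0.
by rewrite l2normZ [in RHS]e -rmorphM.
Qed.

Lemma l2_norm_eq0 x : (l2norm x)%:C = 0 -> x = 0.
Proof. by move=> h; apply/l2norm0_eq0/complexI. Qed.

HB.instance Definition _ := Lmodule_isNormed.Build R[i] l2 l2_normD l2_normZ l2_norm_eq0.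

Lemma l2_nrm_sqr x : nrm x ^+ 2 = nrm (ip x x). Proof. exact: l2norm_sqr. Qed.

Lemma l2_nrm_le_gram x (M : R) : 0 <= M ->
  (forall s, uniq s -> nrm (gram s x x) <= M ^+ 2) -> nrm x <= M.
Proof.
move=> M0 h; rewrite -ler_sqr ?nnegrE ?nrm_ge0 // l2_nrm_sqr; exact: ip_nrm_le.
Qed.

(** The limit is taken entrywise. On each finite list the Gram norm of [u n - u m] obeys a bound
    independent of the list; letting [m] grow keeps the bound, which yields both square-summability
    of the limit and convergence to it. *)
Lemma l2_seq_complete (u : nat -> l2) :
  (forall e : R, 0 < e -> exists N, forall m n,
     (N <= m)%N -> (N <= n)%N -> nrm (u m - u n) <= e) ->
  exists l, tendsto u l.
Proof.
move=> hu.
have coord i : exists v, tendsto (fun n => u n i) v.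
  apply: cauchy_tendsto => e /hu[N hN]; exists N => m n Nm Nn.
  apply: le_trans (hN m n Nm Nn).
  rewrite -ler_sqr ?nnegrE ?nrm_ge0 // l2_nrm_sqr; exact: l2_coord_le (u m - u n) i.
have [y hy] := choice coord.
have yS i : cs_set (S i) (y i).
  apply: approx_closed (@cs_closed _ _ (S i)) _ => e /(hy i)[N hN].
  by exists (u N i); [exact: l2S|rewrite nrmBC; exact: hN].
have lim_gram s n : tendsto (fun m => gram s (u n - u m) (u n - u m))
    (gram s (fun i => u n i - y i) (fun i => u n i - y i)).
  rewrite /gram; elim: s => [|i s IH].
    by rewrite big_nil; apply: tendsto_ext (tendsto_cst 0) => m; rewrite big_nil.
  have h : tendsto (fun m => (u n - u m) i) (u n i - y i).
    move=> e /(hy i)[N hN]; exists N => m /hN.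
    have -> : (u n - u m) i - (u n i - y i) = y i - u m i by rewrite l2D l2N; ncring.
    by rewrite nrmBC.
  rewrite big_cons; apply: tendsto_ext (tendstoD (tendstoM (tendsto_star h) h) IH) => m.
  by rewrite big_cons.
have small e : 0 < e -> exists N, forall n, (N <= n)%N -> forall s, uniq s ->
    nrm (gram s (fun i => u n i - y i) (fun i => u n i - y i)) <= e ^+ 2.
  move=> e0; have [N hN] := hu e e0; exists N => n Nn s us.
  have := lim_gram s n => h.
  have {}h : tendsto (fun m => gram s (u n - u (m + N)%N) (u n - u (m + N)%N))
      (gram s (fun i => u n i - y i) (fun i => u n i - y i)).
    move=> d /h[M hM]; exists M => m Mm; apply: hM; exact: leq_trans Mm (leq_addr _ _).
  apply: tendsto_nrm_le h _ => m.
  apply: le_trans (gram_le_ip _ us) _; rewrite -l2_nrm_sqr.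
  by rewrite ler_sqr ?nnegrE ?nrm_ge0 ?(ltW e0) //; apply: hN => //; exact: leq_addl.
have ysq : sumsq y.
  (* Both tails, of [u N] and of [u N - y], are at most [e / 4], since [gramD_le] doubles their
     sum. *)
  move=> e e0; pose d := Num.sqrt (e / 4).
  have d0 : 0 < d by rewrite sqrtr_gt0 divr_gt0.
  have d2 : d ^+ 2 = e / 4 by rewrite sqr_sqrtr // divr_ge0 // ltW.
  have [N hN] := small d d0; have e40 : 0 < e / 4 by rewrite divr_gt0.
  have [s us hs] := l2_sumsq (u N) e40; exists s => // t ut ts.
  have := hs t ut ts; have := hN N (leqnn _) t ut; rewrite d2 => h1 h2.
  have -> : gram t y y = gram t (fun i => u N i + (-1) *: (u N i - y i))
                                (fun i => u N i + (-1) *: (u N i - y i)).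
    by apply: eq_bigr => i _; rewrite scaleN1r opprB addrC subrK.
  apply: le_trans (gramD_le _ _ _) _; rewrite gramZ normrN1 expr1n mul1r; lra.
exists (mkl2 yS ysq) => e e0; have [N hN] := small e e0; exists N => n Nn.
by apply: l2_nrm_le_gram; [exact: ltW|move=> s us; exact: hN].
Qed.

HB.instance Definition _ := Uniform_isComplete.Build l2 (seq_complete l2_seq_complete).

End L2.

(** * The conditional expectation of a circle action *)

Section CirclePoint.
Context {R : realType}.
Implicit Types t u : R.

Lemma circle_pointD t u : circle_point (t + u) = circle_point t * circle_point u.
Proof.
rewrite /circle_point mulrDr cosD sinD; apply/eqP; rewrite eq_complex /=.
by rewrite eqxx /= addrC [X in _ + X]mulrC.
Qed.

Lemma circle_point0 : circle_point 0 = 1 :> R[i].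
Proof. by rewrite /circle_point mulr0 cos0 sin0. Qed.

Lemma circle_point_half : circle_point (2^-1) = -1 :> R[i].
Proof.
rewrite /circle_point mulrAC mulfV ?mul1r ?pnatr_eq0 // cospi sinpi.
by apply/eqP; rewrite eq_complex /= oppr0 !eqxx.
Qed.

Lemma circle_point_norm t : `|circle_point t| = 1.
Proof. by rewrite normc_def /= cos2Dsin2 sqrtr1. Qed.

Lemma circle_point_neq0 t : circle_point t != 0.
Proof. by rewrite -normr_eq0 circle_point_norm oner_eq0. Qed.

Lemma circle_pointX t n : circle_point t ^+ n = circle_point (n%:R * t).
Proof.
elim: n => [|n IH]; first by rewrite mul0r circle_point0.
by rewrite exprS IH -circle_pointD -[in RHS]natr1 mulrDl mul1r addrC.
Qed.

Lemma circle_pointN t : circle_point (- t) = (circle_point t)^-1.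
Proof.
apply: (mulfI (circle_point_neq0 t)).
by rewrite -circle_pointD subrr circle_point0 mulfV ?circle_point_neq0.
Qed.

Lemma circle_pointz t (k : int) : circle_point t ^ k = circle_point (k%:~R * t).
Proof.
case: k => n; first by rewrite -exprnP circle_pointX pmulrn.
rewrite NegzE -exprnN circle_pointX -circle_pointN; congr circle_point.
by rewrite mulrNz mulNr -pmulrn.
Qed.

Lemma circle_point_near0 (e : R) : 0 < e ->
  exists2 d : R, 0 < d & forall u, `|u| <= d -> `|circle_point u - 1| <= e%:C.
Proof.
move=> e0; have e20 : 0 < e / 2 by rewrite divr_gt0.
have := @continuous_cos R 0; move=> /cvgrPdist_lt /(_ _ e20).
move=> /nbhs_ballP[a /= a0 ha].
have := @continuous_sin R 0; move=> /cvgrPdist_lt /(_ _ e20).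
move=> /nbhs_ballP[b /= b0 hb].
pose c := Num.min a b; have c0 : 0 < c by rewrite lt_min a0.
have p0 : 0 < 2 * pi :> R by rewrite mulr_gt0 // pi_gt0.
have cp0 : 0 < c / (2 * pi) / 2 by rewrite !divr_gt0.
exists (c / (2 * pi) / 2) => // u hu.
have hv : `|2 * pi * u| < c.
  rewrite normrM (gtr0_norm p0); apply: le_lt_trans (_ : c / 2 < c); last by lra.
  apply: le_trans (ler_wpM2l (ltW p0) hu) _.
  by rewrite mulrA mulrCA mulfV ?gt_eqF // mulr1.
have := ha (2 * pi * u); have := hb (2 * pi * u).
rewrite -!ball_normE /ball_ /= !sub0r !normrN cos0 sin0 sub0r normrN.
move=> /(_ _) h2 /(_ _) h1.
have {}h1 : `|1 - cos (2 * pi * u)| < e / 2.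
  by apply: h1; apply: lt_le_trans hv _; rewrite ge_min lexx.
have {}h2 : `|sin (2 * pi * u)| < e / 2.
  by apply: h2; apply: lt_le_trans hv _; rewrite ge_min lexx orbT.
have -> : circle_point u - 1 = (cos (2 * pi * u) - 1)%:C + 'i%C * (sin (2 * pi * u))%:C.
  by apply/eqP; rewrite eq_complex /=; apply/andP; split; apply/eqP; ring.
apply: le_trans (ler_normD _ _) _; rewrite normrM !normc_def /=.
rewrite !expr0n /= !addr0 !add0r expr1n sqrtr1 mul1r !sqrtr_sqr -rmorphD lecR.
rewrite distrC; lra.
Qed.

(* The number of points is a multiple of [2 |k|], which makes [-1] a power of the root
   of unity, so that the root differs from 1. *)
Lemma circle_root_sum (k : int) (m : nat) : k != 0 ->
  \sum_(j < (`|k| * 2 * m.+1)%N) circle_point (k%:~R * (j%:R / (`|k| * 2 * m.+1)%:R)) = 0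
  :> R[i].
Proof.
move=> k0; set n := (`|k| * 2 * m.+1)%N.
have ka0 : `|k|%N%:R != 0 :> R by rewrite pnatr_eq0 absz_eq0.
have m0 : m.+1%:R != 0 :> R by rewrite pnatr_eq0.
have n0 : n%:R != 0 :> R by rewrite /n !natrM !mulf_neq0 // pnatr_eq0.
pose z := circle_point (k%:~R / n%:R) : R[i].
have zX : z ^+ m.+1 = -1.
  rewrite circle_pointX.
  have -> : m.+1%:R * (k%:~R / n%:R) = (sgz k)%:~R * 2^-1 :> R.
    rewrite {1}[k]intEsg intrM -pmulrn /n !natrM.
    by field; rewrite addrC natr1 m0 ka0.
  rewrite -circle_pointz circle_point_half; case: sgzP k0 => // _ _.
  by rewrite -invr_expz ?expr1z invrN1.
have z1 : z != 1.
  apply/eqP => z1; move: zX; rewrite z1 expr1n => /eqP.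
  by rewrite -subr_eq0 opprK -mulr2n pnatr_eq0.
have zn : z ^+ n = 1.
  by rewrite /n mulnC exprM zX mulnC exprM sqrrN expr1n expr1n.
transitivity (\sum_(j < n) z ^+ j).
  by apply: eq_bigr => j _; rewrite circle_pointX; congr circle_point; ring.
apply: (mulfI (_ : z - 1 != 0)); first by rewrite subr_eq0.
by rewrite -subrX1 zn subrr mulr0.
Qed.

End CirclePoint.

Lemma norm_exprz (R : realType) (z : R[i]) (k : int) : `|z| = 1 -> `|z ^ k| = 1.
Proof.
move=> z1; case: k => n; first by rewrite -exprnP normrX z1 expr1n.
by rewrite NegzE -exprnN normfV normrX z1 expr1n invr1.
Qed.

(** * Spectral subspaces and finite sums of homogeneous elements *)

Inductive homog (V : zmodType) (S : int -> set V) : V -> Prop :=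
  | homog0 : homog S 0
  | homogS k x y : S k x -> homog S y -> homog S (x + y).

Lemma homog_spec (V : zmodType) (S : int -> set V) k x : S k x -> homog S x.
Proof. by move=> hx; rewrite -[x]addr0; apply: homogS hx _; exact: homog0. Qed.

Lemma homogD (V : zmodType) (S : int -> set V) x y :
  homog S x -> homog S y -> homog S (x + y).
Proof.
by move=> hx hy; elim: hx => [|k u v hu _ IH]; rewrite ?add0r // -addrA; exact: homogS hu IH.
Qed.

Section Spectral.
Context {R : realType} {B : cstarType R} (gam : R[i] -> B -> B).
Hypothesis gam_hom : forall z : R[i], `|z| = 1 -> star_hom (gam z).

Definition spec (k : int) : set B := [set x | forall z, `|z| = 1 -> gam z x = z ^ k *: x].

Lemma spec_lin k (c : R[i]) x y : spec k x -> spec k y -> spec k (c *: x + y).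
Proof.
move=> hx hy z z1; have g := gam_hom z1.
by rewrite (star_homD g) (star_homZ g) hx // hy // scalerDr !scalerA mulrC.
Qed.

Lemma spec0 k : spec k 0.
Proof. by move=> z z1; rewrite (hom0 (gam_hom z1)) scaler0. Qed.

Lemma specZ k (c : R[i]) x : spec k x -> spec k (c *: x).
Proof. by move=> hx; rewrite -[_ *: _]addr0; apply: spec_lin => //; exact: spec0. Qed.

Lemma specM k l x y : spec k x -> spec l y -> spec (k + l) (x ** y).
Proof.
move=> hx hy z z1; have g := gam_hom z1.
have z0 : z != 0 by rewrite -normr_eq0 z1 oner_eq0.
by rewrite (star_homM g) hx // hy // cmulZl cmulZr scalerA expfzDr.
Qed.

Lemma spec_star k x : spec k x -> spec (- k) (star x).
Proof.
move=> hx z z1; have g := gam_hom z1; rewrite (star_homS g) hx // starZ; congr (_ *: _).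
have zk : `|z ^ k| = 1 by rewrite norm_exprz.
have zk0 : z ^ k != 0 by rewrite -normr_eq0 zk oner_eq0.
by rewrite -invr_expz; apply: (mulfI zk0); rewrite -sqr_normc zk expr1n mulfV.
Qed.

Lemma spec_closed k : closed (spec k).
Proof.
apply: closed_approx => x hx z z1; apply: sub_nrm_arb0 => e e0.
have e20 : 0 < e / 2 by rewrite divr_gt0.
have [y hy xy] := hx _ e20; have g := gam_hom z1.
have zk : `|z ^ k| = 1 by rewrite norm_exprz.
have -> : gam z x - z ^ k *: x = gam z (x - y) - z ^ k *: (x - y).
  by rewrite (homB g) (hy z z1); ncring.
have := nrmB (gam z (x - y)) (z ^ k *: (x - y)); rewrite (nrmZ1 _ zk).
have := nrm_hom_le g (x - y); lra.
Qed.

Lemma homogZ (c : R[i]) x : homog spec x -> homog spec (c *: x).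
Proof.
elim=> [|k u v hu _ IH]; first by rewrite scaler0; exact: homog0.
by rewrite scalerDr; apply: homogS IH; exact: specZ hu.
Qed.

Lemma homogM x y : homog spec x -> homog spec y -> homog spec (x ** y).
Proof.
move=> hx hy; elim: hx => [|k u v hu _ IH]; first by rewrite cmul0l; exact: homog0.
rewrite cmulDl; apply: homogD IH; elim: hy => [|l a b ha _ IH].
  by rewrite cmul0r; exact: homog0.
by rewrite cmulDr; apply: homogS IH; exact: specM hu ha.
Qed.

Lemma homog_star x : homog spec x -> homog spec (star x).
Proof.
elim=> [|k u v hu _ IH]; first by rewrite star0; exact: homog0.
by rewrite starD; apply: homogS IH; exact: spec_star hu.
Qed.

End Spectral.

Section Expectation.
Context {R : realType} {B OT : cstarType R} (gam : R[i] -> B -> B).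
Context (iota : OT -> B) (E : B -> OT).
Hypothesis gam_hom : forall z : R[i], `|z| = 1 -> star_hom (gam z).
Hypothesis iota_incl : cstar_incl iota.
Hypothesis iota_range : range iota = fixed_points gam.
Hypothesis E_avg : forall x, circle_integral (fun z => gam z x) (iota (E x)).

Let hiota : star_hom iota := proj1 iota_incl.
Let iiota : forall x, `|iota x| = `|x| := proj2 iota_incl.

Let cp1 (t : R) : `|circle_point t| = 1 := circle_point_norm t.

Definition avg (n : nat) (x : B) : B :=
  n%:R^-1%:C *: \sum_(j < n) gam (circle_point (j%:R / n%:R)) x.

Lemma avg_tendsto x : tendsto (fun n => avg n x) (iota (E x)).
Proof.
move=> e e0; have [|d d0 hd] := E_avg x (e := e%:C); first by rewrite ltcR.
have d20 : 0 < d / 2 by rewrite divr_gt0.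
have [N hN] := inv_archi d20; exists N.+1 => n Nn.
have n0 : (0 < n)%N by exact: leq_trans Nn.
have nr0 : n%:R != 0 :> R by rewrite pnatr_eq0 -lt0n.
have step i : i.+1%:R / n%:R - i%:R / n%:R = n%:R^-1 :> R.
  by rewrite -mulrBl -natr1 addrC addKr mul1r.
have nd : n%:R^-1 < d.
  have : n%:R^-1 <= N.+1%:R^-1 :> R by rewrite lef_pV2 ?posrE ?ltr0n // ler_nat.
  by move=> /le_trans/(_ hN) /le_lt_trans; apply; lra.
pose p (i : nat) : R := i%:R / n%:R.
have := hd n p p; rewrite /p mul0r mulfV // => /(_ erefl erefl) h.
have {}h : `|\sum_(i < n) (p i.+1 - p i)%:C *: gam (circle_point (p i)) x
    - iota (E x)| < e%:C.
  apply: h => i _; last by rewrite step.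
  by rewrite lexx ler_pM2r ?invr_gt0 ?ltr0n // ler_nat leqnSn.
move: h; rewrite normE ltcR => /ltW; congr (nrm (_ - _) <= _).
by rewrite /avg scaler_sumr; apply: eq_bigr => i _; rewrite /p step.
Qed.

(** The algebraic properties of [E] are checked on the finite averages and carried over by this
    lemma. *)
Lemma E_unique x y : tendsto (fun n => avg n x) (iota y) -> E x = y.
Proof. by move=> h; apply: (iso_inj hiota iiota); exact: tendsto_unique (avg_tendsto x) h. Qed.

Lemma E_id a : E (iota a) = a.
Proof.
apply: E_unique => e e0; exists 1%N => n n0.
have fa : fixed_points gam (iota a) by rewrite -iota_range; exists a.
suff -> : avg n (iota a) = iota a by rewrite subrr nrm0 ltW.
rewrite /avg (eq_bigr (fun=> iota a)) => [|j _]; last exact: fa.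
rewrite sumr_const card_ord -(scaler_nat n (iota a)) scalerA.
have -> : n%:R = n%:R%:C :> R[i] by rewrite rmorph_nat.
by rewrite -rmorphM mulVf ?scale1r // pnatr_eq0 -lt0n.
Qed.

Lemma ED x y : E (x + y) = E x + E y.
Proof.
apply: E_unique; rewrite (star_homD hiota).
apply: tendsto_ext (tendstoD (avg_tendsto x) (avg_tendsto y)) => n.
rewrite /avg -scalerDr -big_split; congr (_ *: _); apply: eq_bigr => j _ /=.
by rewrite (star_homD (gam_hom (cp1 _))).
Qed.

Lemma EZ (c : R[i]) x : E (c *: x) = c *: E x.
Proof.
apply: E_unique; rewrite (star_homZ hiota).
apply: tendsto_ext (tendstoZ c (avg_tendsto x)) => n.
rewrite /avg scalerA mulrC -scalerA; congr (_ *: _); rewrite scaler_sumr.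
by apply: eq_bigr => j _; rewrite (star_homZ (gam_hom (cp1 _))).
Qed.

Lemma E_bimod a x b : E (iota a ** x ** iota b) = a ** E x ** b.
Proof.
have fx c : fixed_points gam (iota c) by rewrite -iota_range; exists c.
apply: E_unique; rewrite !(star_homM hiota).
apply: tendsto_ext (tendstoMr (iota b) (tendstoMl (iota a) (avg_tendsto x))) => n.
rewrite /avg cmulZr cmulZl cmul_sumr cmul_suml; congr (_ *: _).
apply: eq_bigr => j _; rewrite !(star_homM (gam_hom (cp1 _))).
by rewrite !(fx _ _ (cp1 _)).
Qed.

Lemma avg_pos n x : pos x -> pos (avg n x).
Proof.
move=> px; apply: posZ; first by rewrite invr_ge0 ler0n.
by apply: pos_sum => j _; apply: pos_hom px; exact: gam_hom (cp1 _).
Qed.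

Lemma E_pos x : pos x -> pos (E x).
Proof.
move=> px; apply: (pos_iso hiota iiota); apply: pos_closed => e /(avg_tendsto x)[N hN].
exists (avg N x); first exact: avg_pos.
by rewrite nrmBC; exact: hN.
Qed.

Lemma avg_nrm n x : nrm (avg n x) <= nrm x.
Proof.
rewrite /avg nrmZr ger0_norm ?invr_ge0 ?ler0n //.
have [->|n0] := posnP n; first by rewrite big_ord0 nrm0 mulr0 nrm_ge0.
rewrite ler_pdivrMl ?ltr0n //; apply: le_trans (nrm_sum _ _ _) _.
apply: le_trans (ler_sum _ (G := fun=> nrm x) _) _.
  by move=> j _; exact: nrm_hom_le (gam_hom (cp1 _)) x.
by rewrite sumr_const card_ord mulr_natl.
Qed.

Lemma E_nrm x : nrm (E x) <= nrm x.
Proof.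
rewrite -(nrm_iso iiota); apply: tendsto_nrm_le (avg_tendsto x) _ => n; exact: avg_nrm.
Qed.

Lemma iotaE x : spec gam 0 x -> iota (E x) = x.
Proof.
move=> hx; have : fixed_points gam x by move=> z z1; rewrite hx // expr0z scale1r.
by rewrite -iota_range => -[a _ <-]; rewrite E_id.
Qed.

Lemma iota_spec a : spec gam 0 (iota a).
Proof.
move=> z z1; have : fixed_points gam (iota a) by rewrite -iota_range; exists a.
by move=> /(_ z z1) ->; rewrite expr0z scale1r.
Qed.

Lemma E_spec k x : k != 0 -> spec gam k x -> E x = 0.
Proof.
move=> k0 hx; apply: (iso_inj hiota iiota); rewrite (hom0 hiota).
apply: sub_nrm_arb0 => e e0; have [N hN] := avg_tendsto x e0.
(* Along multiples of [2 |k|] the averages vanish exactly, by [circle_root_sum]; this subsequence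
   determines the limit. *)
have := hN (`|k| * 2 * N.+1)%N _.
have -> : avg (`|k| * 2 * N.+1)%N x = 0.
  rewrite /avg (eq_bigr (fun j : 'I_ _ =>
    circle_point (k%:~R * (j%:R / (`|k| * 2 * N.+1)%:R)) *: x)) => [|j _].
    by rewrite -scaler_suml circle_root_sum // scale0r scaler0.
  by rewrite hx // circle_pointz.
rewrite nrmBC; apply; apply: leq_trans (leqnSn N) (leq_pmull _ _).
by rewrite muln_gt0 absz_gt0 k0.
Qed.

Hypothesis homog_dense : forall x (e : R), 0 < e ->
  exists2 y, homog (spec gam) y & nrm (x - y) <= e.

(** Continuity is not part of [gauge_action]. On a component of degree [k] the action is
    multiplication by [z ^ k]; density of homogeneous sums and contractivity of each [gam z] extend
    continuity at 1 to every [y]. *)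
Lemma gam_continuous y (e : R) : 0 < e -> exists2 d : R, 0 < d &
  forall t, 0 <= t <= d -> nrm (gam (circle_point t) y - y) <= e.
Proof.
move=> e0.
have step x : homog (spec gam) x -> forall e : R, 0 < e -> exists2 d : R, 0 < d &
    forall t, 0 <= t <= d -> nrm (gam (circle_point t) x - x) <= e.
  elim=> [|k u v hu _ IH] r r0.
    by exists 1 => // t _; rewrite (hom0 (gam_hom (cp1 t))) subrr nrm0 ltW.
  have r20 : 0 < r / 2 by rewrite divr_gt0.
  have [d d0 hd] := IH _ r20.
  have u10 : 0 < nrm u + 1 by have := nrm_ge0 u; lra.
  have [|d' d'0 hd'] := @circle_point_near0 R (r / 2 / (nrm u + 1)); first by rewrite divr_gt0.
  have k10 : 0 < `|k%:~R| + 1 :> R by rewrite ltr_wpDl.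
  exists (Num.min d (d' / (`|k%:~R| + 1))); first by rewrite lt_min d0 divr_gt0.
  move=> t /andP[t0]; rewrite le_min => /andP[td td'].
  have := hd t; rewrite t0 td => /(_ isT) h1.
  have h2 : nrm (gam (circle_point t) u - u) <= r / 2.
    rewrite hu ?cp1 // circle_pointz -[X in _ - X]scale1r -scalerBl nrmZ.
    have := hd' (k%:~R * t); rewrite normrM (ger0_norm t0) => h.
    have {}h : `|circle_point (k%:~R * t) - 1| <= (r / 2 / (nrm u + 1))%:C.
      apply: h; move: td'; rewrite ler_pdivlMr //; have := normr_ge0 (k%:~R : R); nra.
    have : complex.Re `|circle_point (k%:~R * t) - 1| <= r / 2 / (nrm u + 1).
      by rewrite -lecR RRe_real // realE normr_ge0.
    rewrite ler_pdivlMr // => h3; have := nrm_ge0 u.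
    have : 0 <= complex.Re `|circle_point (k%:~R * t) - 1|.
      by rewrite -lecR RRe_real ?realE ?normr_ge0.
    nra.
  rewrite (star_homD (gam_hom (cp1 t))) opprD addrACA.
  have := nrmD (gam (circle_point t) u - u) (gam (circle_point t) v - v); lra.
have e30 : 0 < e / 3 by rewrite divr_gt0.
have [x hx yx] := homog_dense y e30; have [d d0 hd] := step x hx _ e30.
exists d => // t /hd h; have g := gam_hom (cp1 t).
have -> : gam (circle_point t) y - y =
    gam (circle_point t) (y - x) + (gam (circle_point t) x - x) - (y - x).
  by rewrite (homB g); ncring.
have := nrmB (gam (circle_point t) (y - x) + (gam (circle_point t) x - x)) (y - x).
have := nrmD (gam (circle_point t) (y - x)) (gam (circle_point t) x - x).
have := nrm_hom_le g (y - x); lra.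
Qed.

(* By continuity the average of [gam z y] is at least a multiple of [y], up to a small
   error: keep only the points of the circle that are close to 1. *)
Lemma E_faithful y : pos y -> E y = 0 -> y = 0.
Proof.
move=> py Ey; apply: nrm_arb0 => e e0; have e20 : 0 < e / 2 by rewrite divr_gt0.
have [d d0 hd] := gam_continuous y e20.
have [K hK] := inv_archi d0; pose k := K.+1.
have k0 : 0 < k%:R :> R by rewrite ltr0n.
have [|N hN] := avg_tendsto y (e := e / 2 / k%:R); first by rewrite divr_gt0.
(* With this [n], the first [N + 1] sample points lie in [[0, 1/k]], hence in [[0, d]], and form the
   proportion [1/k] of all points; this is why the average was made smaller than [e / 2 / k]. *)
pose n := (k * N.+1)%N; have Nn : (N <= n)%N by rewrite /n mulSn; apply/leqW/leq_addr.
have := hN n Nn; rewrite Ey (hom0 hiota) subr0 => h1.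
have n0 : 0 < n%:R :> R by rewrite ltr0n.
have nE : n%:R = k%:R * N.+1%:R :> R by rewrite natrM.
have LN : (N.+1 <= n)%N by rewrite /n mulSn leq_addr.
pose g j := gam (circle_point (j%:R / n%:R)) y.
have pg j : pos (g j) by rewrite /g; apply: pos_hom py; exact: gam_hom (cp1 _).
have h2 : nrm (\sum_(j < N.+1) g j) <= n%:R * nrm (avg n y).
  rewrite /avg nrmZr ger0_norm ?invr_ge0 ?ler0n // mulVKf ?gt_eqF //.
  apply: nrm_pos_mono; first by apply: pos_sum.
  have eg m : \sum_(j < m) g j = \sum_(0 <= j < m) g j by rewrite big_mkord.
  rewrite -[X in X - _]/(\sum_(j < n) g j) !eg (@big_cat_nat _ _ _ N.+1) //= addrAC subrr add0r.
  by apply: pos_sum.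
have h3 : nrm (N.+1%:R%:C *: y) <= nrm (\sum_(j < N.+1) g j) + N.+1%:R * (e / 2).
  have := nrm_leD (N.+1%:R%:C *: y) (\sum_(j < N.+1) g j).
  move=> /le_trans; apply; rewrite lerD2l nrmBC.
  have -> : \sum_(j < N.+1) g j - N.+1%:R%:C *: y = \sum_(j < N.+1) (g j - y).
    by rewrite sumrB sumr_const card_ord rmorph_nat scaler_nat.
  apply: le_trans (nrm_sum _ _ _) _.
  apply: le_trans (ler_sum _ (G := fun=> e / 2) _) _.
    move=> j _; apply: hd; rewrite divr_ge0 ?ler0n //=.
    apply: le_trans hK; rewrite nE -/k -[leRHS]mul1r ler_pdivrMr; last by rewrite -nE.
    by rewrite mul1r mulrA mulVf ?gt_eqF // mul1r ler_nat ltnW.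
  by rewrite sumr_const card_ord mulr_natl.
move: h3; rewrite nrmZr ger0_norm ?ler0n // => h3.
have N0 : 0 < N.+1%:R :> R by rewrite ltr0n.
move: h1; rewrite ler_pdivlMr // => h1; move: h2; rewrite nE => h2.
rewrite -(ler_pM2l N0); move: h1 h2 h3.
move: (nrm (avg n y)) (nrm y) (nrm (\sum_(j < N.+1) g j)) => a b c h1 h2 h3.
have : N.+1%:R * (a * k%:R) <= N.+1%:R * (e / 2) by rewrite ler_pM2l.
lra.
Qed.

Lemma E_faithful_cond_exp : faithful_cond_exp iota E.
Proof.
split=> [x y|c x|a|a x b|x|x|x]; rewrite ?ED ?EZ ?E_id ?E_bimod //.
- by apply/posP/E_pos/pos_starM.
- by rewrite !normE lecR E_nrm.
- move=> /(E_faithful (pos_starM x)) h; apply: nrm0_eq0; apply/eqP.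
  by rewrite -sqrf_eq0 -nrm_starM h nrm0.
Qed.

End Expectation.

(** * Hilbert modules and frames *)

Section HilbertModules.
Context {R : realType} {B : cstarType R} {H : hilbMod B}.
Implicit Types (x y z : H).

Lemma innerDl x y z : inner (x + y) z = inner x z + inner y z.
Proof. by rewrite -inner_star innerD starD !inner_star. Qed.

Lemma innerZl (c : R[i]) x y : inner (c *: x) y = c^*%C *: inner x y.
Proof. by rewrite -inner_star innerZ starZ inner_star. Qed.

Lemma inner0 x : inner x 0 = 0.
Proof. by rewrite -[X in inner x X](scale0r (0 : H)) innerZ scale0r. Qed.

Lemma inner0l x : inner 0 x = 0.
Proof. by rewrite -inner_star inner0 star0. Qed.

Lemma innerN x y : inner x (- y) = - inner x y.
Proof. by rewrite -(scaleN1r y) innerZ scaleN1r. Qed.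

Lemma innerNl x y : inner (- x) y = - inner x y.
Proof. by rewrite -inner_star innerN starN inner_star. Qed.

Lemma innerB x y z : inner x (y - z) = inner x y - inner x z.
Proof. by rewrite innerD innerN. Qed.

Lemma innerBl x y z : inner (x - y) z = inner x z - inner y z.
Proof. by rewrite innerDl innerNl. Qed.

Lemma innerMl x y b : inner (x <* b) y = star b ** inner x y.
Proof. by rewrite -inner_star innerM starM inner_star. Qed.

Lemma inner_sum (J : Type) (s : seq J) (P : pred J) (f : J -> H) x :
  inner x (\sum_(j <- s | P j) f j) = \sum_(j <- s | P j) inner x (f j).
Proof. exact: (big_morph (inner x) (innerD x) (inner0 x)). Qed.

Lemma inner_suml (J : Type) (s : seq J) (P : pred J) (f : J -> H) x :
  inner (\sum_(j <- s | P j) f j) x = \sum_(j <- s | P j) inner (f j) x.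
Proof.
exact: (big_morph (fun y => inner y x) (fun y z => innerDl y z x) (inner0l x)).
Qed.

Lemma inner_posP x : pos (inner x x). Proof. by apply/posP/inner_pos. Qed.

Lemma inner_nrm2 x : nrm x ^+ 2 = nrm (inner x x).
Proof. by apply: complexI; rewrite rmorphXn /= -!normE inner_norm. Qed.

Lemma inner_form_pos x y (c : B) :
  pos (star c ** inner x x ** c - star c ** inner x y - star (inner x y) ** c + inner y y).
Proof.
have := inner_posP (x <* c - y); congr pos.
by rewrite innerBl !innerB !innerM !innerMl inner_star; ncring.
Qed.

Lemma inner_cs x y : nrm (inner x y) <= nrm x * nrm y.
Proof.
rewrite -ler_sqr ?nnegrE ?mulr_ge0 ?nrm_ge0 // exprMn !inner_nrm2.
exact: cauchy_schwarz (inner_posP x) (inner_form_pos x y).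
Qed.

Lemma inner_eq0P x : inner x x = 0 -> x = 0.
Proof.
move=> h; apply: nrm0_eq0; apply/eqP.
by rewrite -sqrf_eq0 inner_nrm2 h nrm0.
Qed.

Lemma inner_total x y : (forall z, inner z x = inner z y) -> x = y.
Proof.
move=> h; apply/eqP; rewrite -subr_eq0; apply/eqP/inner_eq0P.
by rewrite innerB h subrr.
Qed.

Lemma inner_lin_span (S : set H) x y v : (forall z, S z -> inner z x = inner z y) ->
  lin_span S v -> inner v x = inner v y.
Proof.
move=> h [n [c [w [wS ->]]]]; rewrite !inner_suml; apply: eq_bigr => i _.
by rewrite !innerZl h.
Qed.

Lemma inner_dense (S : set H) x y : dense (lin_span S) ->
  (forall z, S z -> inner z x = inner z y) -> x = y.
Proof.
move=> /dense_approx dS h; apply/eqP; rewrite -subr_eq0; apply/eqP/inner_eq0P.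
apply: nrm_arb0 => e e0; set v := x - y.
have v1 : 0 < nrm v + 1 by have := nrm_ge0 v; lra.
have [|w Sw vw] := dS v (e / (nrm v + 1)); first by rewrite divr_gt0.
have w0 : inner w v = 0 by rewrite innerB (inner_lin_span h Sw) subrr.
rewrite -[X in inner X _](subrK w) innerDl w0 addr0.
apply: le_trans (inner_cs _ _) _; move: vw; rewrite ler_pdivlMr // => vw.
have := nrm_ge0 (v - w); have := nrm_ge0 v; nra.
Qed.

End HilbertModules.

Section AdjointableMaps.
Context {R : realType} {B : cstarType R}.
Implicit Types (X Y Z : hilbMod B).

Lemma adjoint_pair_sym X Y (T : X -> Y) (S : Y -> X) :
  adjoint_pair T S -> adjoint_pair S T.
Proof. by move=> h x y; rewrite -inner_star -h inner_star. Qed.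

Lemma adjoint_pair_comp X Y Z (T : X -> Y) (S : Y -> X) (T' : Y -> Z) (S' : Z -> Y) :
  adjoint_pair T S -> adjoint_pair T' S' -> adjoint_pair (T' \o T) (S \o S').
Proof. by move=> h h' x z; rewrite /= h' h. Qed.

Lemma adjoint_pair_sum X Y (J : Type) (s : seq J) (T : J -> X -> Y) (S : J -> Y -> X) :
  (forall j, adjoint_pair (T j) (S j)) ->
  adjoint_pair (fun x => \sum_(j <- s) T j x) (fun y => \sum_(j <- s) S j y).
Proof.
move=> h x y; rewrite inner_suml inner_sum; apply: eq_bigr => j _; exact: h.
Qed.

Lemma adjoint_pair_id X : adjoint_pair (@id X) id. Proof. by []. Qed.

Lemma adjoint_pairN X Y (T : X -> Y) (S : Y -> X) : adjoint_pair T S ->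
  adjoint_pair (fun x => - T x) (fun y => - S y).
Proof. by move=> h x y; rewrite innerNl innerN h. Qed.

Lemma adjoint_pairD X Y (T T' : X -> Y) (S S' : Y -> X) : adjoint_pair T S ->
  adjoint_pair T' S' -> adjoint_pair (fun x => T x + T' x) (fun y => S y + S' y).
Proof. by move=> h h' x y; rewrite innerDl innerD h h'. Qed.

(* Adjointness replaces continuity: maps that agree on a total set are equal. *)
Lemma adjoint_pair_eq X Y (T T' : X -> Y) (S S' : Y -> X) (G : set X) :
  adjoint_pair T S -> adjoint_pair T' S' -> dense (lin_span G) ->
  (forall x, G x -> T x = T' x) -> T = T'.
Proof.
move=> h h' dG e; have SS : S = S'.
  apply/funext => y; apply: (inner_dense dG) => x Gx.
  by rewrite -h -h' e.
apply/funext => x; apply: inner_total => y.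
by rewrite -(adjoint_pair_sym h) -(adjoint_pair_sym h') SS.
Qed.

End AdjointableMaps.

Section Fullness.
Context {R : realType} {D : cstarType R} (X : corr D D).

(* Density gives [s = sum <x_i | y_i>] close to 1; by Cauchy-Schwarz [sum <y_i | y_i>]
   dominates a multiple of [s^* s], so it is invertible, and its inverse square root
   normalises the [y_i]. *)
Lemma full_frame : full X -> exists (n : nat) (v : 'I_n -> X),
  \sum_(i < n) inner (v i) (v i) = cone.
Proof.
(* For [s] within 1/4 of 1, the element [r = 1 - s] satisfies [nrm (r + r^* ) <= 1/2]; so
   [s^* s = 1 - (r + r^* ) + r^* r] is at least 1/2. *)
move=> /dense_approx /(_ cone 4^-1) [|_ [n [c [g [hg ->]]]] hs]; first by rewrite invr_gt0.
have hx0 i : exists x : X, exists y : X, g i = inner x y.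
  by have [x [y ->]] := hg i; exists x, y.
have [x hx] := choice hx0; have [y0 hy] := choice hx.
pose y i := c i *: y0 i.
pose s := \sum_(i < n) inner (x i) (y i).
have sE : \sum_(i < n) c i *: g i = s by apply: eq_bigr => i _; rewrite innerZ hy.
move: hs; rewrite sE => hs.
pose xx := \sum_(i < n) inner (x i) (x i).
pose yy := \sum_(i < n) inner (y i) (y i).
have pxx : pos xx by apply: pos_sum => i _; exact: inner_posP.
pose N := nrm xx + 1; have N0 : 0 < N by have := nrm_ge0 xx; rewrite /N; lra.
have pyy : pos (yy - N^-1%:C *: (star s ** s)).
  apply: (cauchy_schwarz_pos N0 pxx) => [|b]; first by rewrite /N; lra.
  rewrite /xx /s /yy cmul_sumr cmul_suml cmul_sumr star_sum cmul_suml -!sumrB -big_split.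
  by apply: pos_sum => i _; exact: inner_form_pos.
have pss : pos (star s ** s - (2^-1)%:C *: cone).
  pose r := cone - s.
  have := posD (@pos_scalB _ _ (2^-1) (r + star r) _ _) (pos_starM r).
  have -> : (2^-1)%:C *: cone - (r + star r) + star r ** r =
      star s ** s - (2^-1)%:C *: cone :> D.
    rewrite /r starB star1 fmorphV rmorph_nat; ncring; by field.
  apply; first by rewrite starD starK addrC.
  by have := nrmD r (star r); rewrite nrm_star; move: hs; rewrite -/r; lra.
have pc : pos (yy - (N^-1 * 2^-1)%:C *: cone).
  have NV0 : 0 <= N^-1 by rewrite invr_ge0 ltW.
  have := posD pyy (posZ NV0 pss); congr pos.
  by rewrite rmorphM; ncring.
have [||w [sw wE]] := pos_inv_sqrt _ _ pc.
- by rewrite star_sum; apply: eq_bigr => i _; rewrite inner_star.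
- by rewrite mulr_gt0 // invr_gt0.
exists n, (fun i => y i <* w); rewrite -wE /yy cmul_sumr cmul_suml.
by apply: eq_bigr => i _; rewrite innerM innerMl sw.
Qed.

End Fullness.

(** * Cuntz-Pimsner algebras *)

Section CuntzPimsnerRelations.
Context {R : realType} {D : cstarType R} (X : corr D D) (O : cuntz_pimsner X).

Let emb n (z : tpow (cp_pow O) n) : cp_fock O := @cp_emb R D X O n z.
Let tauf : X -> cp_fock O -> cp_fock O := @cp_tau_inf R D X O.
Let q : (cp_fock O -> cp_fock O) -> cp_quot O := @cp_q R D X O.
Let qP : quotient_by_compacts q := cp_qP O.

Lemma tau_q x : cp_incl (cp_tau O x) = q (tauf x).
Proof. exact: cp_tauE. Qed.

Let total : set (cp_fock O) := \bigcup_n range (@emb n).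

Let total_dense : dense (lin_span total) := hs_dense (cp_fockP O).
Lemma emb_inner n (z w : tpow (cp_pow O) n) : inner (emb z) (emb w) = inner z w.
Proof. exact: (hs_inner (cp_fockP O)). Qed.

Lemma emb_sum n (J : Type) (s : seq J) (F : J -> tpow (cp_pow O) n) :
  emb (\sum_(j <- s) F j) = \sum_(j <- s) emb (F j).
Proof.
have emb0 : @emb n 0 = 0.
  by rewrite -[X in emb X](scale0r 0) /emb (hsZ (cp_fockP O)) scale0r.
exact: (big_morph _ (@hsD _ _ _ _ _ _ (cp_fockP O) n) emb0).
Qed.

Lemma emb_orth n m (z : tpow (cp_pow O) n) (w : tpow (cp_pow O) m) : n <> m ->
  inner (emb z) (emb w) = 0.
Proof. exact: (hs_orth (cp_fockP O)). Qed.

(** Elementary tensors span only a dense subspace of a tensor power; since [emb] is isometric,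
    orthogonality to them extends to the whole summand. *)
Lemma emb_dense_orth n (S : set (tpow (cp_pow O) n)) v : dense (lin_span S) ->
  (forall z : tpow (cp_pow O) n, S z -> inner (emb z) v = 0) ->
  forall z : tpow (cp_pow O) n, inner (emb z) v = 0.
Proof.
move=> /dense_approx dS h z; apply: nrm_arb0 => e e0.
have v1 : 0 < nrm v + 1 by have := nrm_ge0 v; lra.
have [|w [m [c [g [gS wE]]]] zw] := dS z (e / (nrm v + 1)); first by rewrite divr_gt0.
have w0 : inner (emb w) v = 0.
  rewrite wE emb_sum inner_suml big1 // => i _.
  by rewrite /emb (hsZ (cp_fockP O)) innerZl h ?scaler0.
have := emb_sum [:: z - w; w] id; rewrite !big_cons !big_nil !addr0 /= subrK => ->.
rewrite innerDl w0 addr0; apply: le_trans (inner_cs _ _) _.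
have -> : nrm (emb (z - w)) = nrm (z - w).
  by apply/eqP; rewrite -(eqrXn2 (n := 2)) ?nrm_ge0 // !inner_nrm2 emb_inner.
move: zw; rewrite ler_pdivlMr // => zw.
have := nrm_ge0 (z - w); have := nrm_ge0 v; nra.
Qed.

Lemma tau_emb x n (z : tpow (cp_pow O) n) : tauf x (emb z) = @emb n.+1 (cp_tens x z).
Proof. exact: cp_tau_infE. Qed.

Lemma fock_ext (T T' : cp_fock O -> cp_fock O) S S' :
  adjoint_pair T S -> adjoint_pair T' S' ->
  (forall n (z : tpow (cp_pow O) n), T (emb z) = T' (emb z)) -> T = T'.
Proof.
by move=> h h' e; apply: (adjoint_pair_eq h h' total_dense) => _ [n _ [z _ <-]].
Qed.

Lemma emb_total v w :
  (forall n (z : tpow (cp_pow O) n), inner (emb z) v = inner (emb z) w) -> v = w.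
Proof. by move=> h; apply: (inner_dense total_dense) => _ [n _ [z _ <-]]. Qed.

Variables (T : X -> cp_fock O -> cp_fock O).
Hypothesis TP : forall x, adjoint_pair (tauf x) (T x).

(** The adjoint of a creation operator is the annihilation operator. It is identified by pairing
    with every summand, where only the degree [n] contributes. *)
Lemma annihilate_tens x x' n (z : tpow (cp_pow O) n) :
  T x (emb (cp_tens x' z)) = emb (inner x x' *> z).
Proof.
apply: emb_total => m w; rewrite -TP tau_emb.
have [mn|/eqP mn] := eqVneq m n.
  case: _ / mn z => z; rewrite !emb_inner.
  exact: (rt_inner (cp_tensP O m)).
by rewrite !emb_orth // => -[].
Qed.

Lemma annihilate_vacuum x d : T x (@emb 0 d) = 0.
Proof. by apply: emb_total => m w; rewrite -TP tau_emb emb_orth // inner0. Qed.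

Lemma incl_tau_star x : cp_incl (star (cp_tau O x)) = q (T x).
Proof.
by rewrite (star_homS (proj1 (cp_inclP O))) tau_q (qcS qP (TP x)).
Qed.

Let adjT x : adjointable (T x).
Proof. by exists (tauf x); exact: adjoint_pair_sym. Qed.

Let adjtau x : adjointable (tauf x).
Proof. by exists (T x). Qed.

Lemma q_sum (J : Type) (s : seq J) (F : J -> cp_fock O -> cp_fock O) :
  (forall j, adjointable (F j)) ->
  q (fun y => \sum_(j <- s) F j y) = \sum_(j <- s) q (F j).
Proof.
move=> adjF; have q0 : q (fun=> 0) = 0.
  have -> : (fun=> 0) = (fun y : cp_fock O => 0 *: id y).
    by apply/funext => y; rewrite scale0r.
  by rewrite (qcZ qP) ?scale0r //; exists id.
elim: s => [|i s IH].
  by rewrite big_nil -[RHS]q0; congr (q); apply/funext => y; rewrite big_nil.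
rewrite big_cons -IH -(qcD qP) //; last first.
  have [S hS] := choice adjF.
  by exists (fun y => \sum_(j <- s) S j y); exact: adjoint_pair_sum.
by congr (q); apply/funext => y; rewrite big_cons.
Qed.

(** This relation holds on the Fock module itself, in every degree including the vacuum, before
    passing to the quotient. *)
Lemma tau_left_frame (n : nat) (v : 'I_n -> X) :
  \sum_(i < n) inner (v i) (v i) = cone ->
  \sum_(i < n) star (cp_tau O (v i)) ** cp_tau O (v i) = cone.
Proof.
move=> hv; have hincl := proj1 (cp_inclP O).
apply: (iso_inj hincl (proj2 (cp_inclP O))).
rewrite (hom_sum hincl) (star_hom1 hincl) -(qc1 qP).
transitivity (\sum_(i < n) q (T (v i) \o tauf (v i))).
  apply: eq_bigr => i _.
  by rewrite (star_homM hincl) incl_tau_star tau_q (qcM qP).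
have pair i : adjoint_pair (T (v i) \o tauf (v i)) (T (v i) \o tauf (v i)).
  exact: adjoint_pair_comp (TP _) (adjoint_pair_sym (TP _)).
rewrite -q_sum => [|i]; last by exists (T (v i) \o tauf (v i)).
congr (q).
apply: (fock_ext (adjoint_pair_sum _ pair) (@adjoint_pair_id _ _ _)) => m z.
transitivity (\sum_(i < n) emb (inner (v i) (v i) *> z)).
  by apply: eq_bigr => i _ /=; rewrite tau_emb annihilate_tens.
rewrite -emb_sum; congr emb.
have lact0 : lact 0 z = 0 by rewrite -(scale0r (0 : D)) lactZ scale0r.
by rewrite -(big_morph (fun d => lact d z) (fun a b => lactD a b z) lact0) hv lact1.
Qed.

Lemma tau_right_frame (n : nat) (u : 'I_n -> X) :
  (forall x, x = \sum_(i < n) u i <* inner (u i) x) ->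
  \sum_(i < n) cp_tau O (u i) ** star (cp_tau O (u i)) = cone.
Proof.
move=> hu; have hincl := proj1 (cp_inclP O).
apply: (iso_inj hincl (proj2 (cp_inclP O))).
rewrite (hom_sum hincl) (star_hom1 hincl).
pose F y := \sum_(i < n) tauf (u i) (T (u i) y).
have pairF : adjoint_pair F F.
  apply: (@adjoint_pair_sum _ _ _ _ _ _ (fun i => tauf (u i) \o T (u i))) => i.
  exact: adjoint_pair_comp (adjoint_pair_sym (TP _)) (TP _).
have -> : \sum_(i < n) cp_incl (cp_tau O (u i) ** star (cp_tau O (u i))) = q F.
  rewrite (@q_sum _ _ (fun i => tauf (u i) \o T (u i))) => [|i]; last first.
    exists (tauf (u i) \o T (u i)).
    exact: adjoint_pair_comp (adjoint_pair_sym (TP _)) (TP _).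
  by apply: eq_bigr => i _; rewrite (star_homM hincl) incl_tau_star tau_q (qcM qP).
have tau0 x : tauf x 0 = 0.
  by apply: inner_total => y; rewrite inner0 -(adjoint_pair_sym (TP x)) inner0.
pose P y := y - F y; pose e := @emb 0 cone.
have pairP : adjoint_pair P P.
  exact: adjoint_pairD (@adjoint_pair_id _ _ _) (adjoint_pairN pairF).
have P0 d : P (@emb 0 d) = @emb 0 d.
  by rewrite /P /F big1 ?subr0 // => i _; rewrite annihilate_vacuum tau0.
have PS m x (z : tpow (cp_pow O) m) : P (@emb m.+1 (cp_tens x z)) = 0.
  apply/eqP; rewrite subr_eq0 eq_sym /F; apply/eqP.
  transitivity (\sum_(i < n) @emb m.+1 (cp_tens (u i <* inner (u i) x) z)).
    apply: eq_bigr => i _; rewrite annihilate_tens tau_emb.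
    by rewrite (rt_bal (cp_tensP O m)).
  rewrite -emb_sum; congr emb.
  have tens0 : cp_tens 0 z = 0.
    by rewrite -[X in cp_tens X](scale0r (0 : X)) (rtZl (cp_tensP O m)) scale0r.
  rewrite -(big_morph (fun x => cp_tens x z)
    (fun a b => rtDl (cp_tensP O m) a b z) tens0).
  by rewrite -hu.
(* Self-adjointness moves [P] to the test vector, where it is known: it fixes degree zero and kills
   the higher degrees. Degree zero is generated by [e]. *)
have PE y : P y = e <* inner e y.
  apply: emb_total => -[d|m z]; rewrite -?pairP ?innerM.
    rewrite P0 /e emb_inner.
    have -> : @emb 0 d = e <* d by rewrite /e /emb -(hsM (cp_fockP O)) /= cmul1l.
    by rewrite innerMl /= cmul1r.
  rewrite emb_orth // cmul0l pairP.
  apply: (emb_dense_orth (rt_dense (cp_tensP O m))) => _ [x [w ->]].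
  by rewrite -pairP PS inner0l.
(* The identity minus [P], in the shape to which [qcD] and [qcZ] apply; [P] has rank one and dies in
   the quotient. *)
have -> : F = (fun y => id y + - 1 *: P y).
  by apply/funext => y; rewrite /P /= scaleN1r opprB addrC subrK.
have adjP : adjointable P by exists P.
rewrite (qcD qP) ?(qcZ qP) //; first 1 last.
- by exists id.
- by exists (fun y => - P y); move=> a b; rewrite scaleN1r innerNl innerN pairP.
rewrite (proj2 (qc_ker qP adjP)) ?scaler0 ?addr0 ?(qc1 qP) //.
split=> // r r0; exists P; split; last first.
  split; first exact: ltW.
  by move=> y; rewrite subrr normr0 mulr_ge0 // ltW.
by exists 1%N, (fun=> e), (fun=> e) => y; rewrite big_ord1.
Qed.

End CuntzPimsnerRelations.

Section CuntzPimsnerGrading.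
Context {R : realType} {D : cstarType R} (X : corr D D) (O : cuntz_pimsner X).
Context (gam : R[i] -> O -> O) (gamP : gauge_action gam).

(** Limits of homogeneous sums form a closed *-subalgebra containing the generators. Generation is
    expressed in [cp_quot], so the argument runs on the image [S] under [cp_incl], and its
    closedness there rests on [iso_complete]. *)
Lemma homog_dense_cp (x : O) (e : R) : 0 < e -> exists2 y, homog (spec gam) y & nrm (x - y) <= e.
Proof.
have hincl := proj1 (cp_inclP O); have iincl := proj2 (cp_inclP O).
have ghom := ga_hom gamP.
pose G : set O := [set b | forall e : R, 0 < e -> exists2 y, homog (spec gam) y & nrm (b - y) <= e].
have Ghomog y : homog (spec gam) y -> G y by move=> hy r /ltW r0; exists y => //; rewrite subrr nrm0.
suff GT : G x by exact: GT.
pose S : set (cp_quot O) := [set y | exists2 b, cp_incl b = y & G b].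
have sub : cstar_gen (range (@cp_q _ _ _ O \o @cp_phi_inf _ _ _ O) `|`
    range (@cp_q _ _ _ O \o @cp_tau_inf _ _ _ O)) `<=` S.
  apply: smallest_sub; last first.
    move=> y [[d _ <-]|[u _ <-]].
      exists (cp_phi O d); first exact: cp_phiE.
      apply/Ghomog/(homog_spec (k := 0)) => z z1.
      by rewrite expr0z scale1r (ga_phi gamP).
    exists (cp_tau O u); first exact: cp_tauE.
    apply/Ghomog/(homog_spec (k := 1)) => z z1.
    by rewrite expr1z (ga_tau gamP).
  split.
  - apply: closed_approx => y hy.
    have h n : exists b, G b /\ nrm (y - cp_incl b) <= n.+1%:R^-1.
      by have [|_ [b <- Gb] yb] := hy n.+1%:R^-1; [rewrite invr_gt0 ltr0n|exists b].
    have [u hu] := choice h.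
    have uy : tendsto (fun n => cp_incl (u n)) y.
      move=> r /inv_archi[N hN]; exists N => n Nn; rewrite nrmBC.
      apply: le_trans (proj2 (hu n)) _; apply: le_trans hN.
      by rewrite lef_pV2 ?posrE ?ltr0n // ler_nat.
    have [b <- ub] := iso_complete hincl iincl uy; exists b => // r r0.
    have r20 : 0 < r / 2 by rewrite divr_gt0.
    have [N hN] := ub _ r20; have [z hz uz] := proj1 (hu N) _ r20; exists z => //.
    have := nrm_dist (u N) b z; have := hN N (leqnn _); rewrite (nrmBC b (u N)); lra.
  - by exists 0; [exact: hom0|apply: Ghomog; exact: homog0].
  - move=> c _ _ [a <- Ga] [b <- Gb]; exists (c *: a + b).
      by rewrite (star_homD hincl) (star_homZ hincl).
    move=> r r0; have r20 : 0 < r / 2 by rewrite divr_gt0.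
    have c1 : 0 < complex.Re `|c| + 1.
      by rewrite ltr_wpDl // -ler0c RRe_real ?realE normr_ge0.
    have [|a' ha' aa'] := Ga (r / 2 / (complex.Re `|c| + 1)); first by rewrite divr_gt0.
    have [b' hb' bb'] := Gb _ r20.
    exists (c *: a' + b'); first exact: homogD (homogZ ghom c ha') hb'.
    have -> : c *: a + b - (c *: a' + b') = c *: (a - a') + (b - b') by ncring.
    have := nrmD (c *: (a - a')) (b - b'); rewrite nrmZ.
    by move: aa'; rewrite ler_pdivlMr // => aa'; have := nrm_ge0 (a - a'); nra.
  - move=> _ _ [a <- Ga] [b <- Gb]; exists (a ** b); first exact: (star_homM hincl).
    move=> r r0; have r20 : 0 < r / 2 by rewrite divr_gt0.
    have b1 : 0 < nrm b + 1 by have := nrm_ge0 b; lra.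
    (* [a'] is chosen first, because the precision required of [b'] depends on its norm. *)
    have [|a' ha' aa'] := Ga (r / 2 / (nrm b + 1)); first by rewrite divr_gt0.
    have a1 : 0 < nrm a' + 1 by have := nrm_ge0 a'; lra.
    have [|b' hb' bb'] := Gb (r / 2 / (nrm a' + 1)); first by rewrite divr_gt0.
    exists (a' ** b'); first exact: (homogM ghom ha' hb').
    have -> : a ** b - a' ** b' = (a - a') ** b + a' ** (b - b') by ncring.
    have := nrmD ((a - a') ** b) (a' ** (b - b')).
    have := nrmM (a - a') b; have := nrmM a' (b - b').
    move: aa' bb'; rewrite !ler_pdivlMr // => aa' bb'.
    have := nrm_ge0 (a - a'); have := nrm_ge0 (b - b'); nra.
  - move=> _ [a <- Ga]; exists (star a); first exact: star_homS.
    move=> r /Ga[a' ha' aa']; exists (star a'); first exact: (homog_star ghom ha').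
    by rewrite -starB nrm_star.
have : range (@cp_incl _ _ _ O) (cp_incl x) by exists x.
by rewrite cp_incl_range => /sub[b /(iso_inj hincl iincl) ->].
Qed.

Lemma spec_frames (k : int) (X_fgp : fgp X) (X_full : full X) :
  exists s : seq O, (forall u, u \in s -> spec gam k u) /\
    \sum_(u <- s) u ** star u = cone.
Proof.
have ghom := ga_hom gamP.
have [T TP] := choice (@cp_tau_inf_adj _ _ _ O).
have [lin [_ _ [n [u hu]] _]] := X_fgp.
have [m [v hv]] := full_frame X_full.
have hR := tau_right_frame TP hu; have hL := tau_left_frame TP hv.
have tau1 x : spec gam 1 (cp_tau O x) by move=> z z1; rewrite expr1z (ga_tau gamP).
have pos k' : exists s : seq O, (forall u, u \in s -> spec gam k'%:Z u) /\
    \sum_(u <- s) u ** star u = cone.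
  elim: k' => [|k' [s [hs sE]]].
    exists [:: cone]; rewrite big_seq1 star1 cmul1l; split=> // a.
    by rewrite inE => /eqP -> z z1; rewrite expr0z scale1r (star_hom1 (ghom _ z1)).
  exists [seq cp_tau O (u i) ** a | i <- index_enum 'I_n, a <- s]; split.
    move=> _ /allpairsP[[i a] /= [_ /hs ha ->]].
    by rewrite -[k'.+1]add1n PoszD; exact: specM.
  rewrite big_allpairs_dep -[RHS]hR; apply: eq_bigr => i _.
  rewrite -[X in _ = X ** _]cmul1r -sE cmul_sumr cmul_suml; apply: eq_bigr => a _.
  by rewrite starM !cmulA.
(* Degree [k'] again, but with [a^* a] summing to 1, so that the adjoints form the frame in degree
   [-k']. The new factor now goes on the right, to leave the old sum in the middle of
   [tau^* (a^* a) tau]. *)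
have neg k' : exists s : seq O, (forall u, u \in s -> spec gam k'%:Z u) /\
    \sum_(u <- s) star u ** u = cone.
  elim: k' => [|k' [s [hs sE]]].
    exists [:: cone]; rewrite big_seq1 star1 cmul1l; split=> // a.
    by rewrite inE => /eqP -> z z1; rewrite expr0z scale1r (star_hom1 (ghom _ z1)).
  exists [seq a ** cp_tau O (v i) | i <- index_enum 'I_m, a <- s]; split.
    move=> _ /allpairsP[[i a] /= [_ /hs ha ->]].
    by rewrite -[k'.+1]addn1 PoszD; exact: specM.
  rewrite big_allpairs_dep -[RHS]hL; apply: eq_bigr => i _.
  rewrite -[X in _ = _ ** X]cmul1l -sE cmul_suml cmul_sumr; apply: eq_bigr => a _.
  by rewrite starM !cmulA.
case: k => k; first exact: pos.
have [s [hs sE]] := neg k.+1; exists (map star s); split.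
  by move=> _ /mapP[a /hs ha ->]; rewrite NegzE; exact: spec_star.
by rewrite big_map -[RHS]sE; apply: eq_bigr => a _; rewrite starK.
Qed.

End CuntzPimsnerGrading.

(** * Strongly graded C*-algebras *)

(* A Z-graded C*-algebra [B] with degree-zero part [A]; the frames say that
   [B_k B_k^*] is all of [B_0] for every [k]. *)
Record strong_grading (R : realType) (B A : cstarType R) := StrongGrading {
  sg_sp :> int -> csub B;
  sg_iota : A -> B;
  sg_E : B -> A;
  sg_mul : forall k l x y, cs_set (sg_sp k) x -> cs_set (sg_sp l) y ->
    cs_set (sg_sp (k + l)) (x ** y);
  sg_star : forall k x, cs_set (sg_sp k) x -> cs_set (sg_sp (- k)) (star x);
  sg_incl : cstar_incl sg_iota;
  sg_cond : faithful_cond_exp sg_iota sg_E;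
  sg_iota_mem : forall a, cs_set (sg_sp 0) (sg_iota a);
  sg_iotaE : forall x, cs_set (sg_sp 0) x -> sg_iota (sg_E x) = x;
  sg_E0 : forall k x, k != 0 -> cs_set (sg_sp k) x -> sg_E x = 0;
  sg_dense : forall x (e : R), 0 < e ->
    exists2 y, homog (fun k => cs_set (sg_sp k)) y & nrm (x - y) <= e;
  sg_frames : forall k, exists s : seq B, (forall u, u \in s -> cs_set (sg_sp k) u) /\
    \sum_(u <- s) u ** star u = cone
}.

Section CsubLemmas.
Context {R : realType} {A : cstarType R} (S : csub A).

Lemma csD x y : cs_set S x -> cs_set S y -> cs_set S (x + y).
Proof. by move=> hx hy; rewrite -[x]scale1r; exact: cs_lin. Qed.

Lemma csZ (c : R[i]) x : cs_set S x -> cs_set S (c *: x).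
Proof. by move=> hx; rewrite -[_ *: _]addr0; apply: cs_lin => //; exact: cs0. Qed.

Lemma cs_sum (J : Type) (s : seq J) (P : pred J) (f : J -> A) :
  (forall j, P j -> cs_set S (f j)) -> cs_set S (\sum_(j <- s | P j) f j).
Proof. by move=> h; elim/big_rec: _ => [|j x Pj hx]; [exact: cs0|exact/csD/hx/h]. Qed.

Lemma cs_gsum (I : choiceType) (f : I -> A) v : has_gsum f v ->
  (forall i, cs_set S (f i)) -> cs_set S v.
Proof.
move=> hv hf; apply: approx_closed (@cs_closed _ _ S) _ => e /hv[s hs].
exists (\sum_(i <- undup s) f i); first exact: cs_sum.
by rewrite nrmBC; apply: hs => [|i]; [exact: undup_uniq|rewrite mem_undup].
Qed.

End CsubLemmas.

(** * Bimodules of families over the degree-zero part *)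

Section Bimodules.
Context {R : realType} {B A : cstarType R} (G : strong_grading B A).
Local Notation iota := (sg_iota G).
Local Notation E := (sg_E G).
Local Notation sp k := (cs_set (sg_sp G k)).

Lemma sg_hom : star_hom iota. Proof. exact: (proj1 (sg_incl G)). Qed.
Lemma sg_iso x : `|iota x| = `|x|. Proof. exact: (proj2 (sg_incl G)). Qed.
Lemma iota_inj : injective iota. Proof. exact: iso_inj sg_hom sg_iso. Qed.
Lemma iotaK a : E (iota a) = a. Proof. exact: (ce_id (sg_cond G)). Qed.

Lemma E_additive x y : E (x + y) = E x + E y. Proof. exact: (ceD (sg_cond G)). Qed.
Lemma E_scale (c : R[i]) x : E (c *: x) = c *: E x.
Proof. exact: (ceZ (sg_cond G)). Qed.
Lemma E_zero : E 0 = 0.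
Proof. by rewrite -(scale0r (0 : B)) E_scale scale0r. Qed.
Lemma E_sub x y : E (x - y) = E x - E y.
Proof. by rewrite E_additive -(scaleN1r y) E_scale scaleN1r. Qed.
Lemma E_sum (J : Type) (s : seq J) (P : pred J) (f : J -> B) :
  E (\sum_(j <- s | P j) f j) = \sum_(j <- s | P j) E (f j).
Proof. exact: (big_morph E E_additive E_zero). Qed.

Lemma E_positive x : pos x -> pos (E x).
Proof. by move=> /posP[b ->]; apply/posP/(ce_pos (sg_cond G)). Qed.

Lemma E_contractive x : nrm (E x) <= nrm x.
Proof. by rewrite -lecR -!normE; exact: (ce_norm (sg_cond G)). Qed.

Lemma spMK k l x y : sp k x -> sp l y -> forall m, k + l = m -> sp m (x ** y).
Proof. by move=> hx hy m <-; exact: sg_mul. Qed.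

Lemma sp_starM k x y : sp k x -> sp k y -> sp 0 (star x ** y).
Proof. by move=> /sg_star hx hy; apply: spMK hx hy _ _; rewrite addNr. Qed.

Lemma sp_Mstar k x y : sp k x -> sp k y -> sp 0 (x ** star y).
Proof. by move=> hx /sg_star hy; apply: spMK hx hy _ _; rewrite addrN. Qed.

Section Module.
Variables (I : choiceType) (deg : I -> int).

(** One construction for three uses: the basis of a graded Hilbert space, a finite set of degrees,
    and all of [int] as index types. *)
Definition fam := l2 (fun i => sg_sp G (deg i)).
Implicit Types x y z : fam.

Lemma famS x i : sp (deg i) (x i). Proof. exact: l2S. Qed.

Lemma ip_sp x y : sp 0 (ip x y).
Proof. by apply: cs_gsum (ipP x y) _ => i; apply: sp_starM (famS x i) (famS y i). Qed.

(** The sum [ip x y] already lies in [B_0], so [E] merely inverts [iota] here. By [iota_inner] most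
    identities of inner products are checked in [B], after applying the injective [iota]. *)
Definition fam_inner x y : A := E (ip x y).

Lemma iota_inner x y : iota (fam_inner x y) = ip x y.
Proof. exact/sg_iotaE/ip_sp. Qed.

Lemma ract_sp x b i : sp (deg i) (x i ** iota b).
Proof. by apply: spMK (famS x i) (sg_iota_mem G b) _ _; rewrite addr0. Qed.

Lemma ract_sumsq x b : sumsq (fun i => x i ** iota b).
Proof.
apply: (sumsq_dom (C := nrm (iota b) ^+ 2)) (l2_sumsq x) => s; exact: gram_Mr.
Qed.

Definition fam_ract x b : fam := mkl2 (ract_sp x b) (ract_sumsq x b).

Lemma lact_sp a x i : sp (deg i) (iota a ** x i).
Proof. by apply: spMK (sg_iota_mem G a) (famS x i) _ _; rewrite add0r. Qed.

Lemma lact_sumsq a x : sumsq (fun i => iota a ** x i).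
Proof.
apply: (sumsq_dom (C := nrm (iota a) ^+ 2)) (l2_sumsq x) => s; exact: gram_Ml.
Qed.

Definition fam_lact a x : fam := mkl2 (lact_sp a x) (lact_sumsq a x).

Lemma fam_ractE x b i : fam_ract x b i = x i ** iota b. Proof. by []. Qed.
Lemma fam_lactE a x i : fam_lact a x i = iota a ** x i. Proof. by []. Qed.

Definition fam_mod : hilbMod A.
Proof.
refine (@HilbMod R A fam fam_ract fam_inner _ _ _ _ _ _ _ _ _ _ _ _).
- by move=> x y b; apply: l2_ext => i; rewrite l2D !fam_ractE l2D cmulDl.
- by move=> x b c; apply: l2_ext => i; rewrite l2D !fam_ractE (star_homD sg_hom) cmulDr.
- by move=> k x b; apply: l2_ext => i; rewrite l2Z !fam_ractE l2Z cmulZl.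
- by move=> k x b; apply: l2_ext => i; rewrite l2Z !fam_ractE (star_homZ sg_hom) cmulZr.
- by move=> x b c; apply: l2_ext => i; rewrite !fam_ractE (star_homM sg_hom) cmulA.
- by move=> x; apply: l2_ext => i; rewrite !fam_ractE (star_hom1 sg_hom) cmul1r.
- by move=> x y z; rewrite /fam_inner ipD E_additive.
- by move=> k x y; rewrite /fam_inner ipZ E_scale.
- move=> x y b; apply: iota_inj; rewrite (star_homM sg_hom) !iota_inner.
  apply: gsumE.
  have := has_gsum_map (h := fun v : B => v ** iota b) (C := nrm (iota b)) _ _ (ipP x y).
  move=> /(_ (fun v w => cmulBl v w (iota b))) h.
  have {h} := h (fun v => eq_ind _ (fun t => _ <= t) (nrmM v (iota b)) _ (mulrC _ _)).
  by congr has_gsum; apply/funext => i; rewrite fam_ractE cmulA.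
- by move=> x y; apply: iota_inj; rewrite (star_homS sg_hom) !iota_inner ip_star.
- by move=> x; apply/posP/(pos_iso sg_hom sg_iso); rewrite iota_inner; exact: ip_pos.
- move=> x; rewrite -sg_iso iota_inner !normE -rmorphXn.
  by congr (_%:C); exact: l2_nrm_sqr.
Defined.

Definition bimod : corr A A.
Proof.
refine (@Corr R A A fam_mod fam_lact _ _ _ _ _).
- by move=> a b x; apply: l2_ext => i; rewrite l2D !fam_lactE (star_homD sg_hom) cmulDl.
- by move=> k a x; apply: l2_ext => i; rewrite l2Z !fam_lactE (star_homZ sg_hom) cmulZl.
- by move=> a b x; apply: l2_ext => i; rewrite !fam_lactE (star_homM sg_hom) cmulA.
- by move=> x; apply: l2_ext => i; rewrite !fam_lactE (star_hom1 sg_hom) cmul1l.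
- move=> a x y; congr (E (gsum _)); apply/funext => i.
  by rewrite !fam_lactE starM (star_homS sg_hom) cmulA.
Defined.

Lemma bimod_innerE (x y : bimod) : inner x y = E (ip x y). Proof. by []. Qed.
Lemma bimod_ractE (x : bimod) b i : (x <* b : fam) i = (x : fam) i ** iota b. Proof. by []. Qed.
Lemma bimod_lactE (x : bimod) a i : (a *> x : fam) i = iota a ** (x : fam) i. Proof. by []. Qed.

(* The test on [u] makes [dl], hence [delta], total: [delta i u] is 0 unless [u] lies in
   the component of degree [deg i]. *)
Definition dl (i : I) (u : B) (j : I) : B := if (j == i) && `[< sp (deg i) u >] then u else 0.

Lemma dl_sp i u j : sp (deg j) (dl i u j).
Proof.
rewrite /dl; case: eqVneq => [->|_] /=; last exact: cs0.
by case: asboolP => // _; exact: cs0.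
Qed.

Lemma dl_sumsq i u : sumsq (dl i u).
Proof. by apply: (sumsq_fin (s := [:: i])) => j; rewrite inE /dl => /negbTE ->. Qed.

Definition delta i u : fam := mkl2 (dl_sp i u) (dl_sumsq i u).

Lemma deltaE i u j : sp (deg i) u -> delta i u j = if j == i then u else 0.
Proof. by move=> /asboolP hu; rewrite /= /dl hu andbT. Qed.

Lemma ip_fin x y s : uniq s -> (forall i, i \notin s -> x i = 0) ->
  ip x y = \sum_(i <- s) star (x i) ** y i.
Proof.
move=> us x0; apply/gsumE/has_gsum_fin => // i /x0 ->.
by rewrite star0 cmul0l.
Qed.

Lemma ip_delta i u y : sp (deg i) u -> ip (delta i u) y = star u ** y i.
Proof.
move=> hu; rewrite (@ip_fin _ _ [:: i]) // ?big_seq1 ?deltaE ?eqxx // => j.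
by rewrite inE deltaE // => /negbTE ->.
Qed.

End Module.

Section FiniteModule.
Variables (I : finType) (deg : I -> int).
Local Notation X := (bimod deg).
Local Notation fam := (fam deg).

Lemma ip_finE (x y : fam) : ip x y = \sum_i star (x i) ** y i.
Proof. by apply: ip_fin => [|i]; rewrite ?index_enum_uniq ?mem_index_enum. Qed.

Lemma fin_sumsq (f : I -> B) : sumsq f.
Proof. by apply: (sumsq_fin (s := index_enum I)) => i; rewrite mem_index_enum. Qed.

Definition mkfin (f : I -> B) (h : forall i, sp (deg i) (f i)) : fam := mkl2 h (fin_sumsq f).

Definition fam_lin (x y : X) : A := E (\sum_i (x : fam) i ** star ((y : fam) i)).

Lemma iota_lin x y : iota (fam_lin x y) = \sum_i (x : fam) i ** star ((y : fam) i).
Proof. by apply/sg_iotaE/cs_sum => i _; exact: sp_Mstar (famS x i) (famS y i). Qed.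

Lemma fam_lin_le (x : X) i : nrm ((x : fam) i) ^+ 2 <= nrm (fam_lin x x).
Proof.
rewrite -(nrm_iso sg_iso) iota_lin -nrm_Mstar; apply: nrm_pos_mono.
  exact: pos_Mstar.
rewrite (bigD1 i) //= addrAC subrr add0r; apply: pos_sum => j _; exact: pos_Mstar.
Qed.

Lemma fam_left_corr : left_corr fam_lin.
Proof.
split=> [x y z|k x y|a x y|x y|x|x x0|x y b].
- by rewrite -E_additive -big_split; congr E; apply: eq_bigr => i _; rewrite l2D cmulDl.
- by rewrite -E_scale scaler_sumr; congr E; apply: eq_bigr => i _; rewrite l2Z cmulZl.
- apply: iota_inj; rewrite (star_homM sg_hom) !iota_lin cmul_sumr.
  by apply: eq_bigr => i _; rewrite bimod_lactE cmulA.
- apply: iota_inj; rewrite (star_homS sg_hom) !iota_lin star_sum.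
  by apply: eq_bigr => i _; rewrite starM starK.
- apply/posP/(pos_iso sg_hom sg_iso); rewrite iota_lin.
  by apply: pos_sum => i _; exact: pos_Mstar.
- apply: l2_ext => i; apply: nrm0_eq0; apply/eqP; rewrite -sqrf_eq0 eq_le sqr_ge0 andbT.
  by apply: le_trans (fam_lin_le x i) _; rewrite x0 nrm0.
- apply: iota_inj; rewrite !iota_lin; apply: eq_bigr => i _.
  by rewrite !bimod_ractE starM (star_homS sg_hom) starK cmulA.
Qed.

(** Each entry is bounded by either norm, so the squares differ at most by the number of entries;
    the successor keeps the constant positive for empty [I]. *)
Lemma fam_norms (x : X) :
  nrm x ^+ 2 <= #|I|.+1%:R * nrm (fam_lin x x) /\
  nrm (fam_lin x x) <= #|I|.+1%:R * nrm x ^+ 2.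
Proof.
have cardle (f : I -> R) (M : R) : 0 <= M -> (forall i, f i <= M) ->
    \sum_i f i <= #|I|.+1%:R * M.
  move=> M0 fM; apply: le_trans (ler_sum _ (fun i _ => fM i)) _.
  by rewrite sumr_const -[leLHS]mulr_natl ler_wpM2r // ler_nat leqnSn.
split.
  rewrite (l2_nrm_sqr (x : fam)) ip_finE; apply: le_trans (nrm_sum _ _ _) _.
  by apply: cardle (nrm_ge0 _) _ => i; rewrite nrm_starM; exact: fam_lin_le.
rewrite -(nrm_iso sg_iso) iota_lin; apply: le_trans (nrm_sum _ _ _) _.
apply: cardle; first exact: sqr_ge0.
by move=> i; rewrite nrm_Mstar (l2_nrm_sqr (x : fam)); exact: l2_coord_le.
Qed.

(** Frames are lists, while [fgp] asks for families over ordinals. *)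
Lemma seq_family (V : zmodType) (L : seq V) (f : V -> V -> V) :
  (forall x, x = \sum_(u <- L) f u x) ->
  exists (n : nat) (u : 'I_n -> V), forall x, x = \sum_(i < n) f (u i) x.
Proof.
move=> h; exists (size L), (tnth (in_tuple L)) => x.
by rewrite {1}(h x) big_tnth.
Qed.

(** The right basis places the frame of degree [deg i] at each index [i]. For the left basis one
    needs [v] of degree [deg i] with [v^* v] summing to 1: these are the adjoints of the frame of
    degree [- deg i]. *)
Lemma bimod_fgp : fgp X.
Proof.
have [s hs] := choice (sg_frames G).
exists fam_lin; split.
- exact: fam_left_corr.
- pose c := Num.sqrt (#|I|.+1%:R : R).
  have c0 : 0 < c by rewrite sqrtr_gt0 ltr0n.
  have c2 : c ^+ 2 = #|I|.+1%:R by rewrite sqr_sqrtr.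
  exists c^-1%:C, c%:C; split; rewrite ?ltcR ?invr_gt0 // => x.
  have -> : sqrtC `|fam_lin x x| = (Num.sqrt (nrm (fam_lin x x)))%:C.
    rewrite normE -{1}(sqr_sqrtr (nrm_ge0 (fam_lin x x))) rmorphXn sqrCK //.
    by rewrite ler0c sqrtr_ge0.
  rewrite normE -!rmorphM !lecR; have [] := fam_norms x.
  move: (nrm_ge0 x) (nrm_ge0 (fam_lin x x)).
  move: (nrm x) (nrm (fam_lin x x)) => a l a0 l0 h1 h2.
  have sl0 := sqrtr_ge0 l; rewrite ler_pdivrMl //.
  rewrite -ler_sqr ?nnegrE ?mulr_ge0 ?(ltW c0) // -(@ler_sqr _ (Num.sqrt l)) ?nnegrE
    ?mulr_ge0 ?(ltW c0) //.
  by rewrite !exprMn c2 sqr_sqrtr // h1 h2.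
- apply: (@seq_family X [seq delta deg i u | i <- index_enum I, u <- s (deg i)]
    (fun u x => u <* inner u x)) => x.
  apply: l2_ext => j; rewrite l2_sum big_allpairs_dep /=.
  have frame i : \sum_(u <- s (deg i)) ((delta deg i u : X) <* inner (delta deg i u : X) x : fam) j
      = if j == i then x i else 0 :> B.
    have [hsi sE] := hs (deg i).
    transitivity (\sum_(u <- s (deg i)) (if j == i then u ** star u ** (x : fam) i else 0)).
      apply: eq_big_seq => u /hsi hu; rewrite bimod_ractE iota_inner ip_delta // deltaE //.
      by case: ifP => _; rewrite ?cmulA ?cmul0l.
    by case: (j == i); [rewrite -cmul_suml sE cmul1l|rewrite big1].
  by rewrite (eq_bigr _ (fun i _ => frame i)) -big_mkcond (big_pred1 j) // => i; exact: eq_sym.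
- apply: (@seq_family X [seq delta deg i (star u) | i <- index_enum I, u <- s (- deg i)]
    (fun u x => fam_lin x u *> u)) => x.
  apply: l2_ext => j; rewrite l2_sum big_allpairs_dep /=.
  have frame i : \sum_(u <- s (- deg i)) (fam_lin x (delta deg i (star u)) *> (delta deg i (star u) : X) : fam) j
      = if j == i then x i else 0 :> B.
    have [hsi sE] := hs (- deg i).
    transitivity (\sum_(u <- s (- deg i)) (if j == i then (x : fam) i ** (u ** star u) else 0)).
      apply: eq_big_seq => u /hsi /sg_star; rewrite opprK => hu.
      rewrite bimod_lactE iota_lin.
      rewrite (eq_bigr (fun l => if l == i then (x : fam) l ** u else 0)) => [|l _].
        rewrite -big_mkcond big_pred1_eq deltaE //.
        by case: ifP => _; rewrite ?cmulA ?cmul0r.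
      by rewrite deltaE //; case: ifP => _; rewrite ?starK // star0 cmul0r.
    by case: (j == i); [rewrite -cmul_sumr sE cmul1r|rewrite big1].
  by rewrite (eq_bigr _ (fun i _ => frame i)) -big_mkcond (big_pred1 j) // => i; exact: eq_sym.
Qed.

End FiniteModule.
End Bimodules.

Lemma lin_span_sum (R : realType) (V : lmodType R[i]) (S : set V) (J : eqType)
    (s : seq J) (f : J -> V) :
  (forall j, j \in s -> S (f j)) -> lin_span S (\sum_(j <- s) f j).
Proof.
move=> h; exists (size s), (fun=> 1), (fun i => f (tnth (in_tuple s) i)).
split=> [i|]; first exact/h/mem_tnth.
by rewrite big_tnth; apply: eq_bigr => i _; rewrite scale1r.
Qed.

(** * The tensor functor on graded Hilbert spaces *)

Section GradedMatrices.
Context {R : realType}.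

Lemma gmatrixE (V W : ghilb) (f : gidx W -> gidx V -> R[i]) w v :
  gmatrix f w v = if gdeg w == gdeg v then f w v else 0.
Proof. by []. Qed.

(** The degree filter of [gmatrix] discards nothing: between different degrees each summand has a
    vanishing factor. *)
Lemma gcompE (U V W : ghilb) (g : ghom (R := R) V W) (f : ghom U V) w u :
  gcomp g f w u = \sum_v g w v * f v u.
Proof.
rewrite gmatrixE; case: eqVneq => // wu; apply/esym/big1 => v _.
have [wv|/eqP wv] := eqVneq (gdeg w) (gdeg v); last by rewrite gmx_deg // mul0r.
by rewrite [f v u]gmx_deg ?mulr0 // -wv; exact/eqP.
Qed.

Lemma gaxpyE (V W : ghilb) (c : R[i]) (f g : ghom (R := R) V W) w v :
  gaxpy c f g w v = c * f w v + g w v.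
Proof.
by rewrite gmatrixE; case: eqP => // wv; rewrite !gmx_deg // mulr0 addr0.
Qed.

Lemma gdagE (V W : ghilb) (f : ghom (R := R) V W) w v : gdag f v w = (f w v)^*%C.
Proof.
by rewrite gmatrixE; case: eqP => // wv; rewrite gmx_deg ?conjc0 // => /esym.
Qed.

Lemma gtensmE (V V' W W' : ghilb) (f : ghom (R := R) V V') (g : ghom (R := R) W W') y x :
  gtensm f g y x = f y.1 x.1 * g y.2 x.2.
Proof.
rewrite gmatrixE; case: eqP => // yx /=; apply/esym.
have [h1|/eqP h1] := eqVneq (gdeg y.1) (gdeg x.1); last by rewrite gmx_deg // mul0r.
by rewrite [g _ _]gmx_deg ?mulr0 // => h2; apply: yx; rewrite /= h1 h2.
Qed.

End GradedMatrices.

Section Action.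
Context {R : realType} {B A : cstarType R} (G : strong_grading B A).
Local Notation iota := (sg_iota G).
Local Notation E := (sg_E G).
Local Notation sp k := (cs_set (sg_sp G k)).

Definition gF (V : ghilb) : corr A A := bimod G (fun v : gidx V => gdeg v).
Definition gfam (V : ghilb) := fam G (fun v : gidx V => gdeg v).

Lemma gmap_sp V W (f : ghom (R := R) V W) (x : gF V) w :
  sp (gdeg w) (\sum_v f w v *: (x : gfam V) v).
Proof.
apply: cs_sum => v _; have [->|/eqP wv] := eqVneq (gdeg w) (gdeg v).
  exact/csZ/famS.
by rewrite gmx_deg // scale0r; exact: cs0.
Qed.

Definition gmap V W (f : ghom (R := R) V W) (x : gF V) : gF W := mkfin (gmap_sp f x).

Lemma gmapE V W (f : ghom (R := R) V W) (x : gF V) w :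
  (gmap f x : gfam W) w = \sum_v f w v *: (x : gfam V) v.
Proof. by []. Qed.

Lemma gF_ext V (x y : gF V) : (forall v, (x : gfam V) v = (y : gfam V) v) -> x = y.
Proof. exact: l2_ext. Qed.

Lemma gF_inner V (x y : gF V) :
  iota (inner x y) = \sum_v star ((x : gfam V) v) ** (y : gfam V) v.
Proof. by rewrite bimod_innerE -/(fam_inner _ _) iota_inner ip_finE. Qed.

Lemma gmap_dag V W (f : ghom (R := R) V W) : adjoint_pair (gmap f) (gmap (gdag f)).
Proof.
move=> x y; apply: (iota_inj (G := G)); rewrite !gF_inner.
transitivity (\sum_w \sum_v (f w v)^*%C *:
    (star ((x : gfam V) v) ** (y : gfam W) w)).
  apply: eq_bigr => w _; rewrite gmapE star_sum cmul_suml; apply: eq_bigr => v _.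
  by rewrite starZ cmulZl.
rewrite exchange_big; apply: eq_bigr => v _; rewrite gmapE cmul_sumr.
by apply: eq_bigr => w _; rewrite gdagE cmulZr.
Qed.

Lemma gmap_bimod V W (f : ghom (R := R) V W) : bimod_map (gmap f).
Proof.
split=> [x y|c x|a x|x b|].
- apply: gF_ext => w; rewrite l2D !gmapE -big_split; apply: eq_bigr => v _.
  by rewrite l2D scalerDr.
- apply: gF_ext => w; rewrite l2Z !gmapE scaler_sumr; apply: eq_bigr => v _.
  by rewrite l2Z !scalerA mulrC.
- apply: gF_ext => w; rewrite bimod_lactE !gmapE cmul_sumr; apply: eq_bigr => v _.
  by rewrite bimod_lactE cmulZr.
- apply: gF_ext => w; rewrite bimod_ractE !gmapE cmul_suml; apply: eq_bigr => v _.
  by rewrite bimod_ractE cmulZl.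
- by exists (gmap (gdag f)); exact: gmap_dag.
Qed.

Lemma gtens_sp V W (x : gF V) (y : gF W) (p : gidx (gtens V W)) :
  sp (gdeg p) ((x : gfam V) p.1 ** (y : gfam W) p.2).
Proof. by apply: sg_mul; exact: famS. Qed.

(** The elementary tensors inside [F(V (x) W)]. Taking this space as the relative tensor product
    turns the tensorator into the identity and the associator into a relabelling of indices. *)
Definition gt V W (x : gF V) (y : gF W) : gF (gtens V W) := mkfin (gtens_sp x y).

Lemma gtE V W (x : gF V) (y : gF W) p :
  (gt x y : gfam (gtens V W)) p = (x : gfam V) p.1 ** (y : gfam W) p.2.
Proof. by []. Qed.

Lemma gt_total V W (z : gF (gtens V W)) :
  lin_span [set z | exists (x : gF V) (y : gF W), z = gt x y] z.
Proof.
have [s hs] := choice (sg_frames G).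
pose L := [seq (p, u) | p <- index_enum (gidx V * gidx W)%type, u <- s (gdeg p.1)].
pose dx (q : gidx V * gidx W * B) : gF V := delta G (fun v : gidx V => gdeg v) q.1.1 q.2.
pose dy (q : gidx V * gidx W * B) : gF W :=
  delta G (fun w : gidx W => gdeg w) q.1.2 (star q.2 ** (z : gfam (gtens V W)) q.1).
have -> : z = \sum_(q <- L) gt (dx q) (dy q).
  apply: gF_ext => p; rewrite l2_sum big_allpairs_dep /=.
  have frame p' : \sum_(u <- s (gdeg p'.1)) (gt (dx (p', u)) (dy (p', u)) : gfam _) p
      = if p == p' then (z : gfam (gtens V W)) p' else 0 :> B.
    have [hsi sE] := hs (gdeg p'.1).
    transitivity (\sum_(u <- s (gdeg p'.1))
        (if p == p' then u ** star u ** (z : gfam (gtens V W)) p' else 0)).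
      apply: eq_big_seq => u /hsi hu; rewrite gtE deltaE // deltaE /=; last first.
        apply: spMK (sg_star hu) (famS (z : gfam (gtens V W)) p') _ _.
        by rewrite /= addrA addNr add0r.
      case: p p' {hsi sE hu} => [v w] [v' w'] /=; rewrite xpair_eqE.
      by do 2 case: eqP => _ /=; rewrite ?cmul0l ?cmul0r ?cmulA.
    by case: (p == p'); [rewrite -cmul_suml sE cmul1l|rewrite big1].
  rewrite (eq_bigr _ (fun p' _ => frame p')) -big_mkcond (big_pred1 p).
    by [].
    by move=> p'; exact: eq_sym.
by apply: (@lin_span_sum R (gF (gtens V W))) => q _; exists (dx q), (dy q).
Qed.

Lemma gt_rel_tensor V W : rel_tensor (@gt V W).
Proof.
split=> [x x' y|x y y'|c x y|c x y|x b y|a x y|x y c|x x' y y'|].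
- by apply: gF_ext => p; rewrite l2D !gtE l2D cmulDl.
- by apply: gF_ext => p; rewrite l2D !gtE l2D cmulDr.
- by apply: gF_ext => p; rewrite l2Z !gtE l2Z cmulZl.
- by apply: gF_ext => p; rewrite l2Z !gtE l2Z cmulZr.
- by apply: gF_ext => p; rewrite !gtE bimod_ractE bimod_lactE cmulA.
- by apply: gF_ext => p; rewrite bimod_lactE !gtE bimod_lactE cmulA.
- by apply: gF_ext => p; rewrite bimod_ractE !gtE bimod_ractE cmulA.
- apply: (iota_inj (G := G)); rewrite !gF_inner.
  rewrite -(pair_bigA _ (fun v w => star ((gt x y : gfam _) (v, w)) **
    (gt x' y' : gfam _) (v, w))) exchange_big.
  apply: eq_bigr => w _; rewrite bimod_lactE gF_inner cmul_suml cmul_sumr.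
  by apply: eq_bigr => v _; rewrite !gtE starM !cmulA.
- apply/dense_approx => z e e0; exists z; first exact: gt_total.
  by rewrite subrr nrm0 ltW.
Qed.

Lemma id_unitary V : unitary_bimod_map (@id (gF V)).
Proof.
by split; [split=> //; exists id|exists id].
Qed.

Lemma gunit_sp (a : A) (t : gidx (gline 0)) : sp (gdeg t) (iota a).
Proof. exact: sg_iota_mem. Qed.

Definition gunit (a : idcorr A) : gF (gline 0) := mkfin (gunit_sp a).

Lemma gunitE (a : idcorr A) t : (gunit a : gfam _) t = iota a. Proof. by []. Qed.

Lemma big_unit (V : zmodType) (f : unit -> V) : \sum_t f t = f tt.
Proof. by rewrite (big_pred1 tt) // => -[]. Qed.

Lemma gunit_unitary : unitary_bimod_map gunit.
Proof.
pose V0 (x : gF (gline 0)) : idcorr A := E ((x : gfam _) tt).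
have iV x : iota (V0 x) = (x : gfam _) tt.
  by apply: sg_iotaE; exact: (famS (x : gfam (gline 0)) tt).
have adj : adjoint_pair gunit V0.
  move=> a x; apply: (iota_inj (G := G)); rewrite gF_inner big_unit gunitE.
  by rewrite /= (star_homM (sg_hom G)) (star_homS (sg_hom G)) iV.
split; last first.
  exists V0; split=> // x; first exact: iotaK.
  by apply: gF_ext => -[]; rewrite gunitE iV.
split=> [x y|c x|a x|x b|]; last by exists V0.
- by apply: gF_ext => t; rewrite l2D !gunitE (star_homD (sg_hom G)).
- by apply: gF_ext => t; rewrite l2Z !gunitE (star_homZ (sg_hom G)).
- by apply: gF_ext => t; rewrite bimod_lactE !gunitE (star_homM (sg_hom G)).
- by apply: gF_ext => t; rewrite bimod_ractE !gunitE (star_homM (sg_hom G)).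
Qed.

Lemma gmap_permutation V W (f : ghom (R := R) V W) (h : gidx W -> gidx V) (x : gF V) w :
  (forall v, f w v = (v == h w)%:R) -> (gmap f x : gfam W) w = (x : gfam V) (h w).
Proof.
move=> fE; rewrite gmapE (bigD1 (h w)) //= fE eqxx scale1r big1 ?addr0 // => v vh.
by rewrite fE (negbTE vh) scale0r.
Qed.

Definition action : Zaction A.
Proof.
refine (@ZAction R A gF (fun V => bimod_fgp G _) gmap gmap_bimod _ _ _ gmap_dag
  (fun V W => gF (gtens V W)) gt gt_rel_tensor (fun V W => id)
  (fun V W => id_unitary _) _ gunit gunit_unitary _ _ _).
- move=> V x; apply: gF_ext => v; apply: (gmap_permutation (h := id)) => v'.
  by rewrite gmatrixE eq_sym; case: (eqVneq v' v) => [->|]; rewrite ?eqxx // if_same.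
- move=> U V W g f x; apply: gF_ext => w; rewrite !gmapE.
  transitivity (\sum_u \sum_v (g w v * f v u) *: (x : gfam U) u).
    by apply: eq_bigr => u _; rewrite gcompE scaler_suml.
  rewrite exchange_big; apply: eq_bigr => v _; rewrite gmapE scaler_sumr.
  by apply: eq_bigr => u _; rewrite scalerA.
- move=> V W c f g x; apply: gF_ext => w; rewrite l2D l2Z !gmapE scaler_sumr -big_split.
  by apply: eq_bigr => v _; rewrite gaxpyE scalerDl scalerA.
- move=> V V' W W' f g x y; apply: gF_ext => p; rewrite gtE !gmapE.
  rewrite -(pair_bigA _ (fun v w => gtensm f g p (v, w) *:
    (gt x y : gfam (gtens V W)) (v, w))) cmul_suml; apply: eq_bigr => v _.
  rewrite cmul_sumr; apply: eq_bigr => w _.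
  by rewrite gtensmE gtE cmulZl cmulZr scalerA.
- move=> U V W x y z; apply: gF_ext => p.
  rewrite (gmap_permutation (W := gtens U (gtens V W)) (V := gtens (gtens U V) W)
    (h := fun p : gidx U * (gidx V * gidx W) => ((p.1, p.2.1), p.2.2))) => [|q].
    by rewrite !gtE cmulA.
  rewrite gmatrixE; case: p q => [u [v w]] [[u' v'] w'].
  have -> : ((u', v', w') == (u, v, w)) = ((u, (v, w)) == (u', (v', w'))).
    by rewrite !xpair_eqE andbA (eq_sym u') (eq_sym v') (eq_sym w').
  case: ((u, (v, w)) =P (u', (v', w'))) => [[-> -> ->]|_]; last by rewrite if_same.
  by rewrite /= addrA eqxx.
- move=> V a x; apply: gF_ext => v.
  rewrite (gmap_permutation (V := gtens (gline 0) V) (h := fun v : gidx V => (tt, v))) => [|[[] v']].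
    by rewrite gtE gunitE bimod_lactE.
  rewrite gmatrixE /= xpair_eqE /= add0r (eq_sym v').
  by case: (eqVneq v v') => [->|]; rewrite ?eqxx // if_same.
- move=> V x a; apply: gF_ext => v.
  rewrite (gmap_permutation (V := gtens V (gline 0)) (h := fun v : gidx V => (v, tt))) => [|[v' []]].
    by rewrite gtE gunitE bimod_ractE.
  rewrite gmatrixE /= xpair_eqE /= addr0 andbT (eq_sym v').
  by case: (eqVneq v v') => [->|]; rewrite ?eqxx // if_same.
Defined.

End Action.

(** * The crossed product *)

Section CrossedProduct.
Context {R : realType} {B A : cstarType R} (G : strong_grading B A).
Local Notation iota := (sg_iota G).
Local Notation E := (sg_E G).
Local Notation sp k := (cs_set (sg_sp G k)).
Local Notation F := (action G).
Local Notation H := (bimod G (@id int)).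
Local Notation hfam := (fam G (@id int)).
Local Notation sphomog := (homog (fun k => sp k)).

(** A family over a one-point set is its entry: [at1] and [line] identify [F(C_k)] with [B_k]. *)
Definition at1 k (x : F (gline k)) : B := (x : gfam G (gline k)) tt.

Lemma at1_sp k (x : F (gline k)) : sp k (at1 x).
Proof. exact: (famS (x : gfam G (gline k)) tt). Qed.

Lemma line_sp k (u : B) (hu : sp k u) (t : gidx (gline k)) : sp (gdeg t) u.
Proof. exact: hu. Qed.

Definition line k (u : B) (hu : sp k u) : F (gline k) := mkfin (line_sp hu).

Lemma at1_line k u (hu : sp k u) : at1 (line hu) = u. Proof. by []. Qed.

Lemma line_ext k (x y : F (gline k)) : at1 x = at1 y -> x = y.
Proof. by move=> h; apply: gF_ext => -[]. Qed.

Lemma at1_zmul k l (x : F (gline k)) (y : F (gline l)) m : m = k + l ->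
  at1 (zmul m x y) = at1 x ** at1 y.
Proof.
move=> mE; rewrite /at1 /zmul /= -(pair_bigA _ (fun a b => gcan k l m tt (a, b) *:
  (gt x y : gfam G (gtens (gline k) (gline l))) (a, b))) !big_unit gmatrixE /=.
by rewrite mE eqxx scale1r.
Qed.

Lemma at1_zF0 a : at1 (zF0 F a) = iota a. Proof. by []. Qed.

Lemma at1_inner k (x y : F (gline k)) : iota (inner x y) = star (at1 x) ** at1 y.
Proof. by rewrite (gF_inner (x : gF G (gline k))) big_unit. Qed.

Definition cr_emb k (x : F (gline k)) : H := delta G (@id int) k (at1 x).

Lemma cr_embE k (x : F (gline k)) j : (cr_emb x : hfam) j = if j == k then at1 x else 0.
Proof. exact/deltaE/at1_sp. Qed.

Lemma H_ext (x y : H) : (forall j, (x : hfam) j = (y : hfam) j) -> x = y.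
Proof. exact: l2_ext. Qed.

Lemma H_inner (x y : H) : iota (inner x y) = ip (x : hfam) (y : hfam).
Proof. exact: iota_inner. Qed.

Lemma H_nrm2 (x : H) : nrm x ^+ 2 = nrm (ip (x : hfam) (x : hfam)).
Proof. exact: l2_nrm_sqr. Qed.

Lemma cr_emb_inner k (x : F (gline k)) (h : H) :
  iota (inner (cr_emb x) h) = star (at1 x) ** (h : hfam) k.
Proof. by rewrite H_inner ip_delta //; exact: at1_sp. Qed.

Lemma coord_sp (h : H) j : sp j ((h : hfam) j). Proof. exact: famS. Qed.

Lemma truncation (h : H) (e : R) : 0 < e -> exists2 s : seq int, uniq s &
  nrm (h - \sum_(k <- s) cr_emb (line (coord_sp h k))) <= e.
Proof.
move=> e0; have e20 : 0 < e ^+ 2 by rewrite exprn_gt0.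
have [s us hs] := l2_sumsq (h : hfam) e20; exists s => //.
set t := \sum_(k <- s) _.
have tE j : (t : hfam) j = if j \in s then (h : hfam) j else 0.
  rewrite /t l2_sum (eq_bigr (fun k => if k == j then (h : hfam) j else 0)) => [|k _].
    case: ifP => js; last first.
      by rewrite big1_seq // => k /andP[_ ks]; case: eqP => // kj; rewrite -kj ks in js.
    by rewrite (bigD1_seq j) //= eqxx big1 ?addr0 // => k /negbTE ->.
  by rewrite cr_embE eq_sym; case: eqP => // ->.
apply: l2_nrm_le_gram => [|r ur]; first exact: ltW.
have -> : gram r (h - t : hfam) (h - t : hfam) =
    gram [seq i <- r | i \notin s] (h : hfam) (h : hfam).
  rewrite /gram big_filter [RHS]big_mkcond; apply: eq_bigr => i _.
  rewrite l2D l2N tE; case: ifP => /= _; first by rewrite subrr cmul0r.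
  by rewrite subr0.
apply: hs; first exact: filter_uniq.
by move=> i; rewrite mem_filter => /andP[].
Qed.

Lemma cr_modP : hilbert_sum cr_emb.
Proof.
split=> [k x y|k c x|k x b|k x y|k l x y kl|].
- by apply: H_ext => j; rewrite l2D !cr_embE; case: ifP => _ //; rewrite addr0.
- by apply: H_ext => j; rewrite l2Z !cr_embE; case: ifP => _ //; rewrite scaler0.
- apply: H_ext => j; rewrite bimod_ractE !cr_embE; case: ifP => _; last by rewrite cmul0l.
  by rewrite /at1 bimod_ractE.
- by apply: (iota_inj (G := G)); rewrite cr_emb_inner cr_embE eqxx at1_inner.
- apply: (iota_inj (G := G)); rewrite cr_emb_inner cr_embE (hom0 (sg_hom G)).
  by case: eqP => // _; rewrite cmul0r.
- apply/dense_approx => h e e0; have [s us hs] := truncation h e0.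
  exists (\sum_(k <- s) cr_emb (line (coord_sp h k))) => //.
  by apply: lin_span_sum => k _; exists k => //; exists (line (coord_sp h k)).
Qed.

Section LeftMultiplication.
Variables (k : int) (x : F (gline k)).

Lemma lmul_sp (h : H) l : sp l (at1 x ** (h : hfam) (l - k)).
Proof. by apply: spMK (at1_sp x) (coord_sp h _) _ _; rewrite addrC subrK. Qed.

Lemma gram_shift (f : int -> B) s :
  gram s (fun l => f (l - k)) (fun l => f (l - k)) = gram [seq l - k | l <- s] f f.
Proof. by rewrite /gram big_map. Qed.

Lemma lmul_gram (h : H) s :
  nrm (gram s (fun l => at1 x ** (h : hfam) (l - k)) (fun l => at1 x ** (h : hfam) (l - k)))
  <= nrm (at1 x) ^+ 2 * nrm (gram [seq l - k | l <- s] (h : hfam) (h : hfam)).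
Proof. by rewrite -gram_shift; exact: (gram_Ml s (at1 x) (fun l => (h : hfam) (l - k))). Qed.

Lemma lmul_sumsq (h : H) : sumsq (fun l => at1 x ** (h : hfam) (l - k)).
Proof.
apply: (sumsq_dom (C := nrm (at1 x) ^+ 2) (x := fun l => (h : hfam) (l - k))) => [s|].
  exact: (gram_Ml s (at1 x) (fun l => (h : hfam) (l - k))).
move=> e /(l2_sumsq (h : hfam))[s us hs]; exists [seq l + k | l <- s].
  by rewrite map_inj_uniq //; exact: addIr.
move=> t ut ts; rewrite gram_shift; apply: hs.
  by rewrite map_inj_uniq //; exact: addIr.
move=> _ /mapP[l lt ->]; apply: contra (ts l lt) => ls.
by apply/mapP; exists (l - k) => //; rewrite subrK.
Qed.

Definition cr_lmul (h : H) : H := mkl2 (lmul_sp h : forall l, cs_set (sg_sp G (id l)) _)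
  (lmul_sumsq h).

Lemma cr_lmulE (h : H) l : (cr_lmul h : hfam) l = at1 x ** (h : hfam) (l - k).
Proof. by []. Qed.

Lemma cr_lmulD (g h : H) : cr_lmul (g + h) = cr_lmul g + cr_lmul h.
Proof. by apply: H_ext => l; rewrite l2D !cr_lmulE l2D cmulDr. Qed.

Lemma cr_lmul0 : cr_lmul 0 = 0.
Proof. by apply: H_ext => l; rewrite cr_lmulE cmul0r. Qed.

Lemma cr_lmul_nrm (h : H) : nrm (cr_lmul h) <= nrm (at1 x) * nrm h.
Proof.
apply: l2_nrm_le_gram => [|s us]; first by rewrite mulr_ge0 ?nrm_ge0.
apply: le_trans (lmul_gram h s) _; rewrite exprMn H_nrm2.
rewrite ler_wpM2l ?sqr_ge0 //; apply: gram_le_ip.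
by rewrite map_inj_uniq //; exact: addIr.
Qed.

Lemma cr_lmul_emb l (y : F (gline l)) : cr_lmul (cr_emb y) = cr_emb (zmul (k + l) x y).
Proof.
apply: H_ext => j; rewrite cr_lmulE !cr_embE at1_zmul // subr_eq addrC.
by case: ifP => _; rewrite ?cmul0r.
Qed.

End LeftMultiplication.

(** The adjoint is left multiplication by [(at1 x)^*], of degree [-k]; the substitution [l = m + k]
    matches the two inner products. *)
Lemma cr_lmul_adj k (x : F (gline k)) : adjointable (cr_lmul x).
Proof.
exists (cr_lmul (line (sg_star (at1_sp x)))) => g h.
apply: (iota_inj (G := G)); rewrite !H_inner.
have := has_gsum_reindex (h := fun m => m + k) (h' := fun l => l - k) _ _
  (ipP (cr_lmul x g : hfam) (h : hfam)).
move=> /(_ (addrK k) (subrK k)) hs; apply/esym/gsumE.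
move: hs; congr has_gsum; apply/funext => m.
by rewrite !cr_lmulE at1_line addrK opprK starM !cmulA.
Qed.

(* [finrep h b]: the vector [h] has finitely many components, and they add up to [b]. *)
Inductive finrep : H -> B -> Prop :=
  | finrep0 : finrep 0 0
  | finrepS k (x : F (gline k)) h b : finrep h b -> finrep (cr_emb x + h) (at1 x + b).

Lemma finrepD g b h c : finrep g b -> finrep h c -> finrep (g + h) (b + c).
Proof.
move=> hg hh; elim: hg => [|k x g' b' _ IH]; first by rewrite !add0r.
by rewrite -!addrA; exact: finrepS.
Qed.

Lemma finrep_sum (J : Type) (s : seq J) (g : J -> H) (b : J -> B) :
  (forall j, finrep (g j) (b j)) -> finrep (\sum_(j <- s) g j) (\sum_(j <- s) b j).
Proof.
move=> h; elim: s => [|j s IH]; rewrite ?big_nil ?big_cons; first exact: finrep0.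
exact: finrepD.
Qed.

Lemma finrep_emb k (x : F (gline k)) : finrep (cr_emb x) (at1 x).
Proof. by rewrite -[cr_emb x]addr0 -[at1 x]addr0; apply: finrepS; exact: finrep0. Qed.

Lemma finrep_lmul k (x : F (gline k)) h b : finrep h b -> finrep (cr_lmul x h) (at1 x ** b).
Proof.
elim=> [|l y g c _ IH]; first by rewrite cr_lmul0 cmul0r; exact: finrep0.
rewrite cr_lmulD cmulDr cr_lmul_emb -(at1_zmul x y erefl); exact: finrepS.
Qed.

Lemma homog_finrep b : sphomog b -> exists h, finrep h b.
Proof.
elim=> [|k x y hx _ [h hh]]; first by exists 0; exact: finrep0.
by exists (cr_emb (line hx) + h); exact: finrepS (line hx) _ _ hh.
Qed.

Lemma finrep_coord h b k (y : B) : sp k y -> finrep h b ->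
  E (star y ** b) = E (star y ** (h : hfam) k).
Proof.
move=> hy; elim=> [|l x g c _ IH]; first by rewrite !cmul0r.
rewrite l2D cr_embE !cmulDr !E_additive IH; congr (_ + _).
have [//|kl] := eqVneq k l; rewrite cmul0r E_zero.
apply: (sg_E0 (k := l - k)); first by rewrite subr_eq0 eq_sym.
by apply: spMK (sg_star hy) (at1_sp x) _ _; rewrite addrC.
Qed.

(** Since [E] kills products of components of different degrees, the finitely supported vectors form
    a copy of the homogeneous sums with inner product [E (b^* c)]. *)
Lemma finrep_inner g b h c : finrep g b -> finrep h c -> inner g h = E (star b ** c).
Proof.
move=> hg hh; elim: hg => [|k x g' b' _ IH].
  by rewrite inner0l star0 cmul0l E_zero.
rewrite innerDl IH starD cmulDl E_additive (finrep_coord (at1_sp x) hh).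
congr (_ + _); rewrite -cr_emb_inner iotaK //.
Qed.

Lemma finrep_dense (h : H) (e : R) : 0 < e -> exists g b, finrep g b /\ nrm (h - g) <= e.
Proof.
move=> /(truncation h)[s _ hs].
exists (\sum_(k <- s) cr_emb (line (coord_sp h k))).
exists (\sum_(k <- s) at1 (line (coord_sp h k))); split=> //.
by apply: finrep_sum => k; exact: finrep_emb.
Qed.

(* The left regular representation on the completion of [B] for [E] is isometric:
   if [t - y] were not positive, its negative part [g] would satisfy
   [g y g >= t g^2], while [E (g y g)] is at most [r E (g^2)] in norm. *)
Lemma regular_norm_ge (y : B) (r : R) : pos y -> 0 <= r ->
  (forall g, nrm (E (star g ** y ** g)) <= r * nrm (E (star g ** g))) -> nrm y <= r.
Proof.
(* The slack [e] makes the two bounds on [E (g^* y g)] incompatible unless [E (g^* g)] vanishes;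
   then [g = 0] by faithfulness. *)
move=> py r0 hr; apply/ler_addgt0Pr => e e0; pose t := r + e.
have t0 : 0 <= t by rewrite /t; lra.
apply: pos_nrm_le_scal => //; pose a := t%:C *: cone - y.
have sa : star a = a by rewrite starB starZr star1 (pos_sa py).
have [p [pE pp pc]] := pos_sqrt (pos_sq sa).
have ap : a ** p = p ** a by apply: pc; rewrite cmulA.
pose g := p - a; have sg : star g = g by rewrite starB sa (pos_sa pp).
have ag : a ** g = - (p ** g) by rewrite /g cmulBr cmulBr ap pE; ncring.
have yE : y = t%:C *: cone - a by rewrite /a; ncring.
have gyg : star g ** y ** g = t%:C *: (star g ** g) + star g ** p ** g.
  transitivity (t%:C *: (star g ** g) - star g ** (a ** g)); first by rewrite yE; ncring.
  by rewrite ag; ncring.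
have h1 : t * nrm (E (star g ** g)) <= nrm (E (star g ** y ** g)).
  have := @nrm_pos_mono _ _ (t%:C *: E (star g ** g)) (E (star g ** y ** g)).
  rewrite nrmZr ger0_norm //; apply.
    by apply: posZ => //; apply: E_positive; exact: pos_starM.
  by rewrite gyg E_additive E_scale addrC addKr; apply/E_positive/pos_conj.
have := hr g => h2; have n0 := nrm_ge0 (E (star g ** g)).
have Eg : E (star g ** g) = 0.
  apply: nrm0_eq0; apply/eqP; rewrite eq_le n0 andbT.
  have : e * nrm (E (star g ** g)) <= 0 by move: h1; rewrite /t; lra.
  by rewrite pmulr_rle0.
have /eqP := ce_faithful (sg_cond G) Eg; rewrite subr_eq0 => /eqP pa.
by rewrite -/a -pa.
Qed.

(** An operator bound on the Hilbert module speaks of homogeneous sums only, whereas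
    [regular_norm_ge] tests on a negative part, which need not be one. Both sides are continuous in
    [g]. *)
Lemma E_conj_continuous (y : B) (r : R) : 0 <= r ->
  (forall g, sphomog g -> nrm (E (star g ** y ** g)) <= r * nrm (E (star g ** g))) ->
  forall g, nrm (E (star g ** y ** g)) <= r * nrm (E (star g ** g)).
Proof.
move=> r0 hy g.
have [u hu] : exists u : nat -> B, forall n, sphomog (u n) /\ nrm (g - u n) <= n.+1%:R^-1.
  have h n : exists b, sphomog b /\ nrm (g - b) <= n.+1%:R^-1.
    have [|b hb gb] := @sg_dense _ _ _ G g n.+1%:R^-1; last by exists b.
    by rewrite invr_gt0 ltr0n.
  by have [u hu] := choice h; exists u.
have ug : tendsto u g.
  move=> e /inv_archi[N hN]; exists N => n Nn; rewrite nrmBC.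
  apply: le_trans (proj2 (hu n)) _; apply: le_trans hN.
  by rewrite lef_pV2 ?posrE ?ltr0n // ler_nat.
have Elim (v : nat -> B) b : tendsto v b -> tendsto (fun n => E (v n)) (E b).
  by apply: (tendsto_lip (f := E) (C := 1)) => n; rewrite -E_sub mul1r; exact: E_contractive.
have l1 := Elim _ _ (tendstoM (tendstoMr y (tendsto_star ug)) ug).
have l2 := Elim _ _ (tendstoM (tendsto_star ug) ug).
apply/ler_addgt0Pr => e e0; pose d := e / (r + 2).
have d0 : 0 < d by rewrite divr_gt0 //; lra.
have de : d * (r + 2) = e by rewrite /d divfK // gt_eqF //; lra.
have [N1 h1] := l1 _ d0; have [N2 h2] := l2 _ d0.
have {}h1 := h1 _ (leq_maxl N1 N2); have {}h2 := h2 _ (leq_maxr N1 N2).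
move: h1 h2; set n := maxn N1 N2 => h1 h2.
have := hy _ (proj1 (hu n)).
have := nrm_leD (E (star g ** y ** g)) (E (star (u n) ** y ** u n)).
have := nrm_leD (E (star (u n) ** u n)) (E (star g ** g)).
rewrite (nrmBC (E (star g ** y ** g))).
move: h1 h2; set a := nrm (_ - _); set b := nrm (_ - _).
move: (nrm (E (star g ** g))) (nrm (E (star (u n) ** u n))).
move: (nrm (E (star g ** y ** g))) (nrm (E (star (u n) ** y ** u n))) => p q p' q'.
move=> h1 h2 h3 h4 h5.
have : r * q' <= r * (p' + d) by apply: ler_wpM2l => //; lra.
lra.
Qed.

(** On finite vectors [T] is left multiplication by [a]. The upper bound follows there from
    [a^* a <= nrm a ^2] and extends by density, for which the crude bound [C] supplies continuity.
    The lower bound is [regular_norm_ge] for [a^* a]. *)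
Lemma cr_norm n (k : 'I_n -> int) (x : forall i, F (gline (k i))) :
  is_opnorm (fun h : H => \sum_(i < n) cr_lmul (x i) h : H) `|\sum_(i < n) at1 (x i)|.
Proof.
set T := fun h : H => _; set a := \sum_(i < n) _.
have TD g h : T (g + h) = T g + T h.
  by rewrite /T -big_split; apply: eq_bigr => i _; exact: cr_lmulD.
have Tfin h b : finrep h b -> finrep (T h) (a ** b).
  move=> hb; rewrite /T /a cmul_suml; apply: finrep_sum => i; exact: finrep_lmul.
pose C := \sum_(i < n) nrm (at1 (x i)).
have C0 : 0 <= C by apply: sumr_ge0 => i _; exact: nrm_ge0.
have TC h : nrm (T h) <= C * nrm h.
  apply: le_trans (nrm_sum _ _ _) _; rewrite mulr_suml; apply: ler_sum => i _.
  exact: cr_lmul_nrm.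
have nrm_fin h b : finrep h b -> nrm h ^+ 2 = nrm (E (star b ** b)).
  by move=> hb; rewrite inner_nrm2 (finrep_inner hb hb).
split.
  split=> // h; rewrite !normE -rmorphM lecR.
  apply/ler_addgt0Pr => e e0; have K0 : 0 < C + nrm a + 1 by have := nrm_ge0 a; lra.
  pose d := e / (C + nrm a + 1); have d0 : 0 < d by rewrite divr_gt0.
  have de : d * (C + nrm a + 1) = e by rewrite /d divfK // gt_eqF.
  have [g [b [hb hg]]] := finrep_dense h d0.
  have fin : nrm (T g) <= nrm a * nrm g.
    rewrite -ler_sqr ?nnegrE ?mulr_ge0 ?nrm_ge0 // exprMn (nrm_fin _ _ hb).
    rewrite (nrm_fin _ _ (Tfin _ _ hb)) starM.
    have -> : star b ** star a ** (a ** b) = star b ** (star a ** a) ** b by ncring.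
    have := @nrm_pos_mono _ _ (E (star b ** (star a ** a) ** b))
      ((nrm a ^+ 2)%:C *: E (star b ** b)).
    rewrite nrmZr ger0_norm ?sqr_ge0 //; apply.
      exact/E_positive/pos_conj/pos_starM.
    rewrite -E_scale -E_sub; apply: E_positive.
    by have := pos_conj b (pos_le_sqnrm a); congr pos; ncring.
  have := TD (h - g) g; rewrite subrK => ->.
  have := nrmD (T (h - g)) (T g); have := TC (h - g).
  have h1 : nrm g <= nrm h + d by have := nrm_leD g h; rewrite nrmBC; lra.
  have : nrm a * nrm g <= nrm a * (nrm h + d) by rewrite ler_wpM2l ?nrm_ge0.
  have : C * nrm (h - g) <= C * d by rewrite ler_wpM2l.
  by move: fin; lra.
move=> c [c0 hc].
have [r r0 rE] : exists2 r : R, 0 <= r & c = r%:C.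
  exists (complex.Re c); last by rewrite RRe_real // realE c0.
  by move: c0; rewrite lecE => /andP[].
rewrite rE normE lecR -ler_sqr ?nnegrE ?nrm_ge0 // -nrm_starM.
apply: regular_norm_ge (pos_starM a) (sqr_ge0 r) _.
apply: E_conj_continuous (sqr_ge0 r) _ => g /homog_finrep[h hg].
have -> : star g ** (star a ** a) ** g = star (a ** g) ** (a ** g).
  by rewrite starM; ncring.
rewrite -(nrm_fin _ _ hg) -(nrm_fin _ _ (Tfin _ _ hg)) -exprMn.
rewrite ler_sqr ?nnegrE ?mulr_ge0 ?nrm_ge0 //.
by have := hc h; rewrite rE !normE -rmorphM lecR.
Qed.

(* The crossed product is realised on [B] itself. *)
Definition crossed : reduced_crossed F.
Proof.
refine (@ReducedCrossed R A F H cr_emb cr_modP cr_lmul cr_lmul_adj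
  (fun k l x y => cr_lmul_emb x y)
   B at1 _ _ _ _ _ cr_norm _).
- by [].
- by [].
- by move=> k l x y; rewrite at1_zmul.
- by rewrite at1_zF0 (star_hom1 (sg_hom G)).
- move=> k x; exists (line (sg_star (at1_sp x))) => // y.
  by apply: line_ext; rewrite at1_zmul ?addNr // at1_zF0 at1_inner.
- apply/dense_approx => b e e0; have [c hc bc] := @sg_dense _ _ _ G b _ e0.
  exists c => //.
  have [s ->] : exists s : seq {k : int & {x : B | sp k x}},
      c = \sum_(p <- s) sval (projT2 p).
    elim: hc => [|k x y hx _ [s ->]]; first by exists [::]; rewrite big_nil.
    exists (existT _ k (exist _ x hx) :: s); by rewrite big_cons.
  rewrite (big_nth (existT _ 0 (exist _ 0 (cs0 _)))) big_mkord.
  eexists; exists (fun=> 1); eexists; split; last first.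
    by apply: eq_bigr => i _; rewrite scale1r.
  move=> i /=; case: (nth _ _ _) => k [y hy] /=.
  by exists k => //; exists (line hy).
Defined.

Lemma crossed_iso : star_iso B crossed.
Proof. by exists id; split=> //; exists id. Qed.

Lemma PQN_dense : dense (PQN iota E).
Proof.
apply/dense_approx => b e e0; have [c hc bc] := @sg_dense _ _ _ G b _ e0.
exists c => // {b e e0 bc}.
(* Components of equal degree are merged: with distinct degrees [E] kills the cross terms of
   [(k x)^* k y], so that [k] preserves inner products. *)
have [s [us [f [fS cE]]]] : exists s : seq int, uniq s /\
    exists f : int -> B, (forall k, sp k (f k)) /\ c = \sum_(k <- s) f k.
  elim: hc => [|k x y hx _ [s [us [f [fS ->]]]]].
    by exists [::]; split=> //; exists (fun=> 0); split; [move=> k; exact: cs0|rewrite big_nil].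
  have [ks|ks] := boolP (k \in s).
    exists s; split=> //; exists (fun j => (if j == k then x else 0) + f j); split.
      by move=> j; apply: csD => //; case: eqP => [->//|_]; exact: cs0.
    rewrite big_split /=; congr (_ + _); rewrite (bigD1_seq k) //= eqxx.
    by rewrite big1 ?addr0 // => j /negbTE ->.
  exists (k :: s); split; first by rewrite /= ks.
  exists (fun j => if j == k then x else f j); split.
    by move=> j; case: eqP => [->|].
  rewrite big_cons eqxx; congr (_ + _); apply: eq_big_seq => j js.
  by case: eqP => // jk; rewrite -jk js in ks.
pose deg (i : 'I_(size s)) := tnth (in_tuple s) i.
have deg_inj : injective deg by apply/tuple_uniqP.
pose K := bimod G deg.
pose k (x : K) : B := \sum_i (x : fam G deg) i.
have kin (x y : K) : inner x y = E (star (k x) ** k y).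
  apply: (iota_inj (G := G)); rewrite bimod_innerE -/(fam_inner _ _) iota_inner ip_finE.
  rewrite /k star_sum cmul_suml E_sum (hom_sum (sg_hom G)); apply: eq_bigr => i _.
  rewrite cmul_sumr E_sum (bigD1 i) //= big1 => [|j ji].
    by rewrite addr0 sg_iotaE //; exact: sp_starM (famS x i) (famS y i).
  apply: (sg_E0 (k := deg j - deg i)).
    by rewrite subr_eq0; apply: contra ji => /eqP/deg_inj ->.
  by apply: spMK (sg_star (famS x i)) (famS y j) _ _; rewrite addrC.
have klin (a : R[i]) x y : k (a *: x + y) = a *: k x + k y.
  by rewrite /k scaler_sumr -big_split; apply: eq_bigr => i _.
exists K, k; split=> //.
- exact: bimod_fgp.
(* Injectivity comes from preservation of inner products, [kin], applied to [x - y]. *)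
- split=> // x y kxy; apply/eqP; rewrite -subr_eq0; apply/eqP/inner_eq0P.
  rewrite kin -[x - y]addrC -scaleN1r klin kxy scaleN1r addNr cmul0r; exact: E_zero.
- move=> a x b'; rewrite /k cmul_sumr cmul_suml; apply: eq_bigr => i _.
  by rewrite bimod_lactE bimod_ractE cmulA.
- exists (mkfin (fun i => fS (deg i))) => //.
  by rewrite cE big_tnth.
Qed.

Lemma sg_discrete : cstar_discrete iota E.
Proof. by split; [exact: sg_incl|exact: sg_cond|exact: PQN_dense]. Qed.

End CrossedProduct.

Theorem theoremA (R : realType) (D : cstarType R) (X : corr D D)
    (X_fgp : fgp X) (X_full : full X) (X_inj : lact_injective X)
    (O : cuntz_pimsner X)
    (gam : R[i] -> O -> O) (gamP : gauge_action gam)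
    (OT : cstarType R) (iota : OT -> O) (iota_incl : cstar_incl iota)
    (iota_range : range iota = fixed_points gam)
    (E : O -> OT)
    (E_avg : forall x : O, circle_integral (fun z => gam z x) (iota (E x))) :
  cstar_discrete iota E /\
  exists F : Zaction OT, exists P : reduced_crossed F, star_iso O P.
Proof.
have ghom : forall z : R[i], `|z| = 1 -> star_hom (gam z) := ga_hom gamP.
pose S k := CSub (spec_closed ghom (k := k)) (spec0 ghom k) (spec_lin ghom (k := k)).
pose G := @StrongGrading R O OT S iota E (specM ghom) (spec_star ghom) iota_incl
  (E_faithful_cond_exp ghom iota_incl iota_range E_avg (homog_dense_cp gamP))
  (iota_spec iota_range)
  (iotaE iota_incl iota_range E_avg)
  (E_spec iota_incl E_avg)
  (homog_dense_cp gamP)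
  (fun k => spec_frames gamP k X_fgp X_full).
split; first exact: (sg_discrete G).
by exists (action G), (crossed G); exact: crossed_iso.
Qed.
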